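(* Let $\vartheta\in(0,\infty)$ and $a\in\mathbb R$. Suppose $\boldsymbol\gamma=\{\gamma_n\}_{n=0}^\infty$ is an S-indeterminate Stieltjes moment sequence and $\beta$ is its Friedrichs measure. Let $\psi_{\vartheta,a}(t)=\vartheta(t+a)$ for $t\in\mathbb R$, let $T_{\vartheta,a}\boldsymbol\gamma$ be the sequence $(T_{\vartheta,a}\boldsymbol\gamma)_n=\sum_{j=0}^n\binom nj a^{n-j}\vartheta^n\gamma_j$, $n\in\mathbb Z_+$, and put $c:=\psi_{\vartheta,a}(\inf\mathrm{supp}(\beta))$. Then $T_{\vartheta,a}\boldsymbol\gamma$ is an H-indeterminate Hamburger moment sequence and the following holds: (i) if $c>0$, then $T_{\vartheta,a}\boldsymbol\gamma$ is an S-indeterminate Stieltjes moment sequence and $\beta\circ\psi_{\vartheta,a}^{-1}$ is the Friedrichs measure of $T_{\vartheta,a}\boldsymbol\gamma$, (ii) if $c=0$, then $T_{\vartheta,a}\boldsymbol\gamma$ is an S-determinate Stieltjes moment sequence, (iii) if $c<0$, then $T_{\vartheta,a}\boldsymbol\gamma$ is not a Stieltjes moment sequence.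
   Context: $\mathbb Z_+=\{0,1,2,\ldots\}$, $\mathbb R_+=[0,\infty)$, $0^0=1$; all measures are positive; $\mathrm{supp}(\nu)$ is the closed support of $\nu$; $(\beta\circ\psi_{\vartheta,a}^{-1})(\sigma)=\beta(\psi_{\vartheta,a}^{-1}(\sigma))$ for Borel $\sigma\subseteq\mathbb R$. Let $\mathscr M$ be the set of Borel measures $\nu$ on $\mathbb R$ with $\int|t|^n\,d\nu<\infty$ for all $n\in\mathbb Z_+$, and $\mathscr M^+=\{\nu\in\mathscr M:\mathrm{supp}(\nu)\subseteq\mathbb R_+\}$. A real sequence $\{\gamma_n\}_{n=0}^\infty$ is a Hamburger (resp. Stieltjes) moment sequence if there is $\nu\in\mathscr M$ (resp. $\mathscr M^+$) with $\gamma_n=\int t^n\,d\nu(t)$ for all $n\in\mathbb Z_+$; such $\nu$ are its H-representing (resp. S-representing) measures. It is H-determinate (resp. S-determinate) if there is exactly one H-representing (resp. S-representing) measure; otherwise H-indeterminate (resp. S-indeterminate). An H-representing measure $\nu$ of an H-indeterminate Hamburger moment sequence $\boldsymbol\gamma$ is N-extremal if the complex polynomials are dense in $L^2(\nu)$; $\mathscr M_e(\boldsymbol\gamma)$ is the set of all N-extremal measures of $\boldsymbol\gamma$ and $\mathscr M_e^+(\boldsymbol\gamma)=\mathscr M_e(\boldsymbol\gamma)\cap\mathscr M^+$. If $\boldsymbol\gamma$ is an S-indeterminate Stieltjes moment sequence (it is then H-indeterminate), there exist distinct $\alpha,\beta\in\mathscr M_e^+(\boldsymbol\gamma)$, uniquely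 determined by the requirement that $0=\inf\mathrm{supp}(\alpha)<\inf\mathrm{supp}(\rho)<\inf\mathrm{supp}(\beta)$ for every $\rho\in\mathscr M_e^+(\boldsymbol\gamma)\setminus\{\alpha,\beta\}$; $\alpha$ is the Krein measure and $\beta$ the Friedrichs measure of $\boldsymbol\gamma$. *)

(* Defs.v *)
(* The real line is an arbitrary [R : realType], with its
   canonical Borel sigma-algebra. *)
From HB Require Import structures.
From mathcomp Require Import all_boot all_order all_algebra.
From mathcomp Require Import complex.
From mathcomp Require Import all_classical all_reals all_analysis measurable_realfun.

Set Implicit Arguments.
Unset Strict Implicit.
Unset Printing Implicit Defensive.

Import Order.TTheory GRing.Theory Num.Theory.
Import numFieldNormedType.Exports.

Local Open Scope classical_set_scope.
Local Open Scope ring_scope.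

Section moment_problem.
Context {R : realType}.
Implicit Types (mu nu rho : {measure set R -> \bar R}) (gamma : nat -> R).

(* A {measure set R -> \bar R} is a function on all subsets of R that is
   constrained only on the Borel ones, so equality of Borel measures is
   agreement on Borel sets and not Leibniz equality. *)
Definition measure_eq mu nu : Prop :=
  forall A : set R, measurable A -> mu A = nu A.

Definition supp nu : set R :=
  [set x | forall U : set R, open U -> U x -> (0 < nu U)%E].

Definition finite_moments nu : Prop :=
  forall n : nat, (\int[nu]_t (`|t| ^+ n)%:E < +oo)%E.

Definition H_representing gamma nu : Prop :=
  finite_moments nu /\ forall n : nat, (\int[nu]_t (t ^+ n)%:E = (gamma n)%:E)%E.

Definition S_representing gamma nu : Prop :=
  H_representing gamma nu /\ supp nu `<=` [set t | 0 <= t].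

Definition Hamburger gamma : Prop := exists nu, H_representing gamma nu.

Definition Stieltjes gamma : Prop := exists nu, S_representing gamma nu.

Definition H_determinate gamma : Prop :=
  exists nu, H_representing gamma nu /\
    forall mu, H_representing gamma mu -> measure_eq mu nu.

Definition S_determinate gamma : Prop :=
  exists nu, S_representing gamma nu /\
    forall mu, S_representing gamma mu -> measure_eq mu nu.

Definition H_indeterminate gamma : Prop :=
  Hamburger gamma /\ ~ H_determinate gamma.

Definition S_indeterminate gamma : Prop :=
  Stieltjes gamma /\ ~ S_determinate gamma.

Definition cL2norm nu (f : R -> R[i]) : \bar R :=
  Lnorm nu 2%:E (fun t => (Normc.normc (f t))%:E).

(* [R[i]] carries no sigma-algebra in the library; Borel measurability of a
   complex function is measurability of its real and imaginary parts. *)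
Definition in_cL2 nu (f : R -> R[i]) : Prop :=
  [/\ measurable_fun [set: R] (fun t => complex.Re (f t)),
      measurable_fun [set: R] (fun t => complex.Im (f t)) &
      (cL2norm nu f < +oo)%E].

Definition cpoly_dense nu : Prop :=
  forall f : R -> R[i], in_cL2 nu f ->
  forall e : R, 0 < e ->
  exists p : {poly R[i]},
    (cL2norm nu (fun t => (f t - p.[(t%:C)%C])%R) < e%:E)%E.

Definition N_extremal gamma nu : Prop :=
  [/\ H_indeterminate gamma, H_representing gamma nu & cpoly_dense nu].

Definition N_extremal_plus gamma nu : Prop :=
  N_extremal gamma nu /\ supp nu `<=` [set t | 0 <= t].

(* [inf] is the real infimum; all the supports below are nonempty and bounded
   from below because gamma is S-indeterminate. *)
Definition Krein_Friedrichs_pair gamma (alpha beta : {measure set R -> \bar R})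
    : Prop :=
  [/\ S_indeterminate gamma,
      N_extremal_plus gamma alpha,
      N_extremal_plus gamma beta,
      ~ measure_eq alpha beta &
      0 = inf (supp alpha) /\
      forall rho, N_extremal_plus gamma rho ->
        ~ measure_eq rho alpha -> ~ measure_eq rho beta ->
        inf (supp alpha) < inf (supp rho) < inf (supp beta)].

Definition Friedrichs_measure gamma (beta : {measure set R -> \bar R}) : Prop :=
  exists alpha : {measure set R -> \bar R},
    Krein_Friedrichs_pair gamma alpha beta.

Definition psi (theta a t : R) : R := theta * (t + a).

Definition transform (theta a : R) gamma (n : nat) : R :=
  \sum_(j < n.+1) 'C(n, j)%:R * a ^+ (n - j) * theta ^+ n * gamma j.

Lemma measurable_psi (theta a : R) : measurable_fun [set: R] (psi theta a).
Proof.
by apply: measurable_funM => //; exact: measurable_funD.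
Qed.

Definition push_psi (theta a : R) nu : set R -> \bar R :=
  pushforward nu (psi theta a).

Section push_psi_measure.
Variables (theta a : R) (nu : {measure set R -> \bar R}).

Let push_psi0 : push_psi theta a nu set0 = 0%E.
Proof. by rewrite /push_psi /pushforward preimage_set0 measure0. Qed.

Let push_psi_ge0 A : (0 <= push_psi theta a nu A)%E.
Proof. exact: (measure_ge0 nu (psi theta a @^-1` A)). Qed.

Let push_psi_sigma_additive : semi_sigma_additive (push_psi theta a nu).
Proof.
move=> F mF tF mUF; rewrite /push_psi /pushforward preimage_bigcup.
have mpre A : measurable A -> measurable (psi theta a @^-1` A).
  by move=> mA; rewrite -[X in measurable X]setTI; exact: measurable_psi.
apply: measure_semi_sigma_additive => [n||]; first exact: mpre.
- apply/trivIsetP => /= i j _ _ ij; rewrite -preimage_setI.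
  by move/trivIsetP : tF => /(_ _ _ _ _ ij) ->//; rewrite preimage_set0.
- by rewrite -preimage_bigcup; exact: mpre.
Qed.

HB.instance Definition _ := isMeasure.Build _ _ _ (push_psi theta a nu)
  push_psi0 push_psi_ge0 push_psi_sigma_additive.

End push_psi_measure.

End moment_problem.

(* Main.v *)
Require Import Defs.
From HB Require Import structures.
From mathcomp Require Import all_boot all_order all_algebra.
From mathcomp Require Import complex.
From mathcomp Require Import all_classical all_reals all_analysis.
From mathcomp Require Import measurable_realfun ring lra.

Set Implicit Arguments.
Unset Strict Implicit.
Unset Precip_inting Implicit Defensive.

Import Order.TTheory GRing.Theory Num.Theory.
Import numFieldNormedType.Exports.

Local Open Scope classical_set_scope.
Local Open Scope ring_scope.

(** Pushing forward along psi(t) = theta * (t + a) maps the measures representing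
    gamma bijectively onto those representing the transformed sequence, keeps
    polynomials dense and moves supports by psi.  A representing measure of the
    transform on [0, +oo[ is thus a representing measure of gamma on [-a, +oo[,
    and the sign of c = theta * (b + a), where b is the infimum of the support of
    beta, tells on which side of b the point -a lies.  So the theorem follows
    from a description of the half-lines [x, +oo[ that carry a representing
    measure of gamma: none if x > b ([carried_le_Friedrichs_inf]), beta alone if
    x = b ([Friedrichs_unique]), and several if x < b: beta, and exactly one
    measure with dense polynomials whose support begins at x
    ([exists_extremal_below], [dense_unique]).  The latter, with x = -a, becomes
    the Krein measure of the transform.

    Three facts carry this description.

    Local bounds.  If alpha and beta are distinct, have the same moments and live
    on [x, +oo[, then p |-> p(x - 1) is bounded for the L2 norm on polynomials.
    Otherwise 1 / (t - x + 1) would be a limit of polynomials in L2(alpha + beta);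
    then the polynomials would be dense there ([papprox_all]), and alpha would be
    equal to beta, indicators being approximated in both spaces at the same time
    ([measure_eq_of_density]).  Boundedness at x - 1 propagates to locally uniform
    bounds on values and derivatives through a Volterra-type recurrence for the
    orthonormal polynomials and a discrete Gronwall inequality
    ([locally_bounded_of_eval]).

    Extremal masses.  For any measure with these moments, the mass of {x} is at
    most m(x) = inf { int p^2 : p(x) = 1 }.  If a measure on [x, +oo[ reaches m(x),
    then the polynomials are dense in its L2 space ([extremal_mass_recip],
    [papprox_all]); conversely density makes every support point reach it
    ([extremal_mass_dense]).  Two measures on [x, +oo[ that both reach m(x) are
    equal, because extremality passes to their sum, in whose L2 space the
    polynomials are then dense ([measure_eq_of_extremal_mass]).

    Existence.  If int (t - x) q^2 >= 0 for all q, then p |-> int p - m(x) p(x) is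
    still nonnegative on q^2 and on (t - x) q^2, so it is given by a measure on
    [x, +oo[ ([moment_representation]: sums of squares, extension of positive
    functionals by Zorn's lemma, a Stieltjes measure).  Adding the mass m(x) at x
    yields a representing measure with extremal mass at x ([exists_extremal]).

    If int (t - y) q^2 d(beta) were nonnegative for all q and some y > b, the last
    point would produce an N-extremal measure supported in [y, +oo[, against the
    maximality of b.  Hence these forms take negative values for all y > b, which
    excludes representing measures on [y, +oo[, and forces every one on [b, +oo[
    to have extremal mass at b ([extremal_mass_of_small_form]), so that it is
    beta. *)

(** * Integrals against measures carried by a half-line *)

Section half_line_integrals.
Context {R : realType}.
Implicit Types (mu nu : {measure set R -> \bar R}) (f g : R -> R) (x : R)
  (p q : {poly R}).

(** Having support in [x, +oo[, in the form in which integrals use it. *)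
Definition carried nu x := nu [set t | t < x] = 0%E.

Definition intble nu f := nu.-integrable [set: R] (EFin \o f).

Lemma measurable_lt x : measurable [set t : R | t < x].
Proof.
have -> : [set t : R | t < x] = `]-oo, x[%classic.
  by apply/seteqP; split=> t /=; rewrite in_itv.
exact: measurable_itv.
Qed.

Lemma carried_ae nu x (P : R -> Prop) : carried nu x ->
  (forall t, x <= t -> P t) -> {ae nu, forall t, P t}.
Proof.
move=> cx Px; exists [set t | t < x]; split=> //; first exact: measurable_lt.
by move=> t /= nP; rewrite ltNge; apply/negP => /Px.
Qed.

Lemma intble_meas nu f : intble nu f -> measurable_fun setT f.
Proof. by move=> /(measurable_int nu)/measurable_EFinP. Qed.

Lemma intble_le nu x f g : carried nu x -> measurable_fun setT f -> intble nu g ->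
  (forall t, x <= t -> `|f t| <= g t) -> intble nu f.
Proof.
move=> cx mf /integrableP[mg ig] fg; apply/integrableP; split.
  exact/measurable_EFinP.
apply: le_lt_trans ig; apply: ae_ge0_le_integral => //.
- by apply: measurableT_comp => //; exact/measurable_EFinP.
- exact: measurableT_comp.
- apply: carried_ae cx _ => t xt _ /=; rewrite lee_fin.
  exact: le_trans (fg _ xt) (ler_norm _).
Qed.

Lemma eq_intble nu f g : f =1 g -> intble nu f -> intble nu g.
Proof. by move=> fg; rewrite /intble (_ : f = g)//; apply/funext. Qed.

Lemma intbleD nu f g : intble nu f -> intble nu g -> intble nu (fun t => f t + g t).
Proof. by move=> If Jg; have := integrableD measurableT If Jg. Qed.

Lemma intbleZ nu c f : intble nu f -> intble nu (fun t => c * f t).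
Proof. by move=> If; have := integrableZl measurableT c If. Qed.

Lemma intbleB nu f g : intble nu f -> intble nu g -> intble nu (fun t => f t - g t).
Proof. by move=> If Jg; have := integrableB measurableT If Jg. Qed.

Lemma intD nu f g : intble nu f -> intble nu g ->
  \int[nu]_t (f t + g t) = \int[nu]_t f t + \int[nu]_t g t.
Proof. by move=> If Jg; rewrite RintegralD. Qed.

Lemma intB nu f g : intble nu f -> intble nu g ->
  \int[nu]_t (f t - g t) = \int[nu]_t f t - \int[nu]_t g t.
Proof. by move=> If Jg; rewrite RintegralB. Qed.

Lemma intZ nu c f : intble nu f -> \int[nu]_t (c * f t) = c * \int[nu]_t f t.
Proof. by move=> If; rewrite RintegralZl. Qed.

Lemma le_int nu x f g : carried nu x -> intble nu f -> intble nu g ->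
  (forall t, x <= t -> f t <= g t) -> \int[nu]_t f t <= \int[nu]_t g t.
Proof.
move=> cx If Jg fg; rewrite -subr_ge0 -intB// /Rintegral.
have mfg : measurable_fun setT (fun t => g t - f t).
  by apply: measurable_funB; [exact: intble_meas Jg|exact: intble_meas If].
rewrite (_ : (\int[nu]_t _)%E =
    (\int[nu]_t (`|g t - f t|)%:E)%E); last first.
  apply: ae_eq_integral => //.
  - exact/measurable_EFinP.
  - by apply/measurable_EFinP; exact: measurableT_comp.
  - by apply: carried_ae cx _ => t xt _; rewrite ger0_norm// subr_ge0 fg.
by rewrite fine_ge0// integral_ge0// => t _; rewrite lee_fin.
Qed.

Lemma int_ge0 nu f : (forall t, 0 <= f t) -> 0 <= \int[nu]_t f t.
Proof. by move=> f0; apply: Rintegral_ge0. Qed.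

Lemma intE nu f : intble nu f -> (\int[nu]_t (f t)%:E = (\int[nu]_t f t)%:E)%E.
Proof. by move=> If; rewrite /Rintegral fineK//; exact: integrable_fin_num. Qed.

(** Domination and convergence are asked on [x, +oo[ only: the rest of the line
    is negligible. *)
Lemma dominated_cvg_int nu x (F : nat -> R -> R) f g : carried nu x ->
  (forall n, measurable_fun setT (F n)) -> measurable_fun setT f -> intble nu g ->
  (forall n t, x <= t -> `|F n t| <= g t) ->
  (forall t, x <= t -> F n t @[n --> \oo] --> f t) ->
  intble nu f /\ \int[nu]_t F n t @[n --> \oo] --> \int[nu]_t f t.
Proof.
move=> cx mF mf Jg Fg Ff.
have [] := @dominated_convergence _ _ _ nu setT measurableT
   (fun n => EFin \o F n) (EFin \o f) (EFin \o g).
- by move=> n; exact/measurable_EFinP.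
- exact/measurable_EFinP.
- apply: carried_ae cx _ => t xt _; apply/fine_cvgP; split; last exact: Ff.
  exact: nearW.
- exact: Jg.
- by apply: carried_ae cx _ => t xt n _ /=; rewrite lee_fin Fg.
move=> If _ h; split => //.
rewrite /Rintegral; apply: fine_cvg.
by rewrite fineK//; exact: integrable_fin_num.
Qed.

Lemma measurable_horner p : measurable_fun setT (fun t => p.[t]).
Proof. by apply: continuous_measurable_fun; exact: continuous_horner. Qed.

End half_line_integrals.

(** * Square-integrable functions and polynomial approximation *)
Section polynomial_closure.
Context {R : realType}.
Implicit Types (nu : {measure set R -> \bar R}) (f g h : R -> R) (x : R)
  (p q : {poly R}).

Lemma intble_sum nu (I : Type) (s : seq I) (F : I -> R -> R) :
  (forall i, intble nu (F i)) -> intble nu (fun t => \sum_(i <- s) F i t).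
Proof.
move=> IF; elim: s => [|i s IH].
  apply: (@eq_intble _ _ (fun=> 0)) => [t|]; first by rewrite big_nil.
  exact: integrable0.
by apply: eq_intble (intbleD (IF i) IH) => t; rewrite big_cons.
Qed.

Lemma intble_pow nu n : finite_moments nu -> intble nu (fun t => t ^+ n).
Proof.
move=> /(_ n) fm; apply/integrableP; split.
  apply/measurable_EFinP; exact: measurable_funX.
by under eq_integral do rewrite /= normrX.
Qed.

Lemma intble_poly nu p : finite_moments nu -> intble nu (fun t => p.[t]).
Proof.
move=> fm; apply: eq_intble (_ : intble nu (fun t => \sum_(i < size p) p`_i * t ^+ i)).
  by move=> t; rewrite horner_coef.
by apply: intble_sum => i; apply: intbleZ; exact: intble_pow.
Qed.

Definition L2 nu f := measurable_fun setT f /\ intble nu (fun t => f t ^+ 2).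

Definition sqnorm nu f := \int[nu]_t (f t ^+ 2).

Lemma L2_poly nu p : finite_moments nu -> L2 nu (fun t => p.[t]).
Proof.
move=> fm; split; first exact: measurable_horner.
by apply: eq_intble (intble_poly (p ^+ 2) fm) => t; rewrite horner_exp.
Qed.

Lemma eq_L2 nu f g : f =1 g -> L2 nu f -> L2 nu g.
Proof. by move=> fg; rewrite (_ : f = g)//; apply/funext. Qed.

Lemma L2M nu f g : L2 nu f -> L2 nu g -> intble nu (fun t => f t * g t).
Proof.
move=> [mf If] [mg Jg].
apply: (@le_integrable _ _ _ nu setT measurableT _
  (EFin \o (fun t => f t ^+ 2 + g t ^+ 2))) (intbleD If Jg).
  by apply/measurable_EFinP; apply: measurable_funM.
move=> t _ /=; rewrite lee_fin.
by rewrite [leRHS]ger0_norm ?ler_norml; [nra|nra].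
Qed.

Lemma L2D nu f g : L2 nu f -> L2 nu g -> L2 nu (fun t => f t + g t).
Proof.
move=> Lf Lg; split; first by apply: measurable_funD; [case: Lf|case: Lg].
apply: eq_intble (intbleD (intbleD (proj2 Lf) (proj2 Lg)) (intbleZ 2 (L2M Lf Lg))) => t.
by ring.
Qed.

Lemma L2Z nu c f : L2 nu f -> L2 nu (fun t => c * f t).
Proof.
move=> [mf If]; split; first by apply: measurable_funM.
by apply: eq_intble (intbleZ (c ^+ 2) If) => t; ring.
Qed.

Lemma L2B nu f g : L2 nu f -> L2 nu g -> L2 nu (fun t => f t - g t).
Proof.
by move=> Lf Lg; apply: eq_L2 (L2D Lf (L2Z (-1) Lg)) => t; rewrite mulN1r.
Qed.

Lemma L2_le nu x f g : carried nu x -> measurable_fun setT f -> L2 nu g ->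
  (forall t, x <= t -> `|f t| <= `|g t|) -> L2 nu f.
Proof.
move=> cx mf [mg Jg] fg; split=> //; apply: intble_le cx _ Jg _.
  exact: measurable_funX.
move=> t /fg fgt; rewrite normrX -(real_normK (num_real (g t))).
by rewrite lerXn2r// nnegrE.
Qed.

Lemma sqnorm_ge0 nu f : 0 <= sqnorm nu f.
Proof. by apply: int_ge0 => t; exact: sqr_ge0. Qed.

Lemma sqnorm_le nu x f g : carried nu x -> L2 nu f -> L2 nu g ->
  (forall t, x <= t -> `|f t| <= `|g t|) -> sqnorm nu f <= sqnorm nu g.
Proof.
move=> cx [mf If] [mg Jg] fg; apply: le_int cx If Jg _ => t /fg fgt.
rewrite -(real_normK (num_real (g t))) -(real_normK (num_real (f t))).
by rewrite lerXn2r// nnegrE.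
Qed.

Lemma sqnormZ nu c f : L2 nu f -> sqnorm nu (fun t => c * f t) = c ^+ 2 * sqnorm nu f.
Proof.
move=> [_ If]; rewrite /sqnorm -intZ//; congr (Rintegral _ _ _).
by apply/funext => t; rewrite exprMn.
Qed.

Lemma eq_sqnorm nu f g : f =1 g -> sqnorm nu f = sqnorm nu g.
Proof. by move=> fg; rewrite (_ : f = g)//; apply/funext. Qed.

Lemma int_le nu f g : intble nu f -> intble nu g -> (forall t, f t <= g t) ->
  \int[nu]_t f t <= \int[nu]_t g t.
Proof. by move=> If Jg fg; apply: le_Rintegral. Qed.

(** The cross term is absorbed with a weight e, which gives a constant as close
    to 1 as needed in front of one of the two terms. *)
Lemma sqnormD_le nu e f g : 0 < e -> L2 nu f -> L2 nu g ->
  sqnorm nu (fun t => f t + g t) <= (1 + e) * sqnorm nu f + (1 + e^-1) * sqnorm nu g.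
Proof.
move=> e0 Lf Lg; rewrite /sqnorm -intZ; last by case: Lf.
rewrite -intZ; last by case: Lg.
rewrite -intD; [|by apply: intbleZ; case: Lf|by apply: intbleZ; case: Lg].
apply: int_le; first by case: (L2D Lf Lg).
  by apply: intbleD; apply: intbleZ; [case: Lf|case: Lg].
move=> t; rewrite -subr_ge0.
rewrite [leRHS](_ : _ = e * (f t - e^-1 * g t) ^+ 2).
  by rewrite mulr_ge0 ?sqr_ge0// ltW.
by field; rewrite gt_eqF.
Qed.

Lemma sqnormD nu f g : L2 nu f -> L2 nu g ->
  sqnorm nu (fun t => f t + g t) <= 2 * sqnorm nu f + 2 * sqnorm nu g.
Proof. by move=> Lf Lg; have := sqnormD_le ltr01 Lf Lg; rewrite invr1. Qed.

(** Membership of the L2 closure of the polynomials. *)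
Definition papprox nu f := L2 nu f /\
  forall e, 0 < e -> exists p, sqnorm nu (fun t => f t - p.[t]) < e.

Lemma papprox_closed nu f : finite_moments nu -> L2 nu f ->
  (forall e, 0 < e -> exists g, papprox nu g /\ sqnorm nu (fun t => f t - g t) < e) ->
  papprox nu f.
Proof.
move=> fm Lf H; split=> // e e0.
have e4 : 0 < e / 4 by lra.
have [g [[Lg Pg] gf]] := H _ e4.
have [p gp] := Pg _ e4; exists p.
have -> : sqnorm nu (fun t => f t - p.[t]) =
    sqnorm nu (fun t => (f t - g t) + (g t - p.[t])).
  by apply: eq_sqnorm => t; ring.
have := sqnormD (L2B Lf Lg) (L2B Lg (L2_poly p fm)); lra.
Qed.

Lemma papprox_poly nu p : finite_moments nu -> papprox nu (fun t => p.[t]).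
Proof.
move=> fm; split; first exact: L2_poly.
move=> e e0; exists p; rewrite (@eq_sqnorm _ _ (fun t => 0 * p.[t])).
  by rewrite sqnormZ ?expr0n ?mul0r//; exact: L2_poly.
by move=> t; rewrite subrr mul0r.
Qed.

Lemma eq_papprox nu f g : f =1 g -> papprox nu f -> papprox nu g.
Proof. by move=> fg; rewrite (_ : f = g)//; apply/funext. Qed.

Lemma papproxD nu f g : finite_moments nu -> papprox nu f -> papprox nu g ->
  papprox nu (fun t => f t + g t).
Proof.
move=> fm [Lf Pf] [Lg Pg]; split; first exact: L2D.
move=> e e0; have e4 : 0 < e / 4 by lra.
have [p Hp] := Pf _ e4; have [q Hq] := Pg _ e4; exists (p + q).
rewrite (@eq_sqnorm _ _ (fun t => (f t - p.[t]) + (g t - q.[t]))).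
  have := sqnormD (L2B Lf (L2_poly p fm)) (L2B Lg (L2_poly q fm)); lra.
by move=> t; rewrite hornerD; ring.
Qed.

Lemma papproxZ nu c f : finite_moments nu -> papprox nu f ->
  papprox nu (fun t => c * f t).
Proof.
move=> fm [Lf Pf]; split; first exact: L2Z.
move=> e e0; have c0 : 0 < c ^+ 2 + 1 by rewrite ltr_wpDl// sqr_ge0.
have [p Hp] := Pf (e / (c ^+ 2 + 1)) (divr_gt0 e0 c0); exists (c *: p).
rewrite (@eq_sqnorm _ _ (fun t => c * (f t - p.[t]))).
  rewrite sqnormZ; last by apply: L2B => //; exact: L2_poly.
  rewrite ltr_pdivlMr// in Hp; apply: le_lt_trans Hp.
  by rewrite mulrC ler_wpM2l ?sqnorm_ge0// lerDl.
by move=> t; rewrite hornerZ; ring.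
Qed.

(** * Multipliers of the closure of the polynomials *)

(** Bounded functions that preserve the L2 closure of the polynomials.  They form
    an algebra closed under bounded pointwise limits; once it contains the
    resolvent 1 / (t - x + 1), it contains all indicators of Borel sets. *)
Definition multiplier nu x g := [/\ measurable_fun setT g,
  exists M, forall t, x <= t -> `|g t| <= M &
  forall f, papprox nu f -> papprox nu (fun t => g t * f t)].

Section multipliers.
Variables (nu : {measure set R -> \bar R}) (x : R).
Hypotheses (fm : finite_moments nu) (cx : carried nu x).

Lemma multiplier_cst c : multiplier nu x (cst c).
Proof.
split; first exact: measurable_cst; first by exists `|c|.
by move=> f Pf; exact: papproxZ.
Qed.

Lemma eq_multiplier f g : f =1 g -> multiplier nu x f -> multiplier nu x g.
Proof. by move=> fg; rewrite (_ : f = g)//; apply/funext. Qed.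

Lemma multiplierD f g : multiplier nu x f -> multiplier nu x g -> multiplier nu x (fun t => f t + g t).
Proof.
move=> [mf [M Mf] Pf] [mg [N Ng] Pg]; split; first exact: measurable_funD.
  by exists (M + N) => t xt; apply: le_trans (ler_normD _ _) _; apply: lerD; auto.
move=> h Ph; apply: eq_papprox (papproxD fm (Pf _ Ph) (Pg _ Ph)) => t; ring.
Qed.

Lemma multiplierM f g : multiplier nu x f -> multiplier nu x g -> multiplier nu x (fun t => f t * g t).
Proof.
move=> [mf [M Mf] Pf] [mg [N Ng] Pg]; split; first exact: measurable_funM.
  by exists (M * N) => t xt; rewrite normrM; apply: ler_pM; auto.
move=> h Ph; apply: eq_papprox (Pf _ (Pg _ Ph)) => t; ring.
Qed.

Lemma multiplierX g n : multiplier nu x g -> multiplier nu x (fun t => g t ^+ n).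
Proof.
move=> mg; elim: n => [|n IH]; first exact: (multiplier_cst 1).
by apply: eq_multiplier (multiplierM mg IH) => t; rewrite exprS.
Qed.

Lemma multiplier_sum (I : Type) (s : seq I) (F : I -> R -> R) :
  (forall i, multiplier nu x (F i)) -> multiplier nu x (fun t => \sum_(i <- s) F i t).
Proof.
move=> mF; elim: s => [|i s IH].
  by apply: eq_multiplier (multiplier_cst 0) => t; rewrite big_nil.
by apply: eq_multiplier (multiplierD (mF i) IH) => t; rewrite big_cons.
Qed.

Lemma norm_cvg_le (v : nat -> R) (l M : R) :
  v n @[n --> \oo] --> l -> (forall n, `|v n| <= M) -> `|l| <= M.
Proof.
move=> vl vM.
have cF : `|v n| @[n --> \oo] --> `|l| by exact: cvg_norm vl.
rewrite -(cvg_lim _ cF)//; apply: limr_le.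
  by apply/cvg_ex; eexists; exact: cF.
exact: nearW.
Qed.

Lemma papprox_dominated (F : nat -> R -> R) g h :
  (forall n, papprox nu (F n)) -> measurable_fun setT g -> L2 nu h ->
  (forall n t, x <= t -> `|F n t| <= `|h t|) ->
  (forall t, x <= t -> F n t @[n --> \oo] --> g t) -> papprox nu g.
Proof.
move=> PF mg Lh Fh Fg.
have gh t : x <= t -> `|g t| <= `|h t|.
  by move=> xt; exact: norm_cvg_le (Fg _ xt) (fun n => Fh n _ xt).
have Lg : L2 nu g := L2_le cx mg Lh gh.
apply: papprox_closed => // e e0.
have mF n : measurable_fun setT (F n) by case: (PF n) => -[].
have [_ cv] : intble nu (fun=> 0) /\ \int[nu]_t (g t - F n t) ^+ 2 @[n --> \oo] --> \int[nu]_t 0.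
  apply: (@dominated_cvg_int _ nu x _ _ (fun t => 4 * h t ^+ 2)) => //.
  - by move=> n; apply: measurable_funX; exact: measurable_funB.
  - by apply: intbleZ; case: Lh.
  - move=> n t xt; have := gh _ xt; have := Fh n _ xt.
    rewrite normrX -(real_normK (num_real (h t))).
    have := ler_normB (g t) (F n t); have := normr_ge0 (g t - F n t); nra.
  - move=> t xt; have -> : (0 : R) = (g t - g t) ^+ 2 by rewrite subrr expr0n.
    under eq_cvg do rewrite expr2; rewrite expr2.
    by apply: cvgM; apply: cvgB; [exact: cvg_cst|exact: Fg|exact: cvg_cst|exact: Fg].
have i0 : \int[nu]_t (0 : R) = 0 by rewrite /Rintegral integral0.
rewrite i0 in cv.
have /(cvgr_lt 0) /(_ _ e0) [n _ /(_ n (leqnn n))/= Hn] := cv.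
by exists (F n).
Qed.

Lemma multiplier_lim (G : nat -> R -> R) g (M : R) :
  (forall n, multiplier nu x (G n)) -> measurable_fun setT g ->
  (forall n t, x <= t -> `|G n t| <= M) ->
  (forall t, x <= t -> G n t @[n --> \oo] --> g t) -> multiplier nu x g.
Proof.
move=> mG mg GM Gg; split=> //.
  by exists M => t xt; exact: norm_cvg_le (Gg _ xt) (fun n => GM n _ xt).
move=> f Pf; have [[mf If] _] := Pf.
apply: (@papprox_dominated (fun n t => G n t * f t) _ (fun t => M * f t)).
- by move=> n; case: (mG n) => _ _; exact.
- exact: measurable_funM.
- by apply: L2Z; case: Pf.
- move=> n t xt; rewrite !normrM ler_wpM2r//; apply: le_trans (GM n _ xt) (ler_norm _).
- move=> t xt; apply: cvgM; [exact: Gg|exact: cvg_cst].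
Qed.

(** The exponential series of g is dominated by the exponential of a bound of g. *)
Lemma multiplier_exp g : multiplier nu x g -> multiplier nu x (fun t => expR (g t)).
Proof.
move=> mg; have [meas_g [M gM] _] := mg.
apply: (@multiplier_lim (fun n t => series (exp_coeff (g t)) n) _ (expR M)).
- move=> n; rewrite /series /=; apply: multiplier_sum => i.
  by apply: eq_multiplier (multiplierM (multiplierX i mg) (multiplier_cst (i`!%:R^-1))) => t.
- by apply: measurableT_comp => //; exact: measurable_expR.
- move=> n t xt; apply: (@le_trans _ _ (series (exp_coeff `|g t|) n)).
    rewrite /series /=; apply: le_trans (ler_norm_sum _ _ _) _.
    apply: ler_sum => i _; rewrite /exp_coeff /= normrM normrX.
    by rewrite [X in _ * X]ger0_norm.
  apply: (@le_trans _ _ (expR `|g t|)); last by rewrite ler_expR gM.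
  apply: nondecreasing_cvgn_le; last exact: is_cvg_series_exp_coeff.
  apply/nondecreasing_seqP => k; rewrite /series/= big_nat_recr//= lerDl.
  by apply: exp_coeff_ge0.
- by move=> t xt; exact: is_cvg_series_exp_coeff.
Qed.

(** Values to the left of x do not matter: f, as a constant sequence, converges
    to g on [x, +oo[. *)
Lemma multiplier_ext f g : multiplier nu x f -> measurable_fun setT g ->
  (forall t, x <= t -> f t = g t) -> multiplier nu x g.
Proof.
move=> mf mg fg; have [_ [M fM] _] := mf.
apply: (@multiplier_lim (fun=> f) g M) => // t xt.
by rewrite -fg//; exact: cvg_cst.
Qed.

(** The inner exponential tends to 0 or to infinity with the sign of y, the outer
    one turns this into 1 or 0. *)
Lemma cvg_double_exp (y : R) :
  expR (- (n%:R * expR (n%:R * y))) @[n --> \oo] --> ((y < 0)%R%:R : R).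
Proof.
have [y0|y0] := ltP y 0; last first.
  apply: (@squeeze_cvgr _ _ _ _ (cst 0) (fun n : nat => expR (- n%:R))).
  - apply: nearW => n /=; rewrite expR_ge0/= ler_expR lerN2.
    rewrite ler_peMr// -[leLHS]expR0 ler_expR mulr_ge0//.
  - exact: cvg_cst.
  - exact: cvgn_expR.
have w0 : (2 / y ^+ 2 / n%:R) @[n --> \oo] --> (0 : R).
  rewrite -[X in _ --> X](mulr0 (2 / y ^+ 2)); apply: cvgM; first exact: cvg_cst.
  apply/gtr0_cvgV0; first by near=> n; rewrite ltr0n; near: n; exact: nbhs_infty_gt.
  exact: cvgr_idn.
apply: (@squeeze_cvgr _ _ _ _ (fun n : nat => 1 - 2 / y ^+ 2 / n%:R) (cst 1)).
- near=> n.
  have n0 : 0 < n%:R :> R by rewrite ltr0n; near: n; exact: nbhs_infty_gt.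
  apply/andP; split; last by rewrite /= -expR0 ler_expR oppr_le0 mulr_ge0// expR_ge0.
  apply: le_trans (expR_ge1Dx _); rewrite lerD2l lerN2.
  have ny : 0 < n%:R * - y by rewrite mulr_gt0// oppr_gt0.
  have -> : n%:R * y = - (n%:R * - y) by ring.
  rewrite expRN.
  have H := expR_ge1Dxn 1 (ltW ny).
  have H2 : (n%:R * - y) ^+ 2 / 2 <= expR (n%:R * - y).
    by apply: le_trans H; rewrite lerDr.
  have -> : 2 / y ^+ 2 / n%:R = n%:R * ((n%:R * - y) ^+ 2 / 2)^-1.
    by field; apply/andP; split; rewrite ?(gt_eqF n0)//= ?lt_eqF.
  rewrite ler_pM2l// lef_pV2// ?posrE ?expR_gt0//.
  by rewrite divr_gt0// exprn_gt0.
- rewrite -[X in _ --> X]subr0; apply: cvgB => //; exact: cvg_cst.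
- exact: cvg_cst.
Unshelve. all: by end_near. Qed.

(** The indicator is the limit of exp (- n exp (n (c - g))). *)
Lemma multiplier_superlevel g (c : R) : multiplier nu x g ->
  multiplier nu x (\1_[set t | c < g t]).
Proof.
move=> mg; have [measg _ _] := mg.
have mE : measurable [set t | c < g t].
  have -> : [set t | c < g t] = setT `&` g @^-1` `]c, +oo[%classic.
    by apply/seteqP; split=> t /=; rewrite in_itv/= andbT; [move=> ?; split|case].
  exact: measg.
apply: (@multiplier_lim (fun n t => expR (- (n%:R * expR (n%:R * (c - g t))))) _ 1).
- move=> n; apply: multiplier_exp.
  apply: eq_multiplier (multiplierM (multiplier_cst (- n%:R)) (multiplier_exp
    (multiplierM (multiplier_cst n%:R) (multiplierD (multiplier_cst c) (multiplierM (multiplier_cst (-1)) mg))))) => t.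
  by rewrite /= mulNr mulN1r.
- exact: measurable_indic.
- move=> n t xt; rewrite ger0_norm; last exact: expR_ge0.
  rewrite -expR0 ler_expR oppr_le0.
  by apply: mulr_ge0 => //; exact: expR_ge0.
- move=> t xt; rewrite indicE (_ : (t \in _) = (c - g t < 0)).
    exact: cvg_double_exp.
  by rewrite subr_lt0; apply/idP/idP; rewrite inE.
Qed.

(** On [x, +oo[ this is 1 / (t - (x - 1)); the absolute value makes it positive
    and at most 1 on the whole line. *)
Definition recip t : R := (`|t - x| + 1)^-1.

Lemma recipE t : x <= t -> recip t = (t - (x - 1))^-1.
Proof.
by move=> xt; rewrite /recip ger0_norm ?subr_ge0//; congr (_^-1); ring.
Qed.

Lemma recip_gt0 t : 0 < recip t.
Proof. by rewrite invr_gt0 ltr_wpDl. Qed.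

Lemma recip_le1 t : recip t <= 1.
Proof. by rewrite invf_le1 ?lerDr// ltr_wpDl. Qed.

Lemma measurable_recip : measurable_fun setT recip.
Proof.
apply: continuous_measurable_fun => t.
apply: cvgV; first by rewrite gt_eqF// ltr_wpDl.
apply: cvgD; last exact: cvg_cst.
by apply: cvg_norm; apply: cvgB; [exact: cvg_id|exact: cvg_cst].
Qed.

Section recip_approximable.
Hypothesis Pu : papprox nu recip.

(** Dividing p by t - z, where z = x - 1, writes p / (t - z) as a polynomial plus
    p(z) / (t - z). *)
Lemma papprox_recipM p : papprox nu (fun t => recip t * p.[t]).
Proof.
pose z := x - 1.
have /factor_theorem[q pq] : root (p - p.[z]%:P) z.
  by rewrite rootE hornerD hornerN hornerC subrr.
have h := papproxD fm (papproxZ p.[z] fm Pu) (papprox_poly q fm).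
have Lh : L2 nu (fun t => recip t * p.[t]).
  apply: L2_le cx _ (L2_poly p fm) _.
    by apply: measurable_funM; [exact: measurable_recip|exact: measurable_horner].
  move=> t xt; rewrite normrM ler_piMl// ger0_norm ?recip_le1// ltW// recip_gt0//.
apply: (@papprox_dominated (fun=> fun t => p.[z] * recip t + q.[t]) _ (fun t => recip t * p.[t])) => //.
- by case: Lh.
- move=> n t xt; suff -> : p.[z] * recip t + q.[t] = recip t * p.[t] by [].
  have -> : p = q * ('X - z%:P) + p.[z]%:P by rewrite -pq subrK.
  rewrite !hornerE recipE// -/z; field; rewrite subr_eq0 gt_eqF//.
  by rewrite /z; lra.
- move=> t xt; suff -> : p.[z] * recip t + q.[t] = recip t * p.[t] by exact: cvg_cst.
  have -> : p = q * ('X - z%:P) + p.[z]%:P by rewrite -pq subrK.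
  rewrite !hornerE recipE// -/z; field; rewrite subr_eq0 gt_eqF//.
  by rewrite /z; lra.
Qed.

Lemma multiplier_recip : multiplier nu x recip.
Proof.
split; first exact: measurable_recip.
  by exists 1 => t _; rewrite ger0_norm ?recip_le1// ltW// recip_gt0.
move=> f [Lf Pf].
have u1 (h : R -> R) t : `|recip t * h t| <= `|h t|.
  by rewrite normrM ler_piMl// ger0_norm ?recip_le1// ltW// recip_gt0.
have Lu h : L2 nu h -> L2 nu (fun t => recip t * h t).
  move=> Lf0; apply: (L2_le cx _ Lf0) => [|t _]; last exact: u1.
  by apply: measurable_funM; [exact: measurable_recip|case: Lf0].
apply: papprox_closed => //; first exact: Lu.
move=> e e0; have [p pf] := Pf _ e0.
exists (fun t => recip t * p.[t]); split; first exact: papprox_recipM.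
apply: le_lt_trans pf; apply: sqnorm_le cx _ _ _.
- by apply: L2B; [exact: Lu|exact: Lu (L2_poly p fm)].
- by apply: L2B => //; exact: L2_poly.
- by move=> t xt; rewrite -mulrBr (u1 (fun t => f t - p.[t])).
Qed.

(** Rays are superlevel sets of the reciprocal, which is decreasing. *)
Lemma multiplier_ray (s : R) : multiplier nu x (\1_`]-oo, s[).
Proof.
have [sx|xs] := leP s x.
  apply: multiplier_ext (multiplier_cst 0) _ _; first exact: measurable_indic.
  move=> t xt; rewrite indicE memNset//= in_itv/=; apply/negP.
  by rewrite -leNgt (le_trans sx).
apply: multiplier_ext (multiplier_superlevel (s - (x - 1))^-1 multiplier_recip) _ _.
  exact: measurable_indic.
move=> t xt; rewrite !indicE; congr (_%:R).
suff -> : (t \in [set t | (s - (x - 1))^-1 < recip t]) = (t \in `]-oo, s[%classic) by [].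
apply/idP/idP; rewrite !inE/= recipE// in_itv/= ltf_pV2 ?posrE//; lra.
Qed.

Lemma multiplier_setC A : multiplier nu x (\1_A) -> multiplier nu x (\1_(~` A)).
Proof.
move=> mA; apply: eq_multiplier (multiplierD (multiplier_cst 1) (multiplierM (multiplier_cst (-1)) mA)) => t.
rewrite /= !indicE in_setC; case: (t \in A) => /=; ring.
Qed.

Lemma multiplier_setU A B : multiplier nu x (\1_A) -> multiplier nu x (\1_B) ->
  multiplier nu x (\1_(A `|` B)).
Proof.
move=> mA mB.
apply: eq_multiplier (multiplierD mA (multiplierD mB (multiplierM (multiplier_cst (-1)) (multiplierM mA mB)))) => t.
rewrite /= !indicE in_setU; case: (t \in A); case: (t \in B) => /=; ring.
Qed.

Lemma multiplier_indic A : measurable A -> multiplier nu x (\1_A).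
Proof.
move=> mA; suff [] : measurable A /\ multiplier nu x (\1_A) by [].
rewrite -[X in X A]/((ocitv (R:=R)).-sigma.-measurable) RGenInftyO.measurableE in mA.
move: A mA; apply: smallest_sub; last first.
  by move=> _ [s ->]; split; [exact: measurable_itv|exact: multiplier_ray].
split.
- split; first exact: measurable0.
  by apply: eq_multiplier (multiplier_cst 0) => t; rewrite indicE in_set0.
- by move=> A [mA gA]; rewrite setTD; split; [exact: measurableC|exact: multiplier_setC].
- move=> A mA; split; first by apply: bigcupT_measurable => k; case: (mA k).
  apply: (@multiplier_lim (fun n => \1_(\big[setU/set0]_(i < n) A i)) _ 1).
  + elim=> [|n IH].
      by rewrite big_ord0; apply: eq_multiplier (multiplier_cst 0) => t; rewrite indicE in_set0.
    by rewrite big_ord_recr; apply: multiplier_setU => //; case: (mA n).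
  + by apply: measurable_indic; apply: bigcupT_measurable => k; case: (mA k).
  + by move=> n t xt; rewrite indicE; case: (_ \in _); rewrite ?normr0 ?normr1.
  + move=> t xt; have [[k _ Ak]|nA] := pselect ((\bigcup_k A k) t).
      apply: cvg_near_cst; near=> n; rewrite !indicE !mem_set//; first by exists k.
      apply: (@bigsetU_sup _ k n A) => //.
      near: n; exact: nbhs_infty_gt.
    rewrite indicE memNset//; apply: cvg_near_cst; apply: nearW => n.
    by rewrite indicE memNset// => h; apply: nA; exact: bigsetU_bigcup h.
Unshelve. all: by end_near. Qed.

Lemma multiplier_approx f n : measurable_fun setT f ->
  multiplier nu x (approx setT (EFin \o f) n).
Proof.
move=> mf; rewrite /approx; apply: multiplierD.
  apply: multiplier_sum => k; apply: multiplierM; first exact: multiplier_cst.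
  apply: multiplier_indic; rewrite /dyadic_approx; case: ifP => // _.
  have -> : [set t | (EFin \o f) t \in EFin @` [set` dyadic_itv R n k]] =
      f @^-1` [set` dyadic_itv R n k].
    apply/seteqP; split=> t /=; rewrite inE/=; first by case=> y yI [<-].
    by move=> ft; exists (f t).
  by rewrite setTI -[X in measurable X]setTI; apply: mf => //; exact: measurable_itv.
apply: multiplierM; first exact: multiplier_cst.
apply: multiplier_indic; rewrite /integer_approx setTI.
have -> : [set t | (n%:R%:E <= (EFin \o f) t)%E] = f @^-1` `[n%:R, +oo[%classic.
  by apply/seteqP; split=> t /=; rewrite lee_fin in_itv/= andbT.
by rewrite -[X in measurable X]setTI; apply: mf => //; exact: measurable_itv.
Qed.

Lemma papprox_ge0 f : L2 nu f -> (forall t, 0 <= f t) -> papprox nu f.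
Proof.
move=> Lf f0; have [mf _] := Lf.
have Ef0 t : setT t -> (0 <= (EFin \o f) t)%E by move=> _; rewrite lee_fin.
apply: (@papprox_dominated (approx setT (EFin \o f)) _ f) => //.
- move=> n; have [_ _ /(_ _ (papprox_poly 1 fm))] := multiplier_approx n mf.
  by apply: eq_papprox => t; rewrite hornerC mulr1.
- move=> n t _; rewrite !ger0_norm//.
    by rewrite -lee_fin; exact: (@le_approx _ _ _ setT (EFin \o f) n t Ef0).
  by rewrite /approx addr_ge0 ?sumr_ge0// => *; rewrite !mulr_ge0.
- move=> t _; have /fine_cvgP[_] := @ecvg_approx _ _ _ setT (EFin \o f) Ef0 t Logic.I.
  by apply.
Qed.

(** As soon as one resolvent is a limit of polynomials, indicators of Borel sets
    are multipliers, hence limits of polynomials, and with them all of L2. *)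
Lemma papprox_all f : L2 nu f -> papprox nu f.
Proof.
move=> Lf; have [mf If] := Lf.
have ma : measurable_fun setT (fun t => `|f t|) by exact: measurableT_comp.
have La : L2 nu (fun t => `|f t|).
  by apply: L2_le cx _ Lf _ => // t _; rewrite normr_id.
have Lp : papprox nu (fun t => 2^-1 * (`|f t| + f t)).
  apply: papprox_ge0; first by apply: L2Z; exact: L2D.
  by move=> t; have := ler_norm (- f t); rewrite normrN; lra.
have Ln : papprox nu (fun t => 2^-1 * (`|f t| - f t)).
  apply: papprox_ge0; first by apply: L2Z; exact: L2B.
  by move=> t; have := ler_norm (f t); lra.
by apply: eq_papprox (papproxD fm Lp (papproxZ (-1) fm Ln)) => t; field.
Qed.

End recip_approximable.
End multipliers.
End polynomial_closure.

(** * Point evaluations *)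
Section point_evaluations.
Context {R : realType}.
Implicit Types (nu rho : {measure set R -> \bar R}) (f g h : R -> R) (x : R)
  (p q r : {poly R}).

Definition psqnorm nu p := sqnorm nu (fun t => p.[t]).

Lemma psqnorm_ge0 nu p : 0 <= psqnorm nu p.
Proof. exact: sqnorm_ge0. Qed.

Lemma psqnormZ nu c p : finite_moments nu -> psqnorm nu (c *: p) = c ^+ 2 * psqnorm nu p.
Proof.
move=> fm; rewrite -sqnormZ; last exact: L2_poly.
by apply: eq_sqnorm => t; rewrite hornerZ.
Qed.

Definition mass nu (A : set R) := fine (nu A).

Lemma mass_ge0 nu A : 0 <= mass nu A.
Proof. exact: fine_ge0. Qed.

Lemma total_mass_fin nu : finite_moments nu -> (nu setT < +oo)%E.
Proof.
move=> /(_ 0%N); under eq_integral do rewrite expr0.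
by rewrite integral_cst// mul1e.
Qed.

Lemma mass_fin nu A : finite_moments nu -> measurable A -> (nu A < +oo)%E.
Proof.
by move=> fm mA; apply: le_lt_trans (total_mass_fin fm); apply: le_measure;
  rewrite ?inE.
Qed.

Lemma massE nu A : finite_moments nu -> measurable A -> nu A = (mass nu A)%:E.
Proof. by move=> fm mA; rewrite /mass fineK// ge0_fin_numE// mass_fin. Qed.

Lemma le_mass nu A B : finite_moments nu -> measurable A -> measurable B ->
  A `<=` B -> mass nu A <= mass nu B.
Proof.
by move=> fm mA mB AB; rewrite -lee_fin -!massE// le_measure ?inE.
Qed.

Lemma intble_cst nu c : finite_moments nu -> intble nu (cst c).
Proof. by move=> fm; apply: eq_intble (intble_poly c%:P fm) => t; rewrite hornerC. Qed.

Lemma intble_indic nu A : finite_moments nu -> measurable A -> intble nu (\1_A).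
Proof.
move=> fm mA; apply: (@le_integrable _ _ _ nu setT measurableT _
  (EFin \o cst 1)) (intble_cst 1 fm).
  by apply/measurable_EFinP; exact: measurable_indic.
by move=> t _ /=; rewrite lee_fin normr1 indicE; case: (_ \in _);
  rewrite ?normr1 ?normr0.
Qed.

Lemma int_indic nu A : measurable A -> \int[nu]_t (\1_A t) = mass nu A.
Proof. by move=> mA; rewrite /Rintegral integral_indic// setIT. Qed.

Lemma int_cst nu c : finite_moments nu -> \int[nu]_t c = c * mass nu setT.
Proof. by move=> fm; rewrite Rintegral_cst. Qed.

Lemma indic_sqr (A : set R) t : (\1_A t : R) ^+ 2 = \1_A t.
Proof. by rewrite indicE; case: (_ \in _); rewrite ?expr1n ?expr0n. Qed.

Lemma L2_indic nu A : finite_moments nu -> measurable A -> L2 nu (\1_A).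
Proof.
move=> fm mA; split; first exact: measurable_indic.
by apply: eq_intble (intble_indic fm mA) => t; rewrite indic_sqr.
Qed.

Lemma sqnorm_indic nu A : measurable A -> sqnorm nu (\1_A) = mass nu A.
Proof.
by move=> mA; rewrite -int_indic//; congr Rintegral; apply/funext => t;
  rewrite indic_sqr.
Qed.

Section sum_of_measures.
Variables nu rho : {measure set R -> \bar R}.
Let M : {measure set R -> \bar R} := measure_add nu rho.

Lemma finite_moments_add : finite_moments nu -> finite_moments rho ->
  finite_moments M.
Proof.
move=> fn fr n; rewrite ge0_integral_measure_add//.
- by rewrite lte_add_pinfty.
- apply/measurable_EFinP; apply: measurable_funX.
  by apply: measurableT_comp => //; exact: normr_measurable.
Qed.

Lemma carried_add x : carried nu x -> carried rho x -> carried M x.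
Proof.
by rewrite /carried => n0 r0; rewrite [M _](measure_addE nu rho) n0 r0 adde0.
Qed.

Lemma mass_add A : finite_moments nu -> finite_moments rho -> measurable A ->
  mass M A = mass nu A + mass rho A.
Proof.
move=> fn fr mA; rewrite /mass [M _](measure_addE nu rho).
by rewrite (massE fn mA) (massE fr mA).
Qed.

Lemma int_add f : intble nu f -> intble rho f ->
  intble M f /\ \int[M]_t f t = \int[nu]_t f t + \int[rho]_t f t.
Proof.
move=> nf rf.
have mf : measurable_fun setT (EFin \o f) := measurable_int _ nf.
have IM : intble M f.
  apply/integrableP; split => //; rewrite ge0_integral_measure_add//.
    move: nf rf => /integrableP[_ nf] /integrableP[_ rf].
    by rewrite lte_add_pinfty.
  exact: measurableT_comp.
split=> //; rewrite /Rintegral.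
have := @integral_measure_add _ _ _ nu rho setT measurableT (EFin \o f) nf rf.
move=> /= ->; rewrite fineD//; exact: integrable_fin_num.
Qed.

Lemma psqnorm_add p : finite_moments nu -> finite_moments rho ->
  psqnorm M p = psqnorm nu p + psqnorm rho p.
Proof.
move=> fn fr; apply: (int_add _ _).2.
  by case: (L2_poly p fn).
by case: (L2_poly p fr).
Qed.

End sum_of_measures.

Definition same_moments nu rho :=
  forall p, \int[nu]_t p.[t] = \int[rho]_t p.[t].

Lemma same_moments_psqnorm nu rho p : same_moments nu rho -> psqnorm nu p = psqnorm rho p.
Proof.
move=> mm; have := mm (p ^+ 2); rewrite /psqnorm /sqnorm => h.
by transitivity (\int[nu]_t (p ^+ 2).[t]); [|rewrite h];
  congr Rintegral; apply/funext => t; rewrite horner_exp.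
Qed.

(** Cauchy-Schwarz between f and 1, with the free parameter s in place of the
    square root. *)
Lemma abs_int_le nu f s : finite_moments nu -> L2 nu f -> 0 < s ->
  `|\int[nu]_t f t| <= s * mass nu setT + s^-1 * sqnorm nu f.
Proof.
move=> fm Lf s0.
have If : intble nu f.
  apply: eq_intble (L2M (L2_poly 1 fm) Lf) => t; by rewrite hornerC mul1r.
have IR : intble nu (fun t => s * 1 + s^-1 * f t ^+ 2).
  by apply: intbleD; [exact: intble_cst|apply: intbleZ; case: Lf].
have -> : s * mass nu setT + s^-1 * sqnorm nu f = \int[nu]_t (s * 1 + s^-1 * f t ^+ 2).
  rewrite intD; [|exact: intble_cst|by apply: intbleZ; case: Lf].
  by rewrite int_cst// mulr1 intZ//; case: Lf.
apply: le_trans (le_normr_Rintegral _ _) _ => //.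
apply: int_le => //; first exact: integrable_norm.
move=> t; rewrite mulr1 -(real_normK (num_real (f t))).
have sv : s * s^-1 = 1 by rewrite divff// gt_eqF.
have si : 0 < s^-1 by rewrite invr_gt0.
have := sqr_ge0 (s - `|f t|); have := normr_ge0 (f t) => a0 a1.
have -> : s + s^-1 * `|f t| ^+ 2 = s^-1 * ((s - `|f t|) ^+ 2 + 2 * s * `|f t|).
  by field; rewrite gt_eqF.
have {1}-> : `|f t| = s^-1 * (s * `|f t|) by field; rewrite gt_eqF.
have si' : s * `|f t| <= (s - `|f t|) ^+ 2 + 2 * s * `|f t| by nra.
by move: si'; rewrite -(ler_pM2l si).
Qed.

(** A polynomial close to an indicator in L2(nu + rho) is close to it in L2(nu)
    and in L2(rho), and it has the same integral for both measures. *)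
Lemma measure_eq_of_density nu rho x :
  let M : {measure set R -> \bar R} := measure_add nu rho in
  finite_moments nu -> finite_moments rho -> carried nu x -> carried rho x ->
  same_moments nu rho -> papprox M (recip x) -> measure_eq nu rho.
Proof.
move=> M fn fr cn cr mm Pu A mA.
have fM : finite_moments M by exact: finite_moments_add.
have cM : carried M x by exact: carried_add.
have [_ PA] := papprox_all fM cM Pu (L2_indic fM mA).
rewrite (massE fn mA) (massE fr mA); congr EFin; apply/eqP.
rewrite -subr_eq0 -normr_le0; apply/ler_addgt0Pr => e e0; rewrite add0r.
have T0 := mass_ge0 M setT.
pose s := e / (mass M setT + 1).
have s0 : 0 < s by rewrite divr_gt0// ltr_wpDl.
have [p Hp] := PA (s ^+ 2) (exprn_gt0 _ s0).
pose g t := \1_A t - p.[t].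
have Lg nu' : finite_moments nu' -> L2 nu' g.
  by move=> fm; apply: L2B; [exact: L2_indic|exact: L2_poly].
have intble' nu' : finite_moments nu' -> intble nu' g.
  by move=> fm; apply: intbleB; [exact: intble_indic|exact: intble_poly].
have E nu' : finite_moments nu' ->
    \int[nu']_t g t = mass nu' A - \int[nu']_t p.[t].
  by move=> fm; rewrite intB ?int_indic//; [exact: intble_indic|exact: intble_poly].
have -> : mass nu A - mass rho A = \int[nu]_t g t - \int[rho]_t g t.
  by rewrite !E// mm; ring.
apply: le_trans (ler_normB _ _) _.
apply: le_trans (lerD (abs_int_le fn (Lg _ fn) s0) (abs_int_le fr (Lg _ fr) s0)) _.
have -> : s * mass nu setT + s^-1 * sqnorm nu g + (s * mass rho setT + s^-1 * sqnorm rho g)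
   = s * mass M setT + s^-1 * sqnorm M g.
  rewrite mass_add// /sqnorm (int_add (Lg _ fn).2 (Lg _ fr).2).2; ring.
have : s^-1 * sqnorm M g <= s.
  by rewrite mulrC ler_pdivrMr// -expr2 ltW.
have -> : e = s * mass M setT + s by rewrite /s; field; rewrite gt_eqF// ltr_wpDl.
lra.
Qed.

Lemma L2_recip nu x : finite_moments nu -> carried nu x -> L2 nu (recip x).
Proof.
move=> fm cx; apply: (L2_le cx (measurable_recip x) (L2_poly 1 fm)) => t _.
by rewrite hornerC normr1 ger0_norm ?recip_le1// ltW// recip_gt0.
Qed.

Lemma recip_eq x t : x <= t -> recip x t * (t - (x - 1)) = 1.
Proof. by move=> xt; rewrite recipE// mulVf// gt_eqF//; lra. Qed.

Lemma div_by_root p z : exists q, p = p.[z]%:P + ('X - z%:P) * q.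
Proof.
have /factor_theorem[q pq] : root (p - p.[z]%:P) z.
  by rewrite rootE hornerD hornerN hornerC subrr.
by exists q; rewrite mulrC -pq addrC subrK.
Qed.

(** If evaluation at x - 1 is unbounded, there are polynomials q of small norm
    with q(x - 1) = 1.  Then q = 1 + (t - (x - 1)) r, and - r approximates
    1 / (t - (x - 1)) with the error q / (t - (x - 1)), smaller than q. *)
Lemma recip_or_bounded nu x : finite_moments nu -> carried nu x ->
  papprox nu (recip x) \/
  exists2 C, 0 < C & forall p, p.[x - 1] ^+ 2 <= C * psqnorm nu p.
Proof.
move=> fm cx; have [?|nC] := pselect (exists2 C, 0 < C &
  forall p, p.[x - 1] ^+ 2 <= C * psqnorm nu p); [by right|left].
split; first exact: L2_recip.
move=> e e0.
have [p Hp] : exists p, e^-1 * psqnorm nu p < p.[x - 1] ^+ 2.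
  apply: contrapT => np; apply: nC; exists e^-1; first by rewrite invr_gt0.
  by move=> p; rewrite leNgt; apply/negP => ?; apply: np; exists p.
have p0 : p.[x - 1] != 0.
  apply/eqP => p0; move: Hp; rewrite p0 expr0n/= ltNge.
  by rewrite mulr_ge0 ?psqnorm_ge0// invr_ge0 ltW.
pose q := p.[x - 1]^-1 *: p.
have q1 : q.[x - 1] = 1 by rewrite hornerZ mulVf.
have [r qr] := div_by_root q (x - 1).
exists (- r).
have -> : e = e * 1 by rewrite mulr1.
apply: (@le_lt_trans _ _ (psqnorm nu q)).
  apply: (sqnorm_le cx); [by apply: L2B; [exact: L2_recip|exact: L2_poly]|exact: L2_poly|].
  move=> t xt.
  have -> : recip x t - (- r).[t] = recip x t * q.[t].
    rewrite qr q1 hornerN hornerD hornerM hornerC hornerXsubC.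
    by rewrite mulrDr mulr1 mulrA recip_eq// mul1r opprK.
  rewrite normrM ler_piMl// ger0_norm ?recip_le1// ltW// recip_gt0//.
rewrite mulr1 /q psqnormZ// exprVn mulrC ltr_pdivrMr ?exprn_even_gt0//.
by rewrite -ltr_pdivrMl.
Qed.

(** The alternative cannot be density for the sum of the two measures, since
    that would identify them. *)
Lemma eval_bounded_left nu rho x :
  finite_moments nu -> finite_moments rho -> carried nu x -> carried rho x ->
  same_moments nu rho -> ~ measure_eq nu rho ->
  exists2 C, 0 < C & forall p, p.[x - 1] ^+ 2 <= C * psqnorm nu p.
Proof.
move=> fn fr cn cr mm ne.
have [/(measure_eq_of_density fn fr cn cr mm)//|[C C0 HC]] :=
  recip_or_bounded (finite_moments_add fn fr) (carried_add cn cr).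
exists (C * 2); first by rewrite mulr_gt0.
move=> p; apply: le_trans (HC p) _; rewrite psqnorm_add// -(same_moments_psqnorm p mm).
by rewrite -mulrA mulr2n mulrDl mul1r.
Qed.

(** * Extremal point masses *)

(** This is what remains, on the real line, of the local uniform convergence of
    the reproducing kernel of an indeterminate moment problem. *)
Definition locally_bounded nu := forall M : R, exists2 C, 0 < C &
  forall p t, `|t| <= M ->
    p.[t] ^+ 2 <= C * psqnorm nu p /\ p^`().[t] ^+ 2 <= C * psqnorm nu p.

(** Always int p^2 >= nu {x} when p(x) = 1; here the bound is sharp. *)
Definition extremal_mass nu x := forall k : R, 0 < k ->
  exists2 p, p.[x] = 1 & psqnorm nu p <= mass nu [set x] + k.

(** Let p(x) = 1 with int p^2 close to nu {x}: then p approximates the indicator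
    of {x}, and it is small off x.  Writing p = a + (t - (x - 1)) r, the polynomial
    (p - r) / a approximates 1 / (t - (x - 1)): the error is p / a times a function
    that vanishes at x and is bounded by 1.  The point is a lower bound for |a|.
    The polynomial s = (t - x) r has derivative 1 - a at x, vanishes at x, and is
    bounded by |p| + |a| elsewhere on [x, +oo[; if a were small, s would be small in
    L2, which contradicts the bound on derivatives. *)
Lemma extremal_mass_recip nu x : finite_moments nu -> carried nu x ->
  locally_bounded nu -> extremal_mass nu x -> papprox nu (recip x).
Proof.
move=> fm cx lb em; have [C C0 HC] := lb `|x|.
split; first exact: L2_recip.
move=> e e0.
have m0 := mass_ge0 nu setT; set m := mass nu setT in m0.
(* a ^ 2 < d would give (1 - a) ^ 2 < 1 / 4 and |a| < 1 / 2; and 2 k / d <= e. *)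
pose d := (16 * C * (m + 1) + 4)^-1.
have den0 : 0 < 16 * C * (m + 1) + 4 by rewrite ltr_wpDl// !mulr_ge0 ?ltW// ltr_wpDl.
have d0 : 0 < d by rewrite invr_gt0.
pose k := Num.min (16 * C)^-1 (e * d) / 2.
have kk0 : 0 < Num.min (16 * C)^-1 (e * d).
  by rewrite lt_min invr_gt0 !mulr_gt0.
have k0 : 0 < k by rewrite divr_gt0.
have [p px pn] := em _ k0.
have mx : measurable [set x] by exact: measurable_set1.
pose g t := p.[t] - \1_[set x] t.
have Lg : L2 nu g by apply: L2B; [exact: L2_poly|exact: L2_indic].
have gE t : g t ^+ 2 = p.[t] ^+ 2 - \1_[set x] t.
  rewrite /g indicE; have [->|tx] := eqVneq t x.
    by rewrite mem_set//= px; ring.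
  rewrite memNset/= ?subr0//; exact/eqP.
have gk : sqnorm nu g <= k.
  rewrite /sqnorm (_ : (fun t => _) = (fun t => p.[t] ^+ 2 - \1_[set x] t)).
    rewrite intB; [|by case: (L2_poly p fm)|exact: intble_indic].
    by rewrite int_indic// lerBlDl.
  exact/funext.
have g_off t : t != x -> g t = p.[t].
  by move=> tx; rewrite /g indicE memNset ?subr0//; exact/eqP.
set a := p.[x - 1].
have [r pr] := div_by_root p (x - 1); rewrite -/a in pr.
pose s := ('X - x%:P) * r.
have rx : s^`().[x] = 1 - a.
  rewrite /s derivM derivXsubC !hornerE subrr mul0r addr0.
  by have := px; rewrite pr !hornerE => <-; ring.
have [_ Hs] := HC s x (lexx _).
have gm := sqnorm_ge0 nu g.
have sn : psqnorm nu s <= 2 * sqnorm nu g + 2 * (a ^+ 2 * m).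
  have -> : a ^+ 2 * m = sqnorm nu (fun t => a * 1).
    by rewrite /sqnorm int_cst// mulr1.
  have La : L2 nu (fun t => a * 1).
    by apply: eq_L2 (L2_poly a%:P fm) => t; rewrite hornerC mulr1.
  apply: le_trans (_ : _ <= sqnorm nu (fun t => `|g t| + `|a * 1|)) _; last first.
    have := sqnormD (f := fun t => `|g t|) (g := fun t => `|a * 1|).
    have nn f : L2 nu f -> L2 nu (fun t => `|f t|) /\ sqnorm nu (fun t => `|f t|) = sqnorm nu f.
      move=> [mf If]; have E : (fun t => `|f t| ^+ 2) = (fun t => f t ^+ 2).
        by apply/funext => t; rewrite real_normK ?num_real.
      by split; [split; [exact: measurableT_comp|rewrite E]|rewrite /sqnorm E].
    have [Lg' Eg] := nn _ Lg; have [La' Ea] := nn _ La.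
    by move/(_ nu Lg' La'); rewrite Eg Ea.
  have nn f : L2 nu f -> L2 nu (fun t => `|f t|).
    move=> [mf If]; split; first exact: measurableT_comp.
    by apply: eq_intble If => t; rewrite real_normK ?num_real.
  apply: (sqnorm_le cx); [exact: L2_poly|by apply: L2D; exact: nn|].
  move=> t xt; rewrite [leRHS]ger0_norm ?addr_ge0// mulr1.
  have -> : s.[t] = (p.[t] - a) * ((t - x) * recip x t).
    have h := recip_eq xt.
    rewrite /s pr hornerD !hornerM hornerC !hornerXsubC [a + _]addrC addrK.
    transitivity ((t - x) * r.[t] * (recip x t * (t - (x - 1)))); last by ring.
    by rewrite h mulr1.
  have w0 : 0 <= (t - x) * recip x t by rewrite mulr_ge0 ?subr_ge0// ltW// recip_gt0.
  have w1 : (t - x) * recip x t <= 1.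
    have := recip_eq xt; have := recip_gt0 x t; nra.
  rewrite mulrBl; apply: le_trans (ler_normB _ _) _; apply: lerD.
    have [->|tx] := eqVneq t x; first by rewrite subrr mul0r mulr0 normr0.
    by rewrite g_off// normrM ler_piMr// ger0_norm.
  by rewrite normrM ler_piMr// ger0_norm.
have k1 : 2 * k <= (16 * C)^-1.
  by rewrite /k mulrC divfK// ge_min lexx.
have k2 : 2 * k <= e * d by rewrite /k mulrC divfK// ge_min lexx orbT.
have ad : d <= a ^+ 2.
  rewrite leNgt; apply/negP => ad.
  have c1 : C * (2 * k) <= 16^-1.
    have -> : 16^-1 = C * (16 * C)^-1 :> R by field; rewrite gt_eqF.
    by rewrite ler_pM2l.
  have c2 : 16 * C * (m + 1) * d + 4 * d = 1.
    by rewrite -mulrDl /d divff// gt_eqF.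
  have H1 : (1 - a) ^+ 2 <= C * (2 * sqnorm nu g + 2 * (a ^+ 2 * m)).
    by rewrite -rx; apply: le_trans Hs _; rewrite ler_pM2l.
  have H2 : C * sqnorm nu g <= C * k by rewrite ler_pM2l.
  have H3 : C * m * a ^+ 2 <= C * m * d by apply: ler_wpM2l; [rewrite mulr_ge0// ltW|exact: ltW].
  have H4 : 0 <= C * d by rewrite mulr_ge0// ltW.
  nra.
have a0 : a != 0.
  by apply/eqP => a0; move: ad; rewrite a0 expr0n/= leNgt d0.
exists (a^-1 *: (p - r)).
have Lq : L2 nu (fun t => a^-1 * g t) by exact: L2Z.
apply: (@le_lt_trans _ _ (sqnorm nu (fun t => a^-1 * g t))).
  apply: (sqnorm_le cx) => //; first by apply: L2B; [exact: L2_recip|exact: L2_poly].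
  move=> t xt.
  have -> : recip x t - (a^-1 *: (p - r)).[t] = a^-1 * (p.[t] * (recip x t - 1)).
    have h := recip_eq xt; rewrite hornerZ hornerD hornerN.
    have hp : p.[t] * recip x t = a * recip x t + r.[t].
      rewrite pr hornerD hornerM hornerC hornerXsubC.
      transitivity (a * recip x t + recip x t * (t - (x - 1)) * r.[t]); first by ring.
      by rewrite h mul1r.
    have -> : p.[t] * (recip x t - 1) = p.[t] * recip x t - p.[t] by ring.
    by rewrite hp; field; exact: a0.
  rewrite !normrM ler_wpM2l//.
  have [->|tx] := eqVneq t x.
    have := recip_eq (lexx x); have -> : x - (x - 1) = 1 by ring.
    by rewrite mulr1 => ->; rewrite subrr normr0 mulr0.
  rewrite g_off// ler_piMr// ler0_norm ?subr_le0 ?recip_le1//.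
  by have := recip_gt0 x t; lra.
rewrite sqnormZ// exprVn mulrC ltr_pdivrMr ?exprn_even_gt0//.
have : e * d <= e * a ^+ 2 by rewrite ler_pM2l.
lra.
Qed.

Lemma extremal_mass_add nu rho x :
  finite_moments nu -> finite_moments rho -> same_moments nu rho ->
  extremal_mass nu x -> extremal_mass rho x ->
  extremal_mass (measure_add nu rho) x.
Proof.
move=> fn fr mm en er k k0; have k2 : 0 < k / 2 by lra.
have [p px Hp] := en _ k2; have [q qx Hq] := er _ k2.
have mx : measurable [set x] by exact: measurable_set1.
have := same_moments_psqnorm p mm; have := same_moments_psqnorm q mm => eq_q eq_p.
have [pq|qp] := leP (psqnorm nu p) (psqnorm nu q).
- by exists p => //; rewrite psqnorm_add// mass_add//; lra.
- by exists q => //; rewrite psqnorm_add// mass_add//; lra.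
Qed.

Lemma locally_bounded_add nu rho :
  finite_moments nu -> finite_moments rho -> same_moments nu rho ->
  locally_bounded nu -> locally_bounded (measure_add nu rho).
Proof.
move=> fn fr mm lb M; have [C C0 HC] := lb M; exists C => // p t tM.
have [h1 h2] := HC p t tM; rewrite psqnorm_add//.
have : C * psqnorm nu p <= C * (psqnorm nu p + psqnorm rho p).
  by rewrite ler_pM2l// lerDl psqnorm_ge0.
by move=> h; split; exact: le_trans h.
Qed.

(** Extremality for the sum, which gives density in L2(nu + rho), is the natural
    hypothesis; it is weaker than extremality for each measure. *)
Lemma measure_eq_of_extremal_mass nu rho x :
  finite_moments nu -> finite_moments rho -> carried nu x -> carried rho x ->
  same_moments nu rho -> locally_bounded nu ->
  extremal_mass (measure_add nu rho) x -> measure_eq nu rho.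
Proof.
move=> fn fr cn cr mm lb em.
apply: (measure_eq_of_density fn fr cn cr mm).
apply: extremal_mass_recip => //; first exact: finite_moments_add.
  exact: carried_add.
exact: locally_bounded_add.
Qed.

Lemma locally_lipschitz nu x : locally_bounded nu ->
  exists2 C, 0 < C & forall p t, `|t - x| <= 1 ->
    (p.[t] - p.[x]) ^+ 2 <= (t - x) ^+ 2 * (C * psqnorm nu p).
Proof.
move=> lb; have [C C0 HC] := lb (`|x| + 1); exists C => // p.
have D c : `|c - x| <= 1 -> p^`().[c] ^+ 2 <= C * psqnorm nu p.
  move=> cx; apply: (HC _ _ _).2.
  by rewrite -[c](subrK x) addrC; apply: le_trans (ler_normD _ _) _; rewrite lerD2l.
have cont (a b : R) : {within `[a, b], continuous (horner p)}.
  by apply: continuous_subspaceT => u; exact: continuous_horner.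
move=> t; rewrite ler_norml => /andP[t1 t2].
have [tx|xt] := leP t x.
  rewrite -sqrrN opprB -[(t - x) ^+ 2]sqrrN opprB.
  have [c cI ->] := MVT_segment tx (fun u _ => is_derive_poly p u) (cont _ _).
  rewrite exprMn mulrC ler_wpM2l ?sqr_ge0// D//.
  by move: cI; rewrite in_itv/= ler_norml => /andP[]; lra.
have [c cI ->] := MVT_segment (ltW xt) (fun u _ => is_derive_poly p u) (cont _ _).
rewrite exprMn mulrC ler_wpM2l ?sqr_ge0// D//.
by move: cI; rewrite in_itv/= ler_norml => /andP[]; lra.
Qed.

Definition near_pt x (d : R) := [set t | `|t - x| < d].

Lemma near_ptE x d : near_pt x d = `]x - d, x + d[%classic.
Proof.
apply/seteqP; split=> t; rewrite /near_pt/= in_itv/= ltr_norml => /andP[? ?]; apply/andP; lra.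
Qed.

Lemma measurable_near_pt x d : measurable (near_pt x d).
Proof. by rewrite near_ptE; exact: measurable_itv. Qed.

Lemma mass_near_pt nu x (e : R) : finite_moments nu -> 0 < e ->
  exists2 d, 0 < d <= 1 & mass nu (near_pt x d) <= mass nu [set x] + e.
Proof.
move=> fm e0; pose F n := near_pt x n.+1%:R^-1.
have capF : \bigcap_n F n = [set x].
  apply/seteqP; split=> t /=; last by move=> -> n _; rewrite /F/near_pt/= subrr normr0.
  move=> h; apply/eqP; rewrite -subr_eq0 -normr_le0; apply/ler_addgt0Pr => d d0; rewrite add0r.
  have := h (Num.truncn d^-1) Logic.I; rewrite /F/near_pt/= => /ltW /le_trans; apply.
  rewrite invf_ple ?posrE//; apply: ltW; exact: truncnS_gt.
have cv : (nu \o F) n @[n --> \oo] --> nu [set x].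
  rewrite -capF; apply: nonincreasing_cvg_mu.
  - by apply: mass_fin => //; exact: measurable_near_pt.
  - by move=> i; exact: measurable_near_pt.
  - by rewrite capF; exact: measurable_set1.
  - move=> n m nm; apply/subsetPset => t; rewrite /F /near_pt/= => /lt_le_trans; apply.
    by rewrite lef_pV2 ?posrE// ler_nat.
have cv' : mass nu (F n) @[n --> \oo] --> mass nu [set x].
  by apply: fine_cvg; rewrite -massE//; exact: measurable_set1.
have : \forall n \near \oo, mass nu (F n) < mass nu [set x] + e.
  by apply: (cvgr_lt (mass nu [set x])) => //; rewrite ltrDl.
move=> [n _ /(_ n (leqnn n))/= Hn]; exists n.+1%:R^-1; last exact: ltW.
by rewrite invr_gt0 ltr0n/= invf_le1// ler1n.
Qed.

Lemma open_near_pt x d : open (near_pt x d).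
Proof. by rewrite near_ptE; exact: itv_open. Qed.

(** Approximate the indicator of a small neighbourhood U of x by a polynomial q.
    Somewhere in U, which has positive mass, q is close to 1; by the Lipschitz
    bound q(x) is close to 1 as well, while int q^2 is close to nu U, itself close
    to nu {x}. *)
Lemma extremal_mass_dense nu x : finite_moments nu -> locally_bounded nu ->
  (forall A, measurable A -> papprox nu (\1_A)) -> supp nu x ->
  extremal_mass nu x.
Proof.
move=> fm lb dense sx k k0.
have [C C0 HC] := locally_lipschitz x lb.
have m0 := mass_ge0 nu setT; set m := mass nu setT in m0.
have mx0 := mass_ge0 nu [set x]; set mx := mass nu [set x] in mx0.
(* Small enough for (1 + 3 e) (mx + e) <= (mx + k) (1 - 2 e) ^ 2. *)
pose e := Num.min 8^-1 (k / (7 * mx + 4 + 4 * k)).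
have den0 : 0 < 7 * mx + 4 + 4 * k by lra.
have e0 : 0 < e by rewrite lt_min invr_gt0 ltr0n divr_gt0.
have e8 : e <= 8^-1 by rewrite ge_min lexx.
have ek : e * (7 * mx + 4 + 4 * k) <= k by rewrite -ler_pdivlMr// ge_min lexx orbT.
have [d1 /andP[d10 d11] Hd1] := mass_near_pt x fm e0.
pose B := 2 * C * (m + 1).
have B0 : 0 < B by rewrite !mulr_gt0// ltr_wpDl.
pose d := Num.min d1 (e / (B + 1)).
have d0 : 0 < d by rewrite lt_min d10 divr_gt0// ltr_wpDl// ltW.
have d1' : d <= 1 by apply: le_trans d11; rewrite ge_min lexx.
have dB : d * (B + 1) <= e.
  by rewrite -ler_pdivlMr ?ge_min ?lexx ?orbT// ltr_wpDl// ltW.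
set U := near_pt x d.
have mU : measurable U by exact: measurable_near_pt.
have nU : mass nu U <= mx + e.
  apply: le_trans Hd1; apply: le_mass => //; first exact: measurable_near_pt.
  by move=> t; rewrite /U/near_pt/= => /lt_le_trans; apply; rewrite ge_min lexx.
have U0 : 0 < mass nu U.
  rewrite -lte_fin -massE//; apply: sx; first exact: open_near_pt.
  by rewrite /U/near_pt/= subrr normr0.
have Um : mass nu U <= m by apply: le_mass.
have [LU /(_ (e ^+ 2 * mass nu U))] := dense _ mU.
have e2U : 0 < e ^+ 2 * mass nu U by rewrite mulr_gt0// exprn_gt0.
move=> /(_ e2U)[q Hq].
have Lq : L2 nu (fun t => \1_U t - q.[t]) by apply: L2B => //; exact: L2_poly.
have qn : psqnorm nu q <= (1 + e) * mass nu U + (1 + e^-1) * (e ^+ 2 * mass nu U).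
  have -> : psqnorm nu q = sqnorm nu (fun t => \1_U t + (-1) * (\1_U t - q.[t])).
    by apply: eq_sqnorm => t; ring.
  apply: le_trans (sqnormD_le e0 LU (L2Z _ Lq)) _.
  rewrite sqnormZ// sqrrN expr1n mul1r sqnorm_indic// lerD2l ler_pM2l ?ltW//.
  by rewrite ltr_wpDl// invr_gt0.
have qn2 : psqnorm nu q <= (1 + 3 * e) * mass nu U.
  apply: le_trans qn _.
  have -> : (1 + e) * mass nu U + (1 + e^-1) * (e ^+ 2 * mass nu U)
     = (1 + 2 * e + e ^+ 2) * mass nu U by field; rewrite gt_eqF.
  rewrite ler_pM2r//; nra.
(* Otherwise the error on U alone would exceed the error of approximation. *)
have [t [tU qt]] : exists t, U t /\ (q.[t] - 1) ^+ 2 <= e ^+ 2.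
  apply: contrapT => nt.
  suff : e ^+ 2 * mass nu U <= sqnorm nu (fun t => \1_U t - q.[t]) by rewrite leNgt Hq.
  have <- : \int[nu]_t (e ^+ 2 * \1_U t) = e ^+ 2 * mass nu U.
    by rewrite intZ ?int_indic//; exact: intble_indic.
  apply: int_le; [by apply: intbleZ; exact: intble_indic|by case: Lq|].
  move=> t; rewrite indicE; have [tU|tU] := boolP (t \in U).
    rewrite mulr1 leNgt; apply/negP => h; apply: nt; exists t.
    by split; [exact: set_mem|rewrite -sqrrN opprB ltW].
  by rewrite mulr0 sqr_ge0.
have qx : (q.[t] - q.[x]) ^+ 2 <= e ^+ 2.
  have td : `|t - x| <= d by exact: ltW.
  apply: le_trans (HC q t (le_trans td d1')) _.
  have t2 : (t - x) ^+ 2 <= d ^+ 2.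
    by rewrite -(real_normK (num_real (t - x))) lerXn2r// nnegrE ltW.
  have h1 : C * psqnorm nu q <= B.
    rewrite /B -mulrA [2 * _]mulrC -mulrA ler_pM2l//.
    apply: le_trans qn2 _; nra.
  apply: le_trans (_ : _ <= d ^+ 2 * B) _.
    by apply: ler_pM => //; rewrite ?sqr_ge0// mulr_ge0 ?psqnorm_ge0// ltW.
  apply: le_trans (_ : _ <= (d * (B + 1)) ^+ 2) _; last first.
    by rewrite lerXn2r// nnegrE ltW// mulr_gt0// ltr_wpDl// ltW.
  rewrite exprMn ler_pM2l ?exprn_gt0//; nra.
have q1 : 1 - 2 * e <= q.[x].
  have sq (y : R) : y ^+ 2 <= e ^+ 2 -> - e <= y <= e.
    by move=> h; apply/andP; split; nra.
  have /andP[] := sq _ qt; have /andP[] := sq _ qx; lra.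
have q0 : 0 < q.[x] by lra.
exists (q.[x]^-1 *: q); first by rewrite hornerZ mulVf// gt_eqF.
rewrite psqnormZ// exprVn mulrC ler_pdivrMr ?exprn_gt0//.
apply: le_trans qn2 _.
have h2 : (1 - 2 * e) ^+ 2 <= q.[x] ^+ 2 by rewrite lerXn2r ?nnegrE; lra.
apply: le_trans (_ : _ <= (mx + k) * (1 - 2 * e) ^+ 2) _; last first.
  by rewrite ler_wpM2l//; lra.
apply: (@le_trans _ _ ((1 + 3 * e) * (mx + e))); first by rewrite ler_pM2l//; lra.
apply: (@le_trans _ _ ((mx + k) * (1 - 4 * e))).
  have e2 : e ^+ 2 <= e by nra.
  by lra.
rewrite ler_wpM2l//; first lra.
by have := sqr_ge0 e; lra.
Qed.

(** A polynomial q with int (t - b) q^2 much smaller than int q^2 has its norm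
    concentrated near b, where it is almost constant: so int q^2 is at most about
    q(b)^2 nu {b}. *)
Lemma extremal_mass_of_small_form nu b : finite_moments nu -> carried nu b ->
  locally_bounded nu ->
  (forall e, 0 < e -> exists q, \int[nu]_t (('X - (b + e)%:P) * q ^+ 2).[t] < 0) ->
  extremal_mass nu b.
Proof.
move=> fm cb lb small k k0.
have [C C0 HC] := locally_lipschitz b lb.
have m0 := mass_ge0 nu setT; set m := mass nu setT in m0.
have mb0 := mass_ge0 nu [set b]; set mb := mass nu [set b] in mb0.
(* Small enough for (1 + e) (mb + e) <= (mb + k) (1 - 2 e). *)
pose e := Num.min 8^-1 (k / (3 * mb + 4 + 4 * k)).
have den0 : 0 < 3 * mb + 4 + 4 * k by lra.
have e0 : 0 < e by rewrite lt_min invr_gt0 ltr0n divr_gt0.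
have e8 : e <= 8^-1 by rewrite ge_min lexx.
have ek : e * (3 * mb + 4 + 4 * k) <= k by rewrite -ler_pdivlMr// ge_min lexx orbT.
have [d1 /andP[d10 d11] Hd1] := mass_near_pt b fm e0.
pose B := (1 + e^-1) * C * (m + 1).
have ei : 0 < e^-1 by rewrite invr_gt0.
have B0 : 0 < B by rewrite !mulr_gt0// ltr_wpDl// ltW.
pose d := Num.min d1 (e / (B + 1)).
have d0 : 0 < d by rewrite lt_min d10 divr_gt0// ltr_wpDl// ltW.
have d1' : d <= 1 by apply: le_trans d11; rewrite ge_min lexx.
have dB : d * (B + 1) <= e.
  by rewrite -ler_pdivlMr ?ge_min ?lexx ?orbT// ltr_wpDl// ltW.
set U := near_pt b d.
have mU : measurable U by exact: measurable_near_pt.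
have nU : mass nu U <= mb + e.
  apply: le_trans Hd1; apply: le_mass => //; first exact: measurable_near_pt.
  by move=> t; rewrite /U/near_pt/= => /lt_le_trans; apply; rewrite ge_min lexx.
have Um : mass nu U <= m by apply: le_mass.
have U0 := mass_ge0 nu U.
have [q Hq] := small (e * d) (mulr_gt0 e0 d0).
set Q := psqnorm nu q.
have Q0 : 0 <= Q := psqnorm_ge0 nu q.
have Iq : intble nu (fun t => q.[t] ^+ 2) by case: (L2_poly q fm).
have IXq : intble nu (fun t => (t - b) * q.[t] ^+ 2).
  apply: eq_intble (intble_poly (('X - b%:P) * q ^+ 2) fm) => t.
  by rewrite hornerM hornerXsubC horner_exp.
have small_q : \int[nu]_t ((t - b) * q.[t] ^+ 2) < e * d * Q.
  rewrite -subr_lt0 -[_ * Q]intZ// -intB//; last exact: intbleZ.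
  apply: le_lt_trans Hq; rewrite le_eqVlt; apply/orP; left; apply/eqP.
  congr Rintegral; apply/funext => t.
  by rewrite hornerM hornerXsubC horner_exp; ring.
have form0 : 0 <= \int[nu]_t ((t - b) * q.[t] ^+ 2).
  have <- : \int[nu]_t (0 : R) = 0 by rewrite int_cst// mul0r.
  apply: (le_int cb) => //; first exact: (intble_cst 0).
  by move=> t bt; rewrite mulr_ge0 ?sqr_ge0// subr_ge0.
have Qpos : 0 < Q.
  rewrite lt_neqAle Q0 andbT eq_sym; apply/eqP => Qz.
  by move: small_q; rewrite Qz mulr0 ltNge form0.
pose A := (1 + e) * q.[b] ^+ 2 + (1 + e^-1) * (d ^+ 2 * (C * Q)).
have main : Q <= d^-1 * (e * d * Q) + A * mass nu U.
  apply: le_trans (_ : _ <= \int[nu]_t (d^-1 * ((t - b) * q.[t] ^+ 2) + A * \1_U t)) _.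
    apply: (le_int cb) => //.
      by apply: intbleD; apply: intbleZ => //; exact: intble_indic.
    move=> t bt; rewrite indicE; have [tU|tU] := boolP (t \in U).
      rewrite mulr1; apply: le_trans (_ : A <= _); last first.
        by rewrite lerDr mulr_ge0 ?invr_ge0 ?(ltW d0)// mulr_ge0 ?sqr_ge0 ?subr_ge0.
      have td : `|t - b| <= d by move: tU; rewrite inE => /ltW.
      have t2 : (t - b) ^+ 2 <= d ^+ 2.
        by rewrite -(real_normK (num_real (t - b))) lerXn2r// nnegrE ltW.
      have h : (q.[t] - q.[b]) ^+ 2 <= d ^+ 2 * (C * Q).
        apply: le_trans (HC q t (le_trans td d1')) _.
        by rewrite ler_wpM2r// mulr_ge0// ltW.
      apply: le_trans (_ : (1 + e) * q.[b] ^+ 2 + (1 + e^-1) * (q.[t] - q.[b]) ^+ 2 <= _).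
        rewrite -subr_ge0.
        rewrite [leRHS](_ : _ = e^-1 * (q.[t] - q.[b] - e * q.[b]) ^+ 2).
          by rewrite mulr_ge0 ?sqr_ge0// ltW.
        by field; rewrite gt_eqF.
      by rewrite lerD2l ler_pM2l// ltr_wpDl// ltW.
    rewrite mulr0 addr0 mulrA ler_peMl ?sqr_ge0//.
    rewrite mulrC ler_pdivlMr// mul1r.
    have : ~ (`|t - b| < d) by move=> h; case/negP: tU; rewrite inE.
    by move/negP; rewrite -leNgt ger0_norm// subr_ge0.
  rewrite intD; [|exact: intbleZ|by apply: intbleZ; exact: intble_indic].
  rewrite intZ// intZ ?int_indic//; last exact: intble_indic.
  by rewrite lerD2r ler_pM2l ?invr_gt0// ltW.
have key : Q * (1 - 2 * e) <= (1 + e) * (mb + e) * q.[b] ^+ 2.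
  have E1 : d^-1 * (e * d * Q) = e * Q by field; rewrite gt_eqF.
  have E2 : (1 + e^-1) * (d ^+ 2 * (C * Q)) * mass nu U <= e * Q.
    apply: le_trans (_ : _ <= d ^+ 2 * Q * B) _.
      have -> : (1 + e^-1) * (d ^+ 2 * (C * Q)) * mass nu U
         = d ^+ 2 * Q * ((1 + e^-1) * C * mass nu U) by ring.
      rewrite ler_pM2l ?mulr_gt0 ?exprn_gt0// /B ler_pM2l; first lra.
      by rewrite mulr_gt0// ltr_wpDl// ltW.
    have : d ^+ 2 * B <= e by nra.
    by move=> h; rewrite mulrAC ler_pM2r.
  have E3 : (1 + e) * q.[b] ^+ 2 * mass nu U <= (1 + e) * q.[b] ^+ 2 * (mb + e).
    by rewrite ler_wpM2l// mulr_ge0 ?sqr_ge0//; lra.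
  rewrite E1 /A in main; lra.
have qb : 0 < q.[b] ^+ 2.
  rewrite lt_neqAle sqr_ge0 andbT eq_sym; apply/eqP => z.
  move: key; rewrite z mulr0 leNgt => /negP; apply; rewrite mulr_gt0//; lra.
have qb0 : q.[b] != 0 by apply/eqP => z; move: qb; rewrite z expr0n/= ltxx.
exists (q.[b]^-1 *: q); first by rewrite hornerZ mulVf.
rewrite psqnormZ// exprVn mulrC ler_pdivrMr// -/Q -/mb.
have e12 : 0 < 1 - 2 * e by lra.
rewrite -(ler_pM2r e12); apply: le_trans key _.
rewrite [leRHS]mulrAC ler_pM2r//; nra.
Qed.

End point_evaluations.

(** * Orthonormal polynomials and local bounds *)
Section gronwall.
Context {R : realType}.
Implicit Types (a b c f y V : nat -> R).

Lemma cauchy_schwarz_sum n a b :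
  (\sum_(k < n) a k * b k) ^+ 2 <= (\sum_(k < n) a k ^+ 2) * (\sum_(k < n) b k ^+ 2).
Proof.
set S := \sum_(k < n) a k * b k; set A := \sum_(k < n) a k ^+ 2.
set B := \sum_(k < n) b k ^+ 2.
have B0 : 0 <= B by apply: sumr_ge0 => k _; exact: sqr_ge0.
have [Bz|Bnz] := eqVneq B 0.
  have bz (k : 'I_n) : b k = 0.
    apply/eqP; rewrite -sqrf_eq0; apply/eqP.
    by have /psumr_eq0P -> := Bz => // i _; exact: sqr_ge0.
  rewrite Bz mulr0 /S big1 ?expr0n// => k _; by rewrite bz mulr0.
have Bp : 0 < B by rewrite lt_neqAle eq_sym Bnz.
have : 0 <= \sum_(k < n) (a k * B - b k * S) ^+ 2.
  by apply: sumr_ge0 => k _; exact: sqr_ge0.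
have -> : \sum_(k < n) (a k * B - b k * S) ^+ 2 = B * (A * B - S ^+ 2).
  transitivity (\sum_(k < n) (B ^+ 2 * a k ^+ 2 - 2 * B * S * (a k * b k) + S ^+ 2 * b k ^+ 2)).
    by apply: eq_bigr => k _; ring.
  rewrite big_split sumrB -!mulr_sumr -/A -/B -/S /=; ring.
by rewrite pmulr_rge0// subr_ge0.
Qed.

Lemma sumr_sqr_ge0 (g : nat -> R) n : 0 <= \sum_(k < n) g k ^+ 2.
Proof. by apply: sumr_ge0 => k _; exact: sqr_ge0. Qed.

Lemma ler_sum_sqr (g : nat -> R) m n : (m <= n)%N ->
  \sum_(k < m) g k ^+ 2 <= \sum_(k < n) g k ^+ 2.
Proof.
move=> mn; rewrite -(subnKC mn) big_split_ord /= lerDl.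
by apply: sumr_ge0 => k _; exact: sqr_ge0.
Qed.

(** The kernel c k * V i - c i * V k is of rank two, so that Cauchy-Schwarz
    bounds y i ^ 2 by a summable weight w i times 1 plus the preceding sum of
    squares; the product of the factors 1 + w i is bounded by an exponential. *)
Lemma gronwall_sum n c V f y (s r C D F : R) :
  s ^+ 2 <= r -> \sum_(k < n) c k ^+ 2 <= C -> \sum_(k < n) V k ^+ 2 <= D ->
  \sum_(k < n) f k ^+ 2 <= F ->
  (forall i, (i < n)%N ->
    y i = f i + s * \sum_(k < i) (c k * V i - c i * V k) * y k) ->
  \sum_(k < n) y k ^+ 2 <= expR (2 * F + 8 * r * C * D).
Proof.
move=> sr cC VD fF yE.
have r0 : 0 <= r := le_trans (sqr_ge0 s) sr.
have C0 : 0 <= C by apply: le_trans cC; apply: sumr_ge0 => k _; exact: sqr_ge0.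
have D0 : 0 <= D by apply: le_trans VD; apply: sumr_ge0 => k _; exact: sqr_ge0.
pose w i := 2 * f i ^+ 2 + 4 * r * (C * V i ^+ 2 + D * c i ^+ 2).
have w_ge0 i : 0 <= w i.
  apply: addr_ge0; first exact: mulr_ge0 (sqr_ge0 _).
  apply: mulr_ge0; first exact: mulr_ge0.
  by apply: addr_ge0; exact: mulr_ge0 (sqr_ge0 _).
have main m : (m <= n)%N ->
    \sum_(k < m) y k ^+ 2 + 1 <= expR (\sum_(k < m) w k).
  elim: m => [_|m IH mn]; first by rewrite !big_ord0 expR0 add0r.
  have := IH (ltnW mn); rewrite !big_ord_recr /=.
  set S := \sum_(k < m) y k ^+ 2 => IHm.
  have S0 : 0 <= S by apply: sumr_ge0 => k _; exact: sqr_ge0.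
  rewrite expRD; apply: le_trans (_ : _ <= (S + 1) * (1 + w m)) _; last first.
    by apply: ler_pM => //; [exact: addr_ge0|exact: addr_ge0 (w_ge0 m)|exact: expR_ge1Dx].
  set X := \sum_(k < m) c k * y k; set Y := \sum_(k < m) V k * y k.
  have yy : y m = f m + s * (V m * X - c m * Y).
    rewrite yE//; congr (_ + _ * _); rewrite !mulr_sumr -sumrB.
    by apply: eq_bigr => k _; ring.
  have X2 : X ^+ 2 <= C * S.
    apply: le_trans (cauchy_schwarz_sum _ _ _) _; rewrite ler_wpM2r//.
    by apply: le_trans cC; apply: ler_sum_sqr; exact: ltnW.
  have Y2 : Y ^+ 2 <= D * S.
    apply: le_trans (cauchy_schwarz_sum _ _ _) _; rewrite ler_wpM2r//.
    by apply: le_trans VD; apply: ler_sum_sqr; exact: ltnW.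
  set Z := V m * X - c m * Y in yy.
  have Z2 : Z ^+ 2 <= 2 * (C * V m ^+ 2 + D * c m ^+ 2) * S.
    have h1 : V m ^+ 2 * X ^+ 2 <= V m ^+ 2 * (C * S) by rewrite ler_wpM2l ?sqr_ge0.
    have h2 : c m ^+ 2 * Y ^+ 2 <= c m ^+ 2 * (D * S) by rewrite ler_wpM2l ?sqr_ge0.
    have := sqr_ge0 (V m * X + c m * Y); rewrite /Z; nra.
  have y2 : y m ^+ 2 <= 2 * f m ^+ 2 + 2 * (s ^+ 2 * Z ^+ 2).
    rewrite yy; have := sqr_ge0 (f m - s * Z); nra.
  have sZ : s ^+ 2 * Z ^+ 2 <= r * (2 * (C * V m ^+ 2 + D * c m ^+ 2) * S).
    exact: (ler_pM (sqr_ge0 s) (sqr_ge0 Z) sr Z2).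
  have w0 : 0 <= r * (C * V m ^+ 2 + D * c m ^+ 2).
    by rewrite mulr_ge0// addr_ge0// mulr_ge0// sqr_ge0.
  have f0 : 0 <= f m ^+ 2 * S by rewrite mulr_ge0// sqr_ge0.
  rewrite /w; lra.
have := main n (leqnn n) => h.
apply: (@le_trans _ _ (expR (\sum_(k < n) w k))); first lra.
rewrite ler_expR /w big_split /= -!mulr_sumr big_split /= -!mulr_sumr.
have h1 : C * (\sum_(i < n) V i ^+ 2) <= C * D by rewrite ler_wpM2l.
have h2 : D * (\sum_(i < n) c i ^+ 2) <= D * C by rewrite ler_wpM2l.
have h3 : r * (C * (\sum_(i < n) V i ^+ 2) + D * (\sum_(i < n) c i ^+ 2)) <= r * (2 * (C * D)).
  by rewrite ler_wpM2l//; lra.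
lra.
Qed.

End gronwall.

Section orthonormal_polynomials.
Context {R : realType} (nu : {measure set R -> \bar R}) (x : R).
Implicit Types (p q r : {poly R}).
Hypotheses (fm : finite_moments nu) (cx : carried nu x).

Definition ip p q := \int[nu]_t (p.[t] * q.[t]).

Lemma intble_ip p q : intble nu (fun t => p.[t] * q.[t]).
Proof. exact: L2M (L2_poly _ fm) (L2_poly _ fm). Qed.

Lemma ipC p q : ip p q = ip q p.
Proof. by congr Rintegral; apply/funext => t; rewrite mulrC. Qed.

Lemma ipDl p q r : ip (p + q) r = ip p r + ip q r.
Proof.
rewrite /ip -intD; [|exact: intble_ip|exact: intble_ip].
by congr Rintegral; apply/funext => t; rewrite hornerD mulrDl.
Qed.

Lemma ipZl c p r : ip (c *: p) r = c * ip p r.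
Proof.
rewrite /ip -intZ; last exact: intble_ip.
by congr Rintegral; apply/funext => t; rewrite hornerZ mulrA.
Qed.

Lemma ip0l r : ip 0 r = 0.
Proof. by rewrite -(scale0r r) ipZl mul0r. Qed.

Lemma ip_suml n (c : nat -> R) (e : nat -> {poly R}) r :
  ip (\sum_(i < n) c i *: e i) r = \sum_(i < n) c i * ip (e i) r.
Proof.
elim: n => [|n IH]; first by rewrite !big_ord0 ip0l.
by rewrite !big_ord_recr /= ipDl IH ipZl.
Qed.

Lemma ip_psqnorm p : ip p p = psqnorm nu p.
Proof. by congr Rintegral; apply/funext => t; rewrite expr2. Qed.

Variable C : R.
Hypothesis HC : forall p, p.[x - 1] ^+ 2 <= C * psqnorm nu p.

(** A polynomial of norm zero vanishes at x - 1 by boundedness of the evaluation;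
    the factor t - (x - 1), at least 1 on [x, +oo[, can be removed. *)
Lemma psqnorm_eq0 p : psqnorm nu p = 0 -> p = 0.
Proof.
have [n] := ubnP (size p); elim: n p => // n IH p; rewrite ltnS => pn p0.
have pz : p.[x - 1] = 0.
  apply/eqP; rewrite -sqrf_eq0 eq_le sqr_ge0 andbT.
  by apply: le_trans (HC p) _; rewrite p0 mulr0.
have [q pq] := div_by_root p (x - 1); rewrite pz add0r in pq.
have [q0|q0] := eqVneq q 0; first by rewrite pq q0 mulr0.
suff qz : q = 0 by rewrite pq qz mulr0.
apply: IH.
  apply: leq_trans pn; rewrite [in leqRHS]pq mulrC size_Mmonic ?monicXsubC//.
  by rewrite size_XsubC addn2.
apply/eqP; rewrite eq_le psqnorm_ge0 andbT -p0.
apply: (sqnorm_le cx) => //; try exact: L2_poly.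
move=> t xt; rewrite pq hornerM hornerXsubC normrM ler_peMl//.
by rewrite ger0_norm; lra.
Qed.

Definition orthonormal_family n (e : nat -> {poly R}) :=
  (forall i, (i < n)%N -> size (e i) = i.+1) /\
  (forall i j, (i < n)%N -> (j < n)%N -> ip (e i) (e j) = (i == j)%:R).

Lemma orthonormal_exists n : exists e, orthonormal_family n e.
Proof.
elim: n => [|n [e [se oe]]]; first by exists (fun=> 0); split.
pose P := 'X^n - \sum_(i < n) ip 'X^n (e i) *: e i.
have sP : size P = n.+1.
  rewrite /P size_polyDl size_polyXn// size_polyN.
  apply: leq_ltn_trans (size_sum _ _ _) _; rewrite ltnS; apply/bigmax_leqP => i _.
  by apply: leq_trans (size_scale_leq _ _) _; rewrite se.
have Pn0 : P != 0 by rewrite -size_poly_eq0 sP.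
have oP j : (j < n)%N -> ip P (e j) = 0.
  move=> jn; rewrite /P -scaleN1r ipDl ipZl (@ip_suml n (fun i => ip 'X^n (e i)) e).
  rewrite (bigD1 (Ordinal jn))//= oe// eqxx mulr1 big1 ?addr0; first by rewrite mulN1r subrr.
  by move=> i /eqP ij; rewrite oe// (_ : (_ == _) = false) ?mulr0//; apply/eqP => h; apply: ij; apply/val_inj.
have nP : 0 < psqnorm nu P.
  rewrite lt_neqAle psqnorm_ge0 andbT eq_sym; apply/eqP => /psqnorm_eq0 h.
  by rewrite h eqxx in Pn0.
pose k := (Num.sqrt (psqnorm nu P))^-1.
have k0 : k != 0 by rewrite invr_eq0 gt_eqF// sqrtr_gt0.
have kk : k * (k * psqnorm nu P) = 1.
  by rewrite mulrA -expr2 exprVn sqr_sqrtr ?psqnorm_ge0// mulVf// gt_eqF.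
exists (fun i => if (i < n)%N then e i else k *: P); split.
- move=> i; rewrite ltnS leq_eqVlt; case: ltnP => [ilt _|/=]; first exact: se.
  by rewrite orbF => _ /eqP ->; rewrite size_scale.
- move=> i j; rewrite !ltnS => il jl.
  case: ltnP => ni; case: ltnP => nj.
  + exact: oe.
  + rewrite ipC ipZl oP// mulr0; case: eqP => // E; move: ni; rewrite E ltnNge nj//.
  + rewrite ipZl oP// mulr0; case: eqP => // E; move: nj; rewrite -E ltnNge ni//.
  + have -> : i = n by apply/eqP; rewrite eqn_leq il ni.
    have -> : j = n by apply/eqP; rewrite eqn_leq jl nj.
    by rewrite ipZl ipC ipZl ip_psqnorm eqxx kk.
Qed.

Section family.
Variables (n : nat) (e : nat -> {poly R}).
Hypothesis (oe : orthonormal_family n e).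

Lemma family_span m q : (m <= n)%N -> (size q <= m)%N ->
  exists c : nat -> R, q = \sum_(i < m) c i *: e i.
Proof.
elim: m q => [|m IH] q mn qm.
  by exists (fun=> 0); rewrite big_ord0; apply/eqP; rewrite -size_poly_eq0 -leqn0.
have [se _] := oe; have sm := se _ mn.
have lm : (e m)`_m != 0.
  by have := lead_coef_eq0 (e m); rewrite lead_coefE sm /= => ->; rewrite -size_poly_eq0 sm.
pose q' := q - (q`_m / (e m)`_m) *: e m.
have [|c qc] := IH q' (ltnW mn).
  apply/leq_sizeP => j; rewrite leq_eqVlt => /predU1P[<-|mj].
    by rewrite coefB coefZ divfK ?subrr.
  rewrite coefB coefZ (nth_default 0 (leq_trans qm mj)).
  by rewrite [(e m)`_j]nth_default ?mulr0 ?subr0// sm.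
exists (fun i => if (i < m)%N then c i else q`_m / (e m)`_m).
rewrite big_ord_recr /= ltnn -[q in LHS](subrK ((q`_m / (e m)`_m) *: e m)) -/q' qc.
by congr (_ + _); apply: eq_bigr => i _; rewrite ltn_ord.
Qed.

Lemma family_coord m (c : nat -> R) j : (m <= n)%N -> (j < n)%N ->
  ip (\sum_(i < m) c i *: e i) (e j) = if (j < m)%N then c j else 0.
Proof.
move=> mn jn; have [_ o] := oe; rewrite ip_suml; case: ltnP => jm.
  rewrite (bigD1 (Ordinal jm))//= o// eqxx mulr1 big1 ?addr0// => i /eqP ij.
  rewrite o//; last exact: leq_trans (ltn_ord i) mn.
  by rewrite (_ : (_ == _) = false) ?mulr0//; apply/eqP => h; apply: ij; apply/val_inj.
rewrite big1// => i _; rewrite o//; last exact: leq_trans (ltn_ord i) mn.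
rewrite (_ : (_ == _) = false) ?mulr0//; apply/eqP => h.
by have := ltn_ord i; rewrite h ltnNge jm.
Qed.

Lemma family_expand m q : (m <= n)%N -> (size q <= m)%N ->
  q = \sum_(i < m) ip q (e i) *: e i.
Proof.
move=> mn qm; have [c qc] := family_span mn qm.
rewrite [LHS]qc; apply: eq_bigr => i _; rewrite qc family_coord ?ltn_ord//.
exact: leq_trans (ltn_ord i) mn.
Qed.

Lemma family_orth j q : (j < n)%N -> (size q <= j)%N -> ip (e j) q = 0.
Proof.
move=> jn qj; have [c ->] := family_span (ltnW jn) qj.
by rewrite ipC family_coord ?ltnn// ltnW.
Qed.

Lemma family_psqnorm (c : nat -> R) :
  psqnorm nu (\sum_(i < n) c i *: e i) = \sum_(i < n) c i ^+ 2.
Proof.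
rewrite -ip_psqnorm ip_suml; apply: eq_bigr => i _.
by rewrite ipC family_coord ?ltn_ord ?expr2.
Qed.

(** Integrals against the resolvent at x - 1; for orthonormal polynomials these and
    the values at x - 1 are two solutions of the three-term recurrence. *)
Definition recip_int p := \int[nu]_t (recip x t * p.[t]).

Lemma intble_recip_int p : intble nu (fun t => recip x t * p.[t]).
Proof. exact: L2M (L2_recip fm cx) (L2_poly _ fm). Qed.

Lemma recip_int_sum m (c : nat -> R) :
  recip_int (\sum_(i < m) c i *: e i) = \sum_(i < m) c i * recip_int (e i).
Proof.
elim: m => [|m IH].
  rewrite !big_ord0 /recip_int (_ : (fun t => _) = fun t => 0 * (recip x t * (0 : {poly R}).[t])).
    by rewrite intZ ?mul0r//; exact: intble_recip_int.
  by apply/funext => t; rewrite horner0 !mulr0.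
rewrite !big_ord_recr /= -IH -intZ; last exact: intble_recip_int.
rewrite /recip_int -intD; [|exact: intble_recip_int|by apply: intbleZ; exact: intble_recip_int].
by congr Rintegral; apply/funext => t; rewrite hornerD hornerZ mulrDr mulrCA.
Qed.

(** The polynomial sum of (e i)(x - 1) e i is the reproducing kernel at x - 1. *)
Lemma bessel_eval : \sum_(i < n) (e i).[x - 1] ^+ 2 <= C.
Proof.
set S := \sum_(i < n) _.
have S0 : 0 <= S by apply: sumr_ge0 => k _; exact: sqr_ge0.
have [Sz|Sn] := eqVneq S 0.
  rewrite Sz; have := HC 1; rewrite hornerC expr1n => h.
  have P0 := psqnorm_ge0 nu 1; rewrite leNgt; apply/negP => C0.
  have : C * psqnorm nu 1 <= 0 by rewrite nmulr_rle0.
  lra.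
have Sp : 0 < S by rewrite lt_neqAle eq_sym Sn.
have := HC (\sum_(i < n) (e i).[x - 1] *: e i).
rewrite (family_psqnorm (fun i => (e i).[x - 1])) -/S horner_sum.
have -> : \sum_(i < n) ((e i).[x - 1] *: e i).[x - 1] = S.
  by apply: eq_bigr => i _; rewrite hornerZ expr2.
by rewrite expr2 ler_pM2r.
Qed.

Lemma bessel_recip_int : \sum_(i < n) recip_int (e i) ^+ 2 <= sqnorm nu (recip x).
Proof.
set S := \sum_(i < n) _; pose w := \sum_(i < n) recip_int (e i) *: e i.
have Lu := L2_recip fm cx; have Lw := L2_poly w fm.
have rw : recip_int w = S.
  by rewrite /w (recip_int_sum _ (fun i => recip_int (e i))); apply: eq_bigr => i _; rewrite expr2.
have nw : psqnorm nu w = S by exact: (family_psqnorm (fun i => recip_int (e i))).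
have : 0 <= sqnorm nu (fun t => recip x t - w.[t]) by exact: sqnorm_ge0.
rewrite /sqnorm (_ : (fun t => _) = fun t => recip x t ^+ 2 + w.[t] ^+ 2 - 2 * (recip x t * w.[t])); last first.
  by apply/funext => t; ring.
rewrite intB; [|by apply: intbleD; [case: Lu|case: Lw]|by apply: intbleZ; exact: intble_recip_int].
rewrite intD; [|by case: Lu|by case: Lw].
rewrite intZ; last exact: intble_recip_int.
rewrite -/(sqnorm nu (recip x)) -/(psqnorm nu w) -/(recip_int w) rw.
have -> : \int[nu]_t w.[t] ^+ 2 = S by exact: nw.
lra.
Qed.

(** Both sides come from int p q / (t - (x - 1)), by dividing either p or q. *)
Lemma ip_quotient p q p1 q1 :
  p = p.[x - 1]%:P + ('X - (x - 1)%:P) * p1 ->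
  q = q.[x - 1]%:P + ('X - (x - 1)%:P) * q1 ->
  ip p1 q = ip p q1 + q.[x - 1] * recip_int p - p.[x - 1] * recip_int q.
Proof.
move=> pE qE.
have quo r r1 t : r = r.[x - 1]%:P + ('X - (x - 1)%:P) * r1 -> x <= t ->
    recip x t * r.[t] = r1.[t] + r.[x - 1] * recip x t.
  move=> rE xt; rewrite {1}rE hornerD hornerM hornerC hornerXsubC mulrDr mulrA.
  by rewrite recip_eq// mul1r addrC mulrC.
have I3 : intble nu (fun t => p1.[t] * q.[t] + p.[x - 1] * (recip x t * q.[t])).
  by apply: intbleD; [exact: intble_ip|apply: intbleZ; exact: intble_recip_int].
have I4 : intble nu (fun t => p.[t] * q1.[t] + q.[x - 1] * (recip x t * p.[t])).
  by apply: intbleD; [exact: intble_ip|apply: intbleZ; exact: intble_recip_int].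
have E t : x <= t -> p1.[t] * q.[t] + p.[x - 1] * (recip x t * q.[t]) =
    p.[t] * q1.[t] + q.[x - 1] * (recip x t * p.[t]).
  move=> xt; have h1 := quo _ _ _ pE xt; have h2 := quo _ _ _ qE xt.
  transitivity (q.[t] * (recip x t * p.[t])); first by rewrite h1; ring.
  transitivity (p.[t] * (recip x t * q.[t])); first by ring.
  by rewrite h2; ring.
have : \int[nu]_t (p1.[t] * q.[t] + p.[x - 1] * (recip x t * q.[t])) =
    \int[nu]_t (p.[t] * q1.[t] + q.[x - 1] * (recip x t * p.[t])).
  by apply: le_anti; rewrite !(le_int cx)// => t xt; rewrite E.
rewrite !intD; try (by apply: intbleZ; exact: intble_recip_int); try exact: intble_ip.
rewrite !intZ; try exact: intble_recip_int.
by rewrite -/(ip p1 q) -/(ip p q1) -/(recip_int p) -/(recip_int q) => h; lra.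
Qed.

(** The quotient of e i by t - (x - 1) is expanded on the e k; its inner product
    with e k is transferred to the quotient of e k, of degree less than k, where
    orthogonality removes it and leaves only the boundary terms. *)
Lemma family_recurrence i : (i < n)%N ->
  e i = (e i).[x - 1]%:P + ('X - (x - 1)%:P) *
    \sum_(k < i) ((e k).[x - 1] * recip_int (e i) - (e i).[x - 1] * recip_int (e k)) *: e k.
Proof.
move=> il; have [se _] := oe.
have szq p p1 m : (size p <= m.+1)%N -> p = p.[x - 1]%:P + ('X - (x - 1)%:P) * p1 ->
    (size p1 <= m)%N.
  move=> pm pE; have [->|p10] := eqVneq p1 0; first by rewrite size_poly0.
  have : (size (('X - (x - 1)%:P) * p1)%R <= m.+1)%N.
    have -> : ('X - (x - 1)%:P) * p1 = p - p.[x - 1]%:P by apply/eqP; rewrite eq_sym subr_eq addrC; apply/eqP.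
    apply: leq_trans (size_polyD _ _) _; rewrite geq_max pm size_polyN.
    by apply: leq_trans (size_polyC_leq1 _) _.
  by rewrite mulrC size_Mmonic ?monicXsubC// size_XsubC addn2.
have [g gE] := div_by_root (e i) (x - 1).
have sg : (size g <= i)%N by apply: szq gE; rewrite se.
rewrite [LHS]gE; congr (_ + _ * _).
rewrite [LHS](family_expand (ltnW il) sg); apply: eq_bigr => k _; congr (_ *: _).
have [h hE] := div_by_root (e k) (x - 1).
have kn : (k < n)%N by apply: ltn_trans il.
rewrite (ip_quotient gE hE) family_orth ?add0r//.
apply: (@leq_trans k); last exact: ltnW.
by apply: szq hE; rewrite se.
Qed.

End family.

(** Evaluated at t, [family_recurrence] is a discrete Volterra equation for the
    values of the orthonormal polynomials, and its derivative one for their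
    derivatives.  The sums of c i ^ 2 and V i ^ 2 are bounded independently of the
    degree by the two Bessel inequalities, hence so are the kernels at t. *)
Lemma locally_bounded_of_eval : locally_bounded nu.
Proof.
move=> M; pose D := sqnorm nu (recip x); pose r := (M + `|x - 1|) ^+ 2.
pose B1 := expR (2 * C + 8 * r * C * D).
pose B2 := expR (2 * (4 * C * D * B1) + 8 * r * C * D).
have B10 : 0 < B1 by exact: expR_gt0.
have B20 : 0 < B2 by exact: expR_gt0.
exists (B1 + B2); first exact: addr_gt0.
move=> p t tM.
have [e oe] := orthonormal_exists (size p).
set n := size p in oe.
pose c i := (e i).[x - 1]; pose V i := recip_int (e i).
have cC : \sum_(i < n) c i ^+ 2 <= C by exact: bessel_eval.
have VD : \sum_(i < n) V i ^+ 2 <= D by exact: bessel_recip_int.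
have C0 : 0 <= C by apply: le_trans cC; apply: sumr_ge0 => k _; exact: sqr_ge0.
have D0 : 0 <= D by exact: sqnorm_ge0.
pose a i k := c k * V i - c i * V k.
have sr : (t - (x - 1)) ^+ 2 <= r.
  rewrite /r -(real_normK (num_real (t - _))) lerXn2r ?nnegrE ?normr_ge0//.
    by rewrite addr_ge0// (le_trans _ tM).
  by apply: le_trans (ler_normB _ _) _; rewrite lerD2r.
pose y i := (e i).[t]; pose y' i := (e i)^`().[t].
have yE i : (i < n)%N -> y i = c i + (t - (x - 1)) * \sum_(k < i) a i k * y k.
  move=> il; rewrite /y {1}(family_recurrence oe il) hornerD hornerM hornerC hornerXsubC.
  by congr (_ + _ * _); rewrite horner_sum; apply: eq_bigr => k _; rewrite hornerZ.
have y'E i : (i < n)%N -> y' i = \sum_(k < i) a i k * y k +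
    (t - (x - 1)) * \sum_(k < i) a i k * y' k.
  move=> il; rewrite /y' {1}(family_recurrence oe il) derivD derivC add0r derivM.
  rewrite derivXsubC mul1r hornerD hornerM hornerXsubC raddf_sum !horner_sum.
  congr (_ + _ * _); first by apply: eq_bigr => k _; rewrite hornerZ.
  by apply: eq_bigr => k _; rewrite /= derivZ hornerZ.
have S1 : \sum_(i < n) y i ^+ 2 <= B1 by exact: (gronwall_sum sr cC VD cC yE).
have fF : \sum_(i < n) (\sum_(k < i) a i k * y k) ^+ 2 <= 4 * C * D * B1.
  apply: le_trans (_ : _ <= \sum_(i < n) 2 * (C * V i ^+ 2 + D * c i ^+ 2) * B1) _.
    apply: ler_sum => i _.
    have sub (g : nat -> R) := ler_sum_sqr g (ltnW (ltn_ord i)).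
    set X := \sum_(k < i) c k * y k; set Y := \sum_(k < i) V k * y k.
    have -> : \sum_(k < i) a i k * y k = V i * X - c i * Y.
      by rewrite !mulr_sumr -sumrB; apply: eq_bigr => k _; rewrite /a; ring.
    have X2 : X ^+ 2 <= C * B1.
      apply: le_trans (cauchy_schwarz_sum _ _ _) _.
      by apply: ler_pM; [exact: sumr_sqr_ge0|exact: sumr_sqr_ge0|
        exact: le_trans (sub _) cC|exact: le_trans (sub _) S1].
    have Y2 : Y ^+ 2 <= D * B1.
      apply: le_trans (cauchy_schwarz_sum _ _ _) _.
      by apply: ler_pM; [exact: sumr_sqr_ge0|exact: sumr_sqr_ge0|
        exact: le_trans (sub _) VD|exact: le_trans (sub _) S1].
    have h1 : V i ^+ 2 * X ^+ 2 <= V i ^+ 2 * (C * B1) by rewrite ler_wpM2l ?sqr_ge0.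
    have h2 : c i ^+ 2 * Y ^+ 2 <= c i ^+ 2 * (D * B1) by rewrite ler_wpM2l ?sqr_ge0.
    have := sqr_ge0 (V i * X + c i * Y); nra.
  rewrite -mulr_suml -mulr_sumr big_split /= -!mulr_sumr ler_pM2r//.
  have h1 : C * (\sum_(i < n) V i ^+ 2) <= C * D by rewrite ler_wpM2l.
  have h2 : D * (\sum_(i < n) c i ^+ 2) <= D * C by rewrite ler_wpM2l.
  lra.
have S2 : \sum_(i < n) y' i ^+ 2 <= B2 by exact: (gronwall_sum sr cC VD fF y'E).
pose b i := ip p (e i).
have pE : p = \sum_(i < n) b i *: e i by exact: (family_expand oe (leqnn n) (leqnn n)).
have nE : psqnorm nu p = \sum_(i < n) b i ^+ 2 by rewrite {1}pE family_psqnorm.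
have b0 : 0 <= \sum_(i < n) b i ^+ 2 by apply: sumr_ge0 => k _; exact: sqr_ge0.
split.
- have -> : p.[t] = \sum_(i < n) b i * y i.
    by rewrite {1}pE horner_sum; apply: eq_bigr => i _; rewrite hornerZ.
  apply: le_trans (cauchy_schwarz_sum _ _ _) _; rewrite nE mulrC.
  by rewrite ler_wpM2r//; lra.
- have -> : p^`().[t] = \sum_(i < n) b i * y' i.
    by rewrite {1}pE raddf_sum horner_sum; apply: eq_bigr => i _; rewrite /= derivZ hornerZ.
  apply: le_trans (cauchy_schwarz_sum _ _ _) _; rewrite nE mulrC.
  by rewrite ler_wpM2r//; lra.
Qed.

End orthonormal_polynomials.

(** * Nonnegative polynomials on a half-line *)
Section nonnegative_polynomials.
Context {R : realType}.
Implicit Types (p q r : {poly R}) (x : R).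

Inductive half_line_sos x : {poly R} -> Prop :=
| sos_sqr q : half_line_sos x (q ^+ 2)
| sos_linear_sqr q : half_line_sos x (('X - x%:P) * q ^+ 2)
| sos_add p q : half_line_sos x p -> half_line_sos x q -> half_line_sos x (p + q).

Lemma sos_const x c : 0 <= c -> half_line_sos x c%:P.
Proof. by move=> c0; rewrite -(sqr_sqrtr c0) polyC_exp; exact: sos_sqr. Qed.

Lemma sos_mul_sqr x p q : half_line_sos x p -> half_line_sos x (q ^+ 2 * p).
Proof.
elim=> [r|r|r s _ IHr _ IHs]; first by rewrite -exprMn; exact: sos_sqr.
- by rewrite mulrCA -exprMn; exact: sos_linear_sqr.
- by rewrite mulrDr; exact: sos_add.
Qed.

Lemma sos_mul_linear x p : half_line_sos x p -> half_line_sos x (('X - x%:P) * p).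
Proof.
elim=> [r|r|r s _ IHr _ IHs]; first exact: sos_linear_sqr.
- by rewrite mulrA -expr2 -exprMn; exact: sos_sqr.
- by rewrite mulrDr; exact: sos_add.
Qed.

Lemma horner_ge0_limit p (t0 : R) :
  (forall d, 0 < d -> exists2 t, `|t0 - t| < d & 0 <= p.[t]) -> 0 <= p.[t0].
Proof.
move=> H; rewrite leNgt; apply/negP => pt.
have /(cvgr_lt p.[t0]) /(_ 0 pt) : p.[t] @[t --> t0] --> p.[t0] by exact: continuous_horner.
move=> /nbhs_ballP[d /= d0 Hd]; have [t td] := H _ d0.
by rewrite leNgt Hd.
Qed.

Lemma poly_unbounded p (M : R) : (1 < size p)%N ->
  exists T, forall t, T <= t -> M <= `|p.[t]|.
Proof.
have [n] := ubnP (size p); elim: n p M => // n IH p M; rewrite ltnS => pn p1.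
have [q pq] := div_by_root p 0; rewrite subr0 in pq.
have q0 : q != 0.
  apply/eqP => q0; move: p1; rewrite pq q0 mulr0 addr0 ltnNge.
  by rewrite size_polyC_leq1.
have sq : (size q < size p)%N.
  have -> : size p = (size q).+1.
    rewrite [in LHS]pq addrC mulrC size_polyDl size_mulX//.
    by apply: leq_ltn_trans (size_polyC_leq1 _) _; rewrite ltnS size_poly_gt0.
  exact: ltnSn.
have [T [c c0 HT]] : exists T, exists2 c, 0 < c & forall t, T <= t -> c <= `|q.[t]|.
  have [q1|q1] := leqP (size q) 1.
    exists 0; exists `|q`_0|.
      rewrite normr_gt0; move: q0; apply: contra => /eqP q0.
      by rewrite [q]size1_polyC// q0.
    by move=> t _; rewrite {2}[q]size1_polyC// hornerC.
  have [T HT] := IH q 1 (leq_trans sq pn) q1; exists T; exists 1 => //.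
exists (Num.max T (Num.max 0 ((M + `|p.[0]|) / c))) => t.
rewrite !ge_max => /and3P[Tt t0 tM].
rewrite pq hornerD hornerM hornerC hornerX.
have h : M + `|p.[0]| <= `|t * q.[t]|.
  rewrite normrM ger0_norm//; rewrite ler_pdivrMr// in tM.
  by apply: le_trans tM _; rewrite ler_wpM2l// HT.
have := lerB_normD (t * q.[t]) p.[0]; rewrite [p.[0] + _]addrC; lra.
Qed.

Lemma poly_min_half_line x p : (1 < size p)%N -> (forall t, x <= t -> 0 <= p.[t]) ->
  exists2 t0, x <= t0 & forall t, x <= t -> p.[t0] <= p.[t].
Proof.
move=> p1 p0; have [T HT] := poly_unbounded p.[x] p1.
have xT : x <= Num.max x T by rewrite le_max lexx.
have cont : {within `[x, Num.max x T], continuous (horner p)}.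
  by apply: continuous_subspaceT => u; exact: continuous_horner.
have [t0 + Ht] := EVT_min xT cont; rewrite in_itv/= => /andP[xt0 _].
exists t0 => // t xt; have [tT|Tt] := leP t (Num.max x T).
  by apply: Ht; rewrite in_itv/= xt.
apply: (@le_trans _ _ p.[x]); first by apply: Ht; rewrite in_itv/= lexx.
rewrite -[p.[t]]ger0_norm ?p0//; apply: HT.
by apply: ltW; apply: le_lt_trans Tt; rewrite le_max lexx orbT.
Qed.

(** Subtracting the minimum v of p, attained at t0, leaves a polynomial that
    vanishes at t0: the factor t - t0 splits off once if t0 = x, and twice if
    t0 > x.  The cofactor is nonnegative and of smaller degree. *)
Lemma nonneg_sos x p : (forall t, x <= t -> 0 <= p.[t]) -> half_line_sos x p.
Proof.
have [n] := ubnP (size p); elim: n p => // n IH p; rewrite ltnS => pn p0.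
have [p1|p1] := leqP (size p) 1.
  rewrite [p]size1_polyC//; apply: sos_const.
  by have := p0 x (lexx x); rewrite {1}[p]size1_polyC// hornerC.
have [t0 xt0 Ht0] := poly_min_half_line p1 p0.
have [q pq] := div_by_root p t0; set v := p.[t0] in pq Ht0.
have v0 : 0 <= v by exact: p0.
have qE t : p.[t] - v = (t - t0) * q.[t].
  by rewrite pq hornerD hornerM hornerC hornerXsubC addrAC subrr add0r.
have q0 : q != 0.
  apply/eqP => q0; move: p1; rewrite pq q0 mulr0 addr0 ltnNge.
  by rewrite size_polyC_leq1.
have sizeM r : r != 0 -> size (('X - t0%:P) * r) = (size r).+1.
  by move=> r0; rewrite mulrC size_Mmonic ?monicXsubC// size_XsubC addn2.
have sp : size p = (size q).+1.
  rewrite [in LHS]pq addrC size_polyDl sizeM//.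
  by apply: leq_ltn_trans (size_polyC_leq1 _) _; rewrite ltnS size_poly_gt0.
have qr t : t0 < t -> 0 <= q.[t].
  move=> tt; have := Ht0 t (le_trans xt0 (ltW tt)).
  by rewrite -subr_ge0 qE pmulr_rge0// subr_gt0.
have qt0 : 0 <= q.[t0].
  apply: horner_ge0_limit => d d0; exists (t0 + d / 2); last by apply: qr; lra.
  have -> : t0 - (t0 + d / 2) = - (d / 2) by ring.
  by rewrite normrN ger0_norm; lra.
rewrite pq; apply: sos_add; first exact: sos_const.
move: xt0; rewrite le_eqVlt => /predU1P[xt0|xt0].
  rewrite -xt0; apply: sos_mul_linear; apply: IH.
    by rewrite -sp.
  move=> t; rewrite xt0 le_eqVlt => /predU1P[<-//|]; exact: qr.
have ql t : x <= t -> t < t0 -> q.[t] <= 0.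
  move=> xt tt; have := Ht0 t xt.
  by rewrite -subr_ge0 qE nmulr_rge0// subr_lt0.
have qt0' : q.[t0] = 0.
  apply/eqP; rewrite eq_le qt0 andbT -oppr_ge0 -hornerN.
  apply: horner_ge0_limit => d d0.
  exists (Num.max x (t0 - d / 2)).
    have m1 : Num.max x (t0 - d / 2) < t0 by rewrite gt_max xt0/=; lra.
    have m2 : t0 - d / 2 <= Num.max x (t0 - d / 2) by rewrite le_max lexx orbT.
    by rewrite ger0_norm; lra.
  rewrite hornerN oppr_ge0; apply: ql; first by rewrite le_max lexx.
  by rewrite gt_max xt0/=; lra.
have [s qs] := div_by_root q t0; rewrite qt0' add0r in qs.
have s0 : s != 0 by apply/eqP => s0; rewrite qs s0 mulr0 eqxx in q0.
have sE t : q.[t] = (t - t0) * s.[t] by rewrite qs hornerM hornerXsubC.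
rewrite qs mulrA -expr2; apply: sos_mul_sqr; apply: IH.
  by apply: leq_trans pn; rewrite sp qs sizeM// ltnS leqnSn.
have sr t : x <= t -> t != t0 -> 0 <= s.[t].
  move=> xt; rewrite neq_lt => /orP[tt|tt].
    by have := ql t xt tt; rewrite sE nmulr_rle0// subr_lt0.
  by have := qr t tt; rewrite sE pmulr_rge0// subr_gt0.
move=> t xt; have [->|tt] := eqVneq t t0; last exact: sr.
apply: horner_ge0_limit => d d0; exists (t0 + d / 2).
  have -> : t0 - (t0 + d / 2) = - (d / 2) by ring.
  by rewrite normrN ger0_norm; lra.
by apply: sr; [lra|rewrite gt_eqF//; lra].
Qed.

End nonnegative_polynomials.

(** * Extension of positive functionals *)
Section positive_extension.
Context {R : realType}.
Variables (x : R) (L : {poly R} -> R).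
Implicit Types (p q : {poly R}) (f g h : R -> R).
Hypotheses (LD : forall p q, L (p + q) = L p + L q)
  (LZ : forall c p, L (c *: p) = c * L p)
  (L_ge0 : forall p, (forall t, x <= t -> 0 <= p.[t]) -> 0 <= L p).

Definition poly_dominated f := exists p, forall t, x <= t -> `|f t| <= p.[t].

Let E := poly_dominated.

Lemma dominatedD f g : E f -> E g -> E (fun t => f t + g t).
Proof.
move=> [p fp] [q gq]; exists (p + q) => t xt; rewrite hornerD.
by apply: le_trans (ler_normD _ _) _; apply: lerD; auto.
Qed.

Lemma dominatedZ c f : E f -> E (fun t => c * f t).
Proof.
move=> [p fp]; exists (`|c| *: p) => t xt.
by rewrite hornerZ normrM ler_wpM2l// fp.
Qed.

Lemma dominated_le f g : E g -> (forall t, x <= t -> `|f t| <= g t) -> E f.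
Proof.
move=> [p gp] fg; exists p => t xt; apply: le_trans (fg _ xt) _.
exact: le_trans (ler_norm _) (gp _ xt).
Qed.

Lemma dominated_poly p : E (horner p).
Proof.
exists (p ^+ 2 + 1%:P) => t _; rewrite hornerD horner_exp hornerC ler_norml.
by apply/andP; split; nra.
Qed.

Lemma L0 : L 0 = 0. Proof. by rewrite -(scale0r 0) LZ mul0r. Qed.

Lemma LB p q : L (p - q) = L p - L q.
Proof. by rewrite -scaleN1r LD LZ mulN1r. Qed.

Lemma L_le p q : (forall t, x <= t -> p.[t] <= q.[t]) -> L p <= L q.
Proof.
move=> pq; rewrite -subr_ge0 -LB; apply: L_ge0 => t xt.
by rewrite hornerD hornerN subr_ge0 pq.
Qed.

Definition majorants f := [set L p | p in [set p | forall t, x <= t -> f t <= p.[t]]].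
(** The upper integral attached to L, the largest candidate for an extension. *)
Definition upper f := inf (majorants f).

Lemma majorants_inf f : E f -> has_inf (majorants f).
Proof.
move=> [p fp]; split.
  by exists (L p), p => // t xt; apply: le_trans (ler_norm _) (fp _ xt).
exists (L (- p)) => _ [q fq <-]; apply: L_le => t xt; rewrite hornerN.
apply: le_trans (fq _ xt); rewrite lerNl; apply: le_trans (fp _ xt).
by rewrite -normrN ler_norm.
Qed.

Lemma upper_le f p : E f -> (forall t, x <= t -> f t <= p.[t]) -> upper f <= L p.
Proof.
by move=> Ef fp; apply: ge_inf; [case: (majorants_inf Ef)|exists p].
Qed.

Lemma upper_approx f e : E f -> 0 < e ->
  exists2 p, (forall t, x <= t -> f t <= p.[t]) & L p < upper f + e.
Proof.
move=> Ef e0; have [_ [p fp <-] lt] := inf_adherent e0 (majorants_inf Ef).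
by exists p.
Qed.

Record sublinear (s : (R -> R) -> R) : Prop := Sublinear {
  subD : forall f g, E f -> E g -> s (fun t => f t + g t) <= s f + s g;
  subZ : forall c f, 0 < c -> E f -> s (fun t => c * f t) <= c * s f;
  sub_upper : forall f, E f -> s f <= upper f }.

Lemma sublinear_upper : sublinear upper.
Proof.
split=> //.
- move=> f g Ef Eg; apply/ler_addgt0Pr => e e0; have e2 : 0 < e / 2 by lra.
  have [p fp Lp] := upper_approx Ef e2; have [q gq Lq] := upper_approx Eg e2.
  apply: (@le_trans _ _ (L (p + q))); last by rewrite LD; lra.
  apply: upper_le; first exact: dominatedD.
  by move=> t xt; rewrite hornerD lerD// ?fp ?gq.
- move=> c f c0 Ef; apply/ler_addgt0Pr => e e0.
  have [p fp Lp] := upper_approx Ef (divr_gt0 e0 c0).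
  apply: (@le_trans _ _ (L (c *: p))).
    apply: upper_le; first exact: dominatedZ.
    by move=> t xt; rewrite hornerZ ler_pM2l// fp.
  rewrite LZ; have : c * L p < c * (upper f + e / c) by rewrite ltr_pM2l.
  have -> : c * (upper f + e / c) = c * upper f + e by field; rewrite gt_eqF.
  exact: ltW.
Qed.

Section sublinear_theory.
Variables (s : (R -> R) -> R) (ss : sublinear s).

Let eqf f g : f =1 g -> s f = s g.
Proof. by move=> fg; congr s; apply/funext. Qed.

Lemma dominated0 : E (fun=> 0).
Proof. by exists 0 => t _; rewrite horner0 normr0. Qed.

Lemma sub0 : s (fun=> 0) = 0.
Proof.
have h (c : R) (c0 : 0 < c) := subZ ss c0 dominated0.
have e (c : R) : s (fun t => c * (fun=> 0) t) = s (fun=> 0) by apply: eqf => t; rewrite mulr0.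
have h2 : (0 : R) < 2^-1 by lra.
have := h _ h2; have := h 2 (ltr0n _ 2); rewrite !e; lra.
Qed.

Lemma subZE c f : 0 < c -> E f -> s (fun t => c * f t) = c * s f.
Proof.
move=> c0 Ef; apply/eqP; rewrite eq_le (subZ ss c0 Ef) /=.
have ci : 0 < c^-1 by rewrite invr_gt0.
have := subZ ss ci (dominatedZ c Ef).
rewrite (@eqf _ f); last by move=> t; rewrite mulrA mulVf ?mul1r// gt_eqF.
by rewrite ler_pdivlMl.
Qed.

Lemma sub_lower f : E f -> - s (fun t => (-1) * f t) <= s f.
Proof.
move=> Ef; have := subD ss Ef (dominatedZ (-1) Ef).
rewrite (@eqf _ (fun=> 0)); last by move=> t; rewrite mulN1r subrr.
by rewrite sub0; lra.
Qed.

End sublinear_theory.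

(** Zorn's lemma below the upper integral: the pointwise infimum of a chain is
    sublinear, and is finite because s f >= - s (- f). *)
Lemma minimal_sublinear : exists2 s, sublinear s &
  forall s', sublinear s' -> (forall f, E f -> s' f <= s f) ->
    forall f, E f -> s f <= s' f.
Proof.
pose T := {s | sublinear s}.
pose below (a b : T) := `[< forall f, E f -> sval b f <= sval a f >].
have [||A Atot|[s ss] smin] := @ZL_preorder T (exist _ upper sublinear_upper) below.
- by move=> a; apply/asboolP.
- move=> b a c /asboolP ab /asboolP bc; apply/asboolP => f Ef.
  exact: le_trans (bc _ Ef) (ab _ Ef).
- have [[a0 A0]|nA] := pselect (exists a, A a); last first.
    exists (exist _ upper sublinear_upper) => a Aa; exfalso; apply: nA; by exists a.
  pose V f := [set sval a f | a in A].
  have Vinf f : E f -> has_inf (V f).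
    move=> Ef; split; first by exists (sval a0 f), a0.
    exists (- upper (fun t => (-1) * f t)) => _ [[a sa] Aa <-] /=.
    apply: le_trans (sub_lower sa Ef); rewrite lerN2.
    exact: (sub_upper sa (dominatedZ (-1) Ef)).
  have Vle f a : E f -> A a -> inf (V f) <= sval a f.
    by move=> Ef Aa; apply: ge_inf; [case: (Vinf _ Ef)|exists a].
  have Vs : sublinear (fun f => inf (V f)).
    split.
    + move=> f g Ef Eg; apply/ler_addgt0Pr => e e0; have e2 : 0 < e / 2 by lra.
      have [_ [a Aa <-] fa] := inf_adherent e2 (Vinf _ Ef).
      have [_ [b Ab <-] gb] := inf_adherent e2 (Vinf _ Eg).
      have [/asboolP ab|/asboolP ba] := Atot _ _ Aa Ab.
        apply: le_trans (Vle _ _ (dominatedD Ef Eg) Ab) _.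
        have := subD (proj2_sig b) Ef Eg; have := ab _ Ef; lra.
      apply: le_trans (Vle _ _ (dominatedD Ef Eg) Aa) _.
      have := subD (proj2_sig a) Ef Eg; have := ba _ Eg; lra.
    + move=> c f c0 Ef; apply/ler_addgt0Pr => e e0.
      have [_ [a Aa <-] fa] := inf_adherent (divr_gt0 e0 c0) (Vinf _ Ef).
      apply: le_trans (Vle _ _ (dominatedZ c Ef) Aa) _.
      apply: le_trans (subZ (proj2_sig a) c0 Ef) _.
      have : c * sval a f < c * (inf (V f) + e / c) by rewrite ltr_pM2l.
      have -> : c * (inf (V f) + e / c) = c * inf (V f) + e by field; rewrite gt_eqF.
      exact: ltW.
    + move=> f Ef; apply: le_trans (Vle _ _ Ef A0) _.
      exact: (sub_upper (proj2_sig a0) Ef).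
  exists (exist _ _ Vs) => a Aa; apply/asboolP => f Ef /=; exact: Vle.
- exists s => // s' ss' le f Ef.
  have : below (exist _ s ss) (exist _ s' ss') by apply/asboolP.
  by move=> /smin /asboolP /(_ f Ef).
Qed.

(** A minimal sublinear s is linear.  For fixed f, the infimum over l >= 0 of
    s (g + l f) - l s f is sublinear in g and at most s, hence equal to s; taking
    g = - f and l = 1 gives s (- f) <= - s f. *)
Theorem positive_extension : exists Lam : (R -> R) -> R,
  [/\ forall f g, E f -> E g -> Lam (fun t => f t + g t) = Lam f + Lam g,
      forall c f, E f -> Lam (fun t => c * f t) = c * Lam f,
      forall f, E f -> (forall t, x <= t -> 0 <= f t) -> 0 <= Lam f &
      forall p, Lam (horner p) = L p].
Proof.
have [s ss smin] := minimal_sublinear.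
have eqs f g : f =1 g -> s f = s g by move=> fg; congr s; apply/funext.
have sN f : E f -> s (fun t => (-1) * f t) = - s f.
  move=> Ef; apply/eqP; rewrite eq_le; apply/andP; split; last first.
    by have := sub_lower ss Ef; lra.
  pose V g := [set s (fun t => g t + l * f t) - l * s f | l in [set l : R | 0 <= l]].
  have Eg g l : E g -> E (fun t => g t + l * f t).
    by move=> Egg; apply: dominatedD => //; exact: dominatedZ.
  have sl l : 0 <= l -> s (fun t => l * f t) = l * s f.
    rewrite le_eqVlt => /predU1P[<-|l0]; last exact: subZE.
    rewrite mul0r -[RHS](sub0 ss); apply: eqs => t; exact: mul0r.
  have Vinf g : E g -> has_inf (V g).
    move=> Egg; split.
      by exists (s (fun t => g t + 0 * f t) - 0 * s f), 0 => /=.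
    exists (- s (fun t => (-1) * g t)) => _ [l /= l0 <-].
    have := subD ss (Eg g l Egg) (dominatedZ (-1) Egg).
    rewrite (@eqs _ (fun t => l * f t)); last by move=> t; ring.
    by rewrite sl//; lra.
  have Vle g l : E g -> 0 <= l -> inf (V g) <= s (fun t => g t + l * f t) - l * s f.
    by move=> Egg l0; apply: ge_inf; [case: (Vinf _ Egg)|exists l].
  have V0 g : E g -> inf (V g) <= s g.
    move=> Egg; have := Vle g 0 Egg (lexx _); rewrite mul0r subr0.
    by rewrite (@eqs _ g)// => t; rewrite mul0r addr0.
  have Vs : sublinear (fun g => inf (V g)).
    split.
    - move=> g h Egg Eh; apply/ler_addgt0Pr => e e0; have e2 : 0 < e / 2 by lra.
      have [_ [l /= l0 <-] gl] := inf_adherent e2 (Vinf _ Egg).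
      have [_ [k /= k0 <-] hk] := inf_adherent e2 (Vinf _ Eh).
      apply: le_trans (Vle _ _ (dominatedD Egg Eh) (addr_ge0 l0 k0)) _.
      have := subD ss (Eg g l Egg) (Eg h k Eh).
      rewrite (@eqs _ (fun t => g t + h t + (l + k) * f t)); last by move=> t; ring.
      lra.
    - move=> c g c0 Egg; apply/ler_addgt0Pr => e e0.
      have [_ [l /= l0 <-] gl] := inf_adherent (divr_gt0 e0 c0) (Vinf _ Egg).
      apply: le_trans (Vle _ _ (dominatedZ c Egg) (mulr_ge0 (ltW c0) l0)) _.
      have := subZ ss c0 (Eg g l Egg).
      rewrite (@eqs _ (fun t => c * g t + c * l * f t)); last by move=> t; ring.
      set A := s _; set B := s _ => AB.
      have : c * (B - l * s f) < c * (inf (V g) + e / c) by rewrite ltr_pM2l.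
      have -> : c * (inf (V g) + e / c) = c * inf (V g) + e by field; rewrite gt_eqF.
      lra.
    - by move=> g Egg; apply: le_trans (V0 _ Egg) _; exact: sub_upper.
  have EN := dominatedZ (-1) Ef.
  apply: le_trans (smin _ Vs V0 _ EN) _.
  have := Vle _ 1 EN ler01.
  rewrite (@eqs _ (fun=> 0)); last by move=> t; ring.
  by rewrite (sub0 ss) mul1r sub0r.
have sD f g : E f -> E g -> s (fun t => f t + g t) = s f + s g.
  move=> Ef Eg; apply/eqP; rewrite eq_le (subD ss)//=.
  have := subD ss (dominatedD Ef Eg) (dominatedZ (-1) Eg).
  rewrite (@eqs _ f); last by move=> t; ring.
  by rewrite sN//; lra.
have sZ c f : E f -> s (fun t => c * f t) = c * s f.
  move=> Ef; have [c0|c0|->] := ltgtP c 0.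
  - rewrite (@eqs _ (fun t => (-1) * ((- c) * f t))); last by move=> t; ring.
    rewrite sN; last exact: dominatedZ.
    by rewrite (subZE ss) ?oppr_gt0//; ring.
  - exact: subZE.
  - rewrite mul0r -[RHS](sub0 ss); apply: eqs => t; exact: mul0r.
exists s; split=> //.
- move=> f Ef f0; have h : s (fun t => (-1) * f t) <= 0.
    apply: le_trans (sub_upper ss (dominatedZ (-1) Ef)) _.
    rewrite -L0; apply: upper_le; first exact: dominatedZ.
    by move=> t xt; rewrite horner0 mulN1r oppr_le0 f0.
  by rewrite sN// oppr_le0 in h.
- have h p : s (horner p) <= L p.
    by apply: le_trans (sub_upper ss (dominated_poly p)) _; apply: upper_le => //; exact: dominated_poly.
  move=> p; apply/eqP; rewrite eq_le h /=.
  have := h (- p); rewrite (@eqs _ (fun t => (-1) * p.[t])); last by move=> t; rewrite hornerN mulN1r.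
  rewrite sN; last exact: dominated_poly.
  by rewrite -[- p]scaleN1r LZ; lra.
Qed.

End positive_extension.

(** * Representation of positive functionals by measures *)

(** Lebesgue-Stieltjes measures are defined on the sigma-algebra generated by the
    intervals ]a, b]; this one is repackaged over the Borel structure of R. *)
Lemma measure_of_cumulative {R : realType} (F : R -> R) :
  nondecreasing F -> right_continuous F ->
  exists mu : {measure set R -> \bar R},
    forall a b, a <= b -> mu `]a, b]%classic = (F b - F a)%:E.
Proof.
move=> nd rc.
pose cF : cumulative R R := HB.pack_for (cumulative R R) F (isCumulative.Build R _ R F nd rc).
pose m : set R -> \bar R := lebesgue_stieltjes_measure cF.
have m0 : m set0 = 0%E by exact: (measure0 (lebesgue_stieltjes_measure cF)).
have mge0 A : (0 <= m A)%E by exact: (measure_ge0 (lebesgue_stieltjes_measure cF)).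
have msa : semi_sigma_additive m.
  exact: (@measure_semi_sigma_additive _ _ _ (lebesgue_stieltjes_measure cF)).
pose mu : {measure set R -> \bar R} := HB.pack_for {measure set R -> \bar R} m
  (isMeasure.Build _ _ _ m m0 mge0 msa).
exists mu => a b ab; rewrite /mu /= /m /lebesgue_stieltjes_measure /measure_extension /=.
have := @measurable_mu_extE _ _ _ (wlength cF) _ (is_ocitv a b).
by move=> /= ->; rewrite wlength_itv_bnd.
Qed.

Section counting_levels.
Context {R : realType}.

(** A staircase with unit steps, within 1 below y as long as y <= n + 1; rescaled,
    it turns an integral into a finite sum of measures of superlevel sets. *)
Definition levels n (y : R) : R := \sum_(i < n) ((i.+1%:R < y)%R%:R : R).

Lemma levels_le n y : 0 <= y -> levels n y <= y.
Proof.
move=> y0; suff [h1 h2] : levels n y <= y /\ levels n y <= n%:R by [].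
elim: n => [|n [IH1 IH2]]; rewrite /levels ?big_ord0// big_ord_recr/= -/(levels n y).
have e : n.+1%:R = n%:R + 1 :> R by rewrite natr1.
have [h|h] := boolP (n.+1%:R < y); rewrite /= ?mulr1n ?mulr0n e; last by split; lra.
by rewrite e in h; split; lra.
Qed.

Lemma levels_ge n y : y <= n.+1%:R -> y - 1 <= levels n y.
Proof.
elim: n => [|n IH] h; rewrite /levels ?big_ord0 ?big_ord_recr/=.
  by rewrite subr_le0.
have nn : n.+2%:R = n.+1%:R + 1 :> R by rewrite natr1.
have [k|k] := ltP n.+1%:R y; last by rewrite addr0; exact: IH.
have -> : \sum_(i < n) ((i.+1%:R < y)%R%:R : R) = n%:R.
  transitivity (\sum_(i < n) (1 : R)); last by rewrite sumr_const card_ord.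
  apply: eq_bigr => i _; rewrite (lt_trans _ k)// ltr_nat ltnS//.
by rewrite natr1; lra.
Qed.

End counting_levels.

Section moment_representation.
Context {R : realType}.
Variables (x : R) (L : {poly R} -> R).
Implicit Types (p q : {poly R}) (f g h : R -> R).
Hypotheses (LD : forall p q, L (p + q) = L p + L q)
  (LZ : forall c p, L (c *: p) = c * L p)
  (L_sqr : forall q, 0 <= L (q ^+ 2))
  (L_linear_sqr : forall q, 0 <= L (('X - x%:P) * q ^+ 2)).

(** The two families of squares generate all polynomials that are nonnegative on
    the half-line. *)
Lemma L_nonneg p : (forall t, x <= t -> 0 <= p.[t]) -> 0 <= L p.
Proof.
move=> /nonneg_sos; elim=> // {}p q _ p0 _ q0.
by rewrite LD addr_ge0.
Qed.

Section representing.
Variable Lam : (R -> R) -> R.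
Let E := @poly_dominated R x.
Hypotheses (LamD : forall f g, E f -> E g -> Lam (fun t => f t + g t) = Lam f + Lam g)
  (LamZ : forall c f, E f -> Lam (fun t => c * f t) = c * Lam f)
  (Lam_ge0 : forall f, E f -> (forall t, x <= t -> 0 <= f t) -> 0 <= Lam f)
  (LamL : forall p, Lam (horner p) = L p).

Lemma Lam_le f g : E f -> E g -> (forall t, x <= t -> f t <= g t) -> Lam f <= Lam g.
Proof.
move=> Ef Eg fg; have Nf := dominatedZ (-1) Ef.
have := Lam_ge0 (dominatedD Eg Nf); rewrite LamD// LamZ// mulN1r subr_ge0; apply.
by move=> t xt; rewrite mulN1r subr_ge0 fg.
Qed.

Lemma Lam_eq f g : E f -> E g -> (forall t, x <= t -> f t = g t) -> Lam f = Lam g.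
Proof. by move=> Ef Eg fg; apply: le_anti; rewrite !Lam_le// => t /fg ->. Qed.

Lemma dominated_bounded f (M : R) : (forall t, x <= t -> `|f t| <= M) -> E f.
Proof. by move=> fM; exists M%:P => t xt; rewrite hornerC fM. Qed.

Lemma dominated_indic (A : set R) : E (\1_A).
Proof.
apply: (@dominated_bounded _ 1) => t _.
by rewrite indicE; case: (_ \in _); rewrite ?normr0 ?normr1.
Qed.

Let m := Lam (cst 1).

Lemma dominated_cst (c : R) : E (cst c).
Proof. by apply: (@dominated_bounded _ `|c|). Qed.

Lemma Lam_cst c : Lam (cst c) = c * m.
Proof.
rewrite -LamZ; last exact: dominated_cst.
by congr Lam; apply/funext => t /=; rewrite mulr1.
Qed.

(** The distribution function of the functional; it need not be right continuous,
    whence its regularisation F. *)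
Let G s := Lam (\1_`]-oo, s]).

Lemma G_ge0 s : 0 <= G s.
Proof. by apply: Lam_ge0 => //; exact: dominated_indic. Qed.

Lemma indic_le (A B : set R) : A `<=` B -> forall t : R, (\1_A t : R) <= \1_B t.
Proof.
move=> AB t; rewrite !indicE.
by case: (boolP (t \in A)) => [/set_mem/AB/mem_set ->|_]; rewrite ?ler0n.
Qed.

Lemma G_nd : nondecreasing G.
Proof.
move=> a b ab; apply: Lam_le; try exact: dominated_indic.
move=> t _; apply: indic_le => u /=; rewrite !in_itv/= => /le_trans; exact.
Qed.

Let F s := inf [set G r | r in [set r | s < r]].

Lemma F_has_inf s : has_inf [set G r | r in [set r | s < r]].
Proof.
split; first by exists (G (s + 1)), (s + 1) => //=; rewrite ltrDl.
by exists 0 => _ [r _ <-]; exact: G_ge0.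
Qed.

Lemma F_le s r : s < r -> F s <= G r.
Proof. by move=> sr; apply: ge_inf; [case: (F_has_inf s)|exists r]. Qed.

Lemma F_ge s : G s <= F s.
Proof.
apply: lb_le_inf; first by case: (F_has_inf s).
by move=> _ [r /= sr <-]; apply: G_nd; exact: ltW.
Qed.

Lemma F_nd : nondecreasing F.
Proof.
move=> a b ab; apply: lb_le_inf; first by case: (F_has_inf b).
by move=> _ [r /= br <-]; apply: F_le; exact: le_lt_trans br.
Qed.

Lemma F_rc : right_continuous F.
Proof.
move=> s; apply/cvgrPdist_lt => e e0.
have [_ [r /= sr <-] Gr] := inf_adherent e0 (F_has_inf s).
near=> t; have st : s < t by near: t; exact: nbhs_right_gt.
have tr : t < r by near: t; exact: nbhs_right_lt.
have h1 := F_nd (ltW st); have h2 := F_le tr.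
by rewrite distrC ger0_norm ?subr_ge0// ltrBlDl; exact: le_lt_trans h2 _.
Unshelve. all: by end_near. Qed.

Variable mu : {measure set R -> \bar R}.
Hypothesis muF : forall a b, a <= b -> mu `]a, b]%classic = (F b - F a)%:E.

(** On rays mu is compared with Lam by monotone limits; only inequalities hold,
    because Lam need not be continuous along monotone sequences. *)
Lemma mu_ray_gt s : (mu `]s, +oo[%classic <= (Lam (\1_`]s, +oo[))%:E)%E.
Proof.
pose A n := `]s, s + n%:R]%classic.
have UA : `]s, +oo[%classic = \bigcup_n A n.
  apply/seteqP; split=> t /=; rewrite ?in_itv/= ?andbT.
    move=> st; exists (Num.truncn (t - s)).+1 => //; rewrite /A/= in_itv/= st/=.
    by have := truncnS_gt (t - s); lra.
  by case=> n _; rewrite /A/= in_itv/= => /andP[].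
have cv : (mu \o A) n @[n --> \oo] --> mu `]s, +oo[%classic.
  rewrite UA; apply: nondecreasing_cvg_mu.
  - by move=> i; exact: measurable_itv.
  - by apply: bigcupT_measurable => i; exact: measurable_itv.
  - move=> i j ij; apply/subsetPset => t; rewrite /A/= !in_itv/= => /andP[-> ti]/=.
    by apply: le_trans ti _; rewrite lerD2l ler_nat.
rewrite -(cvg_lim _ cv)//; apply: lime_le; first by apply/cvg_ex; eexists; exact: cv.
apply: nearW => n; rewrite /= muF ?lerDl// lee_fin.
have h1 : F (s + n%:R) <= G (s + n%:R + 1) by apply: F_le; rewrite ltrDl.
have h2 := F_ge s.
have h3 : G (s + n%:R + 1) <= m.
  apply: Lam_le; [exact: dominated_indic|exact: dominated_cst|].
  by move=> t _; rewrite indicE; case: (_ \in _).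
have h4 : m = G s + Lam (\1_`]s, +oo[).
  rewrite /m /G -LamD; try exact: dominated_indic.
  congr Lam; apply/funext => t /=; rewrite !indicE.
  have -> : (t \in `]-oo, s]%classic) = (t <= s) by apply/idP/idP; rewrite inE/= in_itv.
  have -> : (t \in `]s, +oo[%classic) = (s < t).
    by apply/idP/idP; rewrite inE/= in_itv/= andbT.
  by case: leP; rewrite ?addr0 ?add0r.
lra.
Qed.

Lemma mu_ray_lt s : (mu `]-oo, s[%classic <= (Lam (\1_`]-oo, s[))%:E)%E.
Proof.
pose A n := `]s - n.+1%:R, s - n.+1%:R^-1]%classic.
have n0 n : 0 < n.+1%:R^-1 :> R by rewrite invr_gt0.
have n1 n : n.+1%:R^-1 <= 1 :> R by rewrite invf_le1// ler1n.
have n2 n : 1 <= n.+1%:R :> R by rewrite ler1n.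
have UA : `]-oo, s[%classic = \bigcup_n A n.
  apply/seteqP; split=> t /=; rewrite ?in_itv/=.
    move=> st; have st0 : 0 < s - t by lra.
    have [k h1 h2] : exists2 k : nat, s - t < k.+1%:R & (s - t)^-1 < k.+1%:R.
      exists (maxn (Num.truncn (s - t)) (Num.truncn (s - t)^-1)).
        by apply: lt_le_trans (truncnS_gt _) _; rewrite ler_nat ltnS leq_max leqnn.
      by apply: lt_le_trans (truncnS_gt _) _; rewrite ler_nat ltnS leq_max leqnn orbT.
    exists k => //; rewrite /A/= in_itv/=.
    have h3 : k.+1%:R^-1 < s - t by rewrite invf_plt ?posrE.
    by rewrite ltrBlDr -ltrBlDl h1 lerBrDr -lerBrDl ltW.
  case=> n _; rewrite /A/= in_itv/= => /andP[_] /le_lt_trans; apply.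
  by rewrite ltrBlDr ltrDl n0.
have cv : (mu \o A) n @[n --> \oo] --> mu `]-oo, s[%classic.
  rewrite UA; apply: nondecreasing_cvg_mu.
  - by move=> i; exact: measurable_itv.
  - by apply: bigcupT_measurable => i; exact: measurable_itv.
  - move=> i j ij; apply/subsetPset => t; rewrite /A/= !in_itv/= => /andP[h1 h2].
    have i1 : i.+1%:R <= j.+1%:R :> R by rewrite ler_nat.
    have i2 : j.+1%:R^-1 <= i.+1%:R^-1 :> R by rewrite lef_pV2 ?posrE.
    by apply/andP; split; [apply: le_lt_trans h1|apply: le_trans h2 _];
      rewrite lerD2l lerN2.
rewrite -(cvg_lim _ cv)//; apply: lime_le; first by apply/cvg_ex; eexists; exact: cv.
apply: nearW => n; rewrite /= muF; last by rewrite lerD2l lerN2 (le_trans (n1 n)).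
rewrite lee_fin.
have h1 : F (s - n.+1%:R^-1) <= G (s - n.+1%:R^-1 / 2).
  by apply: F_le; rewrite ltrD2l ltrN2 ltr_pdivrMr// ltr_pMr ?n0// ltr1n.
have h2 := F_ge (s - n.+1%:R); have h2' := G_ge0 (s - n.+1%:R).
have h3 : G (s - n.+1%:R^-1 / 2) <= Lam (\1_`]-oo, s[).
  apply: Lam_le; try exact: dominated_indic.
  move=> t _; apply: indic_le => u /=; rewrite !in_itv/= => /le_lt_trans; apply.
  by rewrite ltrBlDr ltrDl divr_gt0// n0.
lra.
Qed.

Lemma mu_carried : carried mu x.
Proof.
apply/eqP; rewrite -measure_le0.
have -> : [set t | t < x] = `]-oo, x[%classic.
  by apply/seteqP; split=> t /=; rewrite in_itv.
apply: le_trans (mu_ray_lt x) _; rewrite lee_fin.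
have z0 : Lam (cst 0) = 0 by rewrite Lam_cst mul0r.
rewrite -z0; apply: Lam_le; [exact: dominated_indic|exact: dominated_cst|].
by move=> t xt; rewrite indicE memNset//= in_itv/=; apply/negP; rewrite -leNgt.
Qed.

Lemma mu_setT_le : (mu setT <= m%:E)%E.
Proof.
have -> : mu setT = mu `]x - 1, +oo[%classic.
  have -> : setT = `]x - 1, +oo[%classic `|` [set t | t < x].
    apply/seteqP; split=> t //= _; rewrite in_itv/= andbT.
    by have [|] := ltP t x; [right|left; lra].
  by rewrite measureU0//; [exact: measurable_lt|exact: mu_carried].
apply: le_trans (mu_ray_gt _) _; rewrite lee_fin.
apply: Lam_le; [exact: dominated_indic|exact: dominated_cst|].
by move=> t _; rewrite indicE; case: (_ \in _).
Qed.

Lemma mu_setT_fin : (mu setT < +oo)%E.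
Proof. by apply: le_lt_trans mu_setT_le _; rewrite ltry. Qed.

(** No mass escapes to infinity: by Chebyshev, Lam of the ray beyond x + d is at
    most Lam (t - x) / d. *)
Lemma mu_setT_ge : m <= mass mu setT.
Proof.
apply/ler_addgt0Pr => e e0.
pose k := Lam (horner ('X - x%:P)).
have k0 : 0 <= k.
  by apply: Lam_ge0 => [|t xt]; [exact: dominated_poly|rewrite hornerXsubC subr_ge0].
pose d := k / e + 1; have d0 : 0 < d by rewrite ltr_wpDl// divr_ge0// ltW.
have h1 : m - k / d <= G (x + d).
  have -> : m - k / d = Lam (fun t => cst 1 t + (- d^-1) * ('X - x%:P).[t]).
    rewrite LamD; [|exact: dominated_cst|by apply: dominatedZ; exact: dominated_poly].
    by rewrite LamZ ?mulNr ?[_ * Lam _]mulrC//; exact: dominated_poly.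
  apply: Lam_le.
  - by apply: dominatedD; [exact: dominated_cst|apply: dominatedZ; exact: dominated_poly].
  - exact: dominated_indic.
  - move=> t xt; rewrite hornerXsubC indicE; have [td|td] := leP t (x + d).
      rewrite mem_set ?in_itv//= mulNr gerBl mulr_ge0 ?subr_ge0//.
      by rewrite invr_ge0 ltW.
    rewrite memNset//=; last by rewrite in_itv/=; apply/negP; rewrite -ltNge.
    by rewrite mulNr subr_le0 mulrC ler_pdivlMr// mul1r; lra.
have h2 : F (x - 1) = 0.
  apply: le_anti; apply/andP; split; last exact: le_trans (G_ge0 _) (F_ge _).
  apply: le_trans (F_le (_ : x - 1 < x - 2^-1)) _; first lra.
  have z0 : Lam (cst 0) = 0 by rewrite Lam_cst mul0r.
  rewrite -z0; apply: Lam_le; [exact: dominated_indic|exact: dominated_cst|].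
  by move=> t xt; rewrite indicE memNset//= in_itv/=; apply/negP; rewrite -ltNge; lra.
have h3 : G (x + d) <= mass mu setT.
  rewrite -lee_fin /mass fineK; last by rewrite ge0_fin_numE// mu_setT_fin.
  apply: (@le_trans _ _ (mu `]x - 1, x + d]%classic)).
    by rewrite muF ?h2 ?subr0 ?lee_fin; [exact: F_ge|lra].
  by apply: le_measure; rewrite ?inE.
have h4 : k / d <= e.
  rewrite ler_pdivrMr// /d mulrDr mulr1 mulrCA divff ?mulr1 ?gt_eqF//.
  by rewrite lerDl ltW.
lra.
Qed.

Lemma mu_setT : mass mu setT = m.
Proof.
apply: le_anti; rewrite mu_setT_ge andbT -lee_fin /mass fineK ?mu_setT_le//.
by rewrite ge0_fin_numE// mu_setT_fin.
Qed.

Lemma Lam_sum n (H : nat -> R -> R) : (forall i, E (H i)) ->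
  E (fun t => \sum_(i < n) H i t) /\
  Lam (fun t => \sum_(i < n) H i t) = \sum_(i < n) Lam (H i).
Proof.
move=> EH; elim: n => [|n [IH1 IH2]].
  have -> : (fun t : R => \sum_(i < 0) H i t) = cst 0.
    by apply/funext => t; rewrite big_ord0.
  by rewrite big_ord0 Lam_cst mul0r; split => //; exact: dominated_cst.
have -> : (fun t => \sum_(i < n.+1) H i t) = (fun t => \sum_(i < n) H i t + H n t).
  by apply/funext => t; rewrite big_ord_recr.
split; first exact: (dominatedD IH1 (EH n)).
by rewrite big_ord_recr /= -IH2 LamD.
Qed.

(** Layer cake: f is a limit of staircases below it whose steps are superlevel
    sets, and Fatou's lemma applies. *)
Lemma int_le_Lam f : measurable_fun setT f -> (forall t, 0 <= f t) -> E f ->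
  (forall c : R, 0 < c ->
    (mu [set t | (c < f t)%R] <= (Lam (\1_[set t | (c < f t)%R]))%:E)%E) ->
  (\int[mu]_t (f t)%:E <= (Lam f)%:E)%E.
Proof.
move=> mf f0 Ef sup.
pose A n i := [set t | i.+1%:R / n.+1%:R < f t].
have mA n i : measurable (A n i).
  have -> : A n i = setT `&` f @^-1` `]i.+1%:R / n.+1%:R, +oo[%classic.
    by apply/seteqP; split=> t /=; rewrite in_itv/= andbT; [move=> ?; split|case].
  exact: mf.
pose g (n : nat) (t : R) : R := \sum_(i < n.+1 ^ 2) n.+1%:R^-1 * \1_(A n i) t.
have gE n t : g n t = n.+1%:R^-1 * levels (n.+1 ^ 2) (n.+1%:R * f t).
  rewrite /g /levels mulr_sumr; apply: eq_bigr => i _; congr (_ * _).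
  rewrite indicE; congr ((_ : bool)%:R).
  by apply/idP/idP; rewrite inE /A/= ltr_pdivrMr// mulrC.
have gf n t : g n t <= f t.
  by rewrite gE ler_pdivrMl// levels_le// mulr_ge0.
have g0 n t : 0 <= g n t.
  by apply: sumr_ge0 => i _; rewrite mulr_ge0// invr_ge0.
have mg n : measurable_fun setT (g n).
  by apply: measurable_sum => i; apply: measurable_funM.
have cvg_g t : g n t @[n --> \oo] --> f t.
  apply: (@squeeze_cvgr _ _ _ _ (fun n : nat => f t - n.+1%:R^-1) (cst (f t))).
  - near=> n; rewrite gf andbT gE.
    have ft : f t < n%:R.
      apply: lt_le_trans (truncnS_gt _) _; rewrite ler_nat.
      near: n; exact: nbhs_infty_gt.
    have n0 : 0 < n.+1%:R :> R by [].
    have := @levels_ge _ (n.+1 ^ 2) (n.+1%:R * f t).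
    have -> : n.+1%:R * f t <= (n.+1 ^ 2).+1%:R.
      rewrite -[(n.+1 ^ 2).+1%:R]natr1 natrX expr2.
      have : n.+1%:R * f t <= n.+1%:R * n.+1%:R.
        by rewrite ler_pM2l//; apply: ltW (lt_trans ft _); rewrite ltr_nat.
      lra.
    move=> /(_ isT) h.
    have -> : f t - n.+1%:R^-1 = n.+1%:R^-1 * (n.+1%:R * f t - 1).
      by rewrite mulrBr mulr1 mulKf.
    by rewrite ler_pM2l// invr_gt0.
  - rewrite -[X in _ --> X]subr0; apply: cvgB; first exact: cvg_cst.
    exact: cvg_harmonic.
  - exact: cvg_cst.
have ig n : (\int[mu]_t (g n t)%:E <= (Lam f)%:E)%E.
  apply: (@le_trans _ _ (Lam (g n))%:E); last first.
    rewrite lee_fin; apply: Lam_le => //.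
    by apply: (dominated_le Ef) => t _; rewrite ger0_norm.
  have -> : (fun t => (g n t)%:E) =
      (fun t => \sum_(i < n.+1 ^ 2) (n.+1%:R^-1 * \1_(A n i) t)%:E)%E.
    by apply/funext => t; rewrite /g sumEFin.
  rewrite ge0_integral_sum//; last first.
    by move=> i; apply/measurable_EFinP; apply: measurable_funM.
  have Eg i : E (fun t => n.+1%:R^-1 * \1_(A n i) t).
    by apply: dominatedZ; exact: dominated_indic.
  have [_] := Lam_sum (n.+1 ^ 2) Eg; rewrite -/(g n) => ->.
  rewrite -sumEFin; apply: lee_sum => i _.
  rewrite LamZ; last exact: dominated_indic.
  rewrite EFinM.
  under eq_integral do rewrite EFinM.
  rewrite ge0_integralZl//; last first.
    by apply/measurable_EFinP; exact: measurable_indic.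
  rewrite integral_indic// setIT lee_wpmul2l ?lee_fin ?invr_ge0//.
  by apply: sup; rewrite divr_gt0.
have := @fatou _ _ _ mu setT measurableT (fun n t => (g n t)%:E).
have lim_g t : limn_einf (fun n => (g n t)%:E) = (f t)%:E.
  by apply: (cvg_limn_einf_sup _).1; apply/fine_cvgP; split; [exact: nearW|exact: cvg_g].
under eq_integral do rewrite lim_g.
move=> /(_ _ _)/le_trans; apply.
- by move=> n; exact/measurable_EFinP.
- by move=> n t _; rewrite lee_fin.
- rewrite limn_einf_lim; apply: lime_le; first exact: is_cvg_einfs.
  apply: nearW => n; apply: le_trans (ig n); apply: ereal_inf_lbound.
  by exists n => /=.
Unshelve. all: by end_near. Qed.

Lemma root_exists (c : R) n : 0 < c -> exists2 r, 0 < r & r ^+ n.+1 = c.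
Proof.
move=> c0; exists (c `^ (n.+1%:R^-1)); first exact: powR_gt0.
by rewrite -powR_mulrn ?powR_ge0// -powRrM mulVf ?powRr1// ltW.
Qed.

(** The powers of t - x made monotone on the whole line, so that their superlevel
    sets are rays. *)
Definition trunc_pow n t := Num.max 0 (t - x) ^+ n.+1.

Lemma trunc_pow_ge0 n t : 0 <= trunc_pow n t.
Proof. by rewrite exprn_ge0// le_max lexx. Qed.

Lemma trunc_powE n t : x <= t -> trunc_pow n t = (('X - x%:P) ^+ n.+1).[t].
Proof.
by move=> xt; rewrite /trunc_pow horner_exp hornerXsubC max_r// subr_ge0.
Qed.

Lemma trunc_pow_lt n c t r : 0 < r -> r ^+ n.+1 = c -> (c < trunc_pow n t) = (x + r < t).
Proof.
move=> r0 <-; rewrite /trunc_pow ltr_pXn2r ?nnegrE ?(ltW r0)//; last by rewrite le_max lexx.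
by rewrite lt_max ltNge (ltW r0)/= ltrBrDl.
Qed.

Lemma trunc_pow_gt n c t r : 0 < r -> r ^+ n.+1 = c -> (trunc_pow n t < c) = (t < x + r).
Proof.
move=> r0 <-; rewrite /trunc_pow ltr_pXn2r ?nnegrE ?(ltW r0)//; last by rewrite le_max lexx.
by rewrite gt_max r0/= ltrBlDl.
Qed.

Lemma measurable_trunc_pow n : measurable_fun setT (trunc_pow n).
Proof.
apply: measurable_funX; apply: measurable_maxr; first exact: measurable_cst.
by apply: measurable_funB; [exact: measurable_id|exact: measurable_cst].
Qed.

Lemma dominated_trunc_pow n : E (trunc_pow n).
Proof.
apply: (dominated_le (dominated_poly x (('X - x%:P) ^+ n.+1))) => t xt.
by rewrite ger0_norm ?trunc_pow_ge0// trunc_powE.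
Qed.

Lemma Lam_trunc_pow n : Lam (trunc_pow n) = L (('X - x%:P) ^+ n.+1).
Proof.
rewrite -LamL; apply: Lam_eq; [exact: dominated_trunc_pow|exact: dominated_poly|].
by move=> t; exact: trunc_powE.
Qed.

Lemma intble_finite f : measurable_fun setT f -> (forall t, 0 <= f t) ->
  (\int[mu]_t (f t)%:E < +oo)%E -> intble mu f.
Proof.
move=> mf f0 fi; apply/integrableP; split; first exact/measurable_EFinP.
by under eq_integral do rewrite /= ger0_norm//.
Qed.

Lemma intble_const (c : R) : 0 <= c -> intble mu (cst c).
Proof.
move=> c0; apply: intble_finite => [|t|]; [exact: measurable_cst|exact: c0|].
have /= -> := @integral_cst _ _ _ mu setT measurableT c%:E.
by rewrite lte_mul_pinfty ?lee_fin// mu_setT_fin.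
Qed.

(** The upper bound is the layer cake inequality for f.  The lower bound is the
    same inequality for N - min(f, N), whose superlevel sets are rays to the left;
    the truncation costs at most Lam (f^2) / N. *)
Lemma int_trunc_pow n :
  intble mu (trunc_pow n) /\ \int[mu]_t trunc_pow n t = L (('X - x%:P) ^+ n.+1).
Proof.
set f := trunc_pow n.
have f0 t : 0 <= f t by exact: trunc_pow_ge0.
have mf : measurable_fun setT f by exact: measurable_trunc_pow.
have Ef : E f by exact: dominated_trunc_pow.
have upp : (\int[mu]_t (f t)%:E <= (Lam f)%:E)%E.
  apply: int_le_Lam => // c c0; have [r r0 rc] := root_exists n c0.
  have -> : [set t | c < f t] = `]x + r, +oo[%classic.
    by apply/seteqP; split=> t /=; rewrite in_itv/= andbT (trunc_pow_lt _ r0 rc).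
  exact: mu_ray_gt.
have If : intble mu f by apply: intble_finite => //; apply: le_lt_trans upp _; rewrite ltry.
have upp' : \int[mu]_t f t <= Lam f by rewrite -lee_fin -intE.
split=> //; rewrite -Lam_trunc_pow; apply: le_anti; rewrite upp'/=.
pose k := Lam (fun t => f t * f t).
have Ek : E (fun t => f t * f t).
  apply: (dominated_le (dominated_poly x (('X - x%:P) ^+ n.+1 * ('X - x%:P) ^+ n.+1))) => t xt.
  by rewrite ger0_norm ?mulr_ge0// hornerM -trunc_powE.
have k0 : 0 <= k by apply: Lam_ge0 => // t _; rewrite mulr_ge0.
apply/ler_addgt0Pr => e e0.
pose N := k / e + 1; have N0 : 0 < N by rewrite ltr_wpDl// divr_ge0// ltW.
have kN : k / N <= e.
  rewrite ler_pdivrMr// /N mulrDr mulr1 mulrCA divff ?mulr1 ?gt_eqF//.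
  by rewrite lerDl ltW.
pose h t := Num.min (f t) N.
have h0 t : 0 <= h t by rewrite le_min f0 ltW.
have hf t : h t <= f t by rewrite ge_min lexx.
have hN t : h t <= N by rewrite ge_min lexx orbT.
have mh : measurable_fun setT h by apply: measurable_minr.
have Eh : E h by apply: (dominated_le Ef) => t _; rewrite ger0_norm.
have EN : E (cst N) by exact: dominated_cst.
have Ih : intble mu h.
  apply: (intble_le mu_carried mh If) => t _; by rewrite ger0_norm.
have IN : intble mu (cst N) by apply: intble_const; exact: ltW.
have low : (\int[mu]_t (cst N t - h t)%:E <= (Lam (fun t => cst N t + (-1) * h t))%:E)%E.
  have -> : (fun t => cst N t + (-1) * h t) = (fun t => cst N t - h t).
    by apply/funext => t; rewrite mulN1r.
  apply: int_le_Lam.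
  - by apply: measurable_funB => //; exact: measurable_cst.
  - by move=> t; rewrite subr_ge0.
  - by apply: (dominated_le EN) => t _ /=; rewrite ger0_norm ?subr_ge0// gerBl.
  - move=> c c0; have [cN|cN] := leP N c.
      rewrite (_ : [set t | _] = set0) ?measure0 ?lee_fin.
        by apply: Lam_ge0 => //; exact: dominated_indic.
      by apply/seteqP; split=> t //=; have := h0 t; lra.
    have Nc : 0 < N - c by rewrite subr_gt0.
    have [r r0 rc] := root_exists n Nc.
    have -> : [set t | c < cst N t - h t] = `]-oo, x + r[%classic.
      apply/seteqP; split=> t /=; rewrite in_itv/= -(trunc_pow_gt _ r0 rc) -/f.
        by rewrite /h; case: (leP (f t) N) => ?; lra.
      by have := hf t; lra.
    exact: mu_ray_lt.
have low' : \int[mu]_t (cst N t - h t) <= N * m - Lam h.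
  rewrite -lee_fin -intE; last exact: intbleB.
  apply: le_trans low _; rewrite lee_fin LamD//; last exact: dominatedZ.
  by rewrite LamZ// Lam_cst mulN1r.
rewrite intB// in low'.
have iN : \int[mu]_t cst N t = N * m by rewrite /cst Rintegral_cst// -mu_setT.
have hh : \int[mu]_t h t <= \int[mu]_t f t by apply: int_le.
have Lh : Lam f - k / N <= Lam h.
  have -> : Lam f - k / N = Lam (fun t => f t + (- N^-1) * (f t * f t)).
    by rewrite LamD//; [rewrite LamZ// mulNr [_ * Lam _]mulrC|exact: dominatedZ].
  apply: Lam_le => //; first by apply: dominatedD => //; exact: dominatedZ.
  move=> t _; rewrite mulNr /h; case: (leP (f t) N) => [_|fN].
    by rewrite gerBl mulr_ge0 ?invr_ge0 ?(ltW N0)// mulr_ge0.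
  have -> : f t - N^-1 * (f t * f t) = N - N^-1 * (f t * f t - f t * N + N * N).
    by field; rewrite gt_eqF.
  rewrite gerBl mulr_ge0 ?invr_ge0 ?(ltW N0)//.
  by have := f0 t; nra.
rewrite iN in low'; lra.
Qed.

(** Every polynomial is a combination of powers of t - x; the induction carries a
    factor (t - x)^n along. *)
Lemma represents_poly p :
  intble mu (horner p) /\ \int[mu]_t p.[t] = L p.
Proof.
suff : forall n, intble mu (fun t => (('X - x%:P) ^+ n * p).[t]) /\
    \int[mu]_t (('X - x%:P) ^+ n * p).[t] = L (('X - x%:P) ^+ n * p).
  by move=> /(_ 0%N); rewrite expr0 mul1r.
have powers n : intble mu (fun t => (('X - x%:P) ^+ n).[t]) /\
    \int[mu]_t (('X - x%:P) ^+ n).[t] = L (('X - x%:P) ^+ n).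
  case: n => [|n].
    have I1 : intble mu (cst 1) by exact: intble_const.
    have e1 : (fun t : R => (('X - x%:P) ^+ 0).[t]) = cst 1.
      by apply/funext => t; rewrite expr0 hornerC.
    rewrite e1; split=> //.
    rewrite /cst Rintegral_cst// mul1r -/(mass mu setT) mu_setT -LamL.
    by congr Lam; exact/esym/e1.
  have [If fE] := int_trunc_pow n.
  have mp : measurable_fun setT (fun t => (('X - x%:P) ^+ n.+1).[t]) by exact: measurable_horner.
  have Ip : intble mu (fun t => (('X - x%:P) ^+ n.+1).[t]).
    apply: (intble_le mu_carried mp If) => t xt.
    by rewrite -trunc_powE// ger0_norm ?trunc_pow_ge0.
  split=> //; rewrite -fE; apply: le_anti.
  by rewrite !(le_int mu_carried)// => t /trunc_powE ->.
have [k] := ubnP (size p); elim: k p => // k IH p; rewrite ltnS => pk n.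
have [p1|p1] := leqP (size p) 1.
  have [I1 i1] := powers n; rewrite [p]size1_polyC//.
  have e : (fun t => (('X - x%:P) ^+ n * (p`_0)%:P).[t]) = (fun t => p`_0 * (('X - x%:P) ^+ n).[t]).
    by apply/funext => t; rewrite hornerM hornerC mulrC.
  rewrite e intZ// i1 -LZ mulrC mul_polyC; split=> //; exact: intbleZ.
have [q pq] := div_by_root p x.
have q0 : q != 0.
  apply/eqP => q0; move: p1; rewrite pq q0 mulr0 addr0 ltnNge.
  by rewrite size_polyC_leq1.
have qk : (size q < k)%N.
  apply: leq_trans pk.
  rewrite [in leqRHS]pq addrC size_polyDl mulrC size_Mmonic ?monicXsubC// size_XsubC addn2//=.
  by apply: leq_ltn_trans (size_polyC_leq1 _) _; rewrite ltnS size_poly_gt0.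
have [I1 i1] := IH q qk n.+1; have [I2 i2] := powers n.
have e : ('X - x%:P) ^+ n * p = p.[x] *: ('X - x%:P) ^+ n + ('X - x%:P) ^+ n.+1 * q.
  by rewrite [in LHS]pq mulrDr mulrA -exprSr [_ * _%:P]mulrC mul_polyC.
have e' : (fun t => (('X - x%:P) ^+ n * p).[t]) =
    (fun t => p.[x] * (('X - x%:P) ^+ n).[t] + (('X - x%:P) ^+ n.+1 * q).[t]).
  by apply/funext => t; rewrite e hornerD hornerZ.
rewrite e'; split; first by apply: intbleD => //; exact: intbleZ.
by rewrite intD//; [rewrite intZ// i1 i2 e LD LZ|exact: intbleZ].
Qed.

End representing.

(** Stieltjes' solution of the moment problem, on [x, +oo[ in place of [0, +oo[. *)
Theorem moment_representation : exists mu : {measure set R -> \bar R},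
  [/\ finite_moments mu, carried mu x & forall p, \int[mu]_t p.[t] = L p].
Proof.
have [Lam [LamD LamZ Lam0 LamL]] := positive_extension LD LZ L_nonneg.
have [mu muF] := measure_of_cumulative (F_nd Lam0) (F_rc Lam0).
have rep p : intble mu (horner p) /\ \int[mu]_t p.[t] = L p.
  exact: (represents_poly LamD LamZ Lam0 LamL muF).
exists mu; split.
- move=> n; have I2 : intble mu (fun t => 1 + t ^+ (n * 2)).
    have [I _] := rep (1%:P + 'X^(n * 2)); apply: eq_intble I => t.
    by rewrite hornerD hornerC hornerXn.
  have := integrableP _ _ _ I2 => -[_]; apply: le_lt_trans.
  apply: ge0_le_integral => //.
  + by apply/measurable_EFinP; apply: measurable_funX; exact: normr_measurable.
  + by apply: measurableT_comp => //; apply/measurable_EFinP; exact: intble_meas I2.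
  + move=> t _; rewrite lee_fin -normrX ger0_norm; last first.
      by rewrite addr_ge0// exprM sqr_ge0.
    rewrite exprM -(real_normK (num_real (t ^+ n))).
    by have := normr_ge0 (t ^+ n); have := sqr_ge0 (`|t ^+ n| - 1); nra.
- exact: (mu_carried LamD LamZ Lam0 muF).
- by move=> p; case: (rep p).
Qed.

End moment_representation.

(** * Real and complex density of polynomials *)
Section complex_density.
Context {R : realType}.
Implicit Types (nu : {measure set R -> \bar R}) (f g : R -> R[i]) (p q : {poly R}).

Definition poly_dense nu := forall f : R -> R, L2 nu f -> papprox nu f.

Definition sqmod (z : R[i]) : R := complex.Re z ^+ 2 + complex.Im z ^+ 2.

Lemma sqmod_ge0 z : 0 <= sqmod z.
Proof. by rewrite addr_ge0// sqr_ge0. Qed.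

Lemma normc_sqr (z : R[i]) : Normc.normc z ^+ 2 = sqmod z.
Proof. by case: z => a b /=; rewrite sqr_sqrtr// addr_ge0// sqr_ge0. Qed.

Lemma normc_ge0 (z : R[i]) : 0 <= Normc.normc z.
Proof. by case: z => a b /=; exact: sqrtr_ge0. Qed.

Lemma cL2norm_poweR nu f :
  (cL2norm nu f `^ 2 = \int[nu]_t (sqmod (f t))%:E)%E.
Proof.
rewrite /cL2norm poweR_Lnorm//; apply: eq_integral => t _ /=.
rewrite ger0_norm ?normc_ge0// -normc_sqr.
by congr EFin; exact: (powR_mulrn 2 (normc_ge0 _)).
Qed.

Lemma cL2norm_lt nu f e : 0 < e ->
  (cL2norm nu f < e%:E)%E <-> (\int[nu]_t (sqmod (f t))%:E < (e ^+ 2)%:E)%E.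
Proof.
move=> e0; rewrite -cL2norm_poweR.
have : (0 <= cL2norm nu f)%E by exact: Lnorm_ge0.
case: (cL2norm nu f) => [r r0| |]//=; last first.
  by rewrite pnatr_eq0 /=; split; rewrite ltNge leey.
have re : r `^ 2 = r ^+ 2 by exact: (powR_mulrn 2).
by rewrite re !lte_fin ltr_pXn2r ?nnegrE// ltW.
Qed.

Lemma cL2norm_lty nu f :
  (cL2norm nu f < +oo)%E <-> (\int[nu]_t (sqmod (f t))%:E < +oo)%E.
Proof.
rewrite -cL2norm_poweR; split; first exact: poweR_lty.
by apply: lty_poweRy.
Qed.

(** A real-linear map applied to the values of a complex polynomial at real points
    acts on its coefficients. *)
Lemma additive_horner (h : R[i] -> R) (p : {poly R[i]}) (t : R) : h 0 = 0 ->
  (forall z c, h (z * (t%:C)%C + c) = h z * t + h c) ->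
  h p.[(t%:C)%C] = (map_poly h p).[t].
Proof.
move=> h0 hl.
elim/poly_ind: p => [|p c IH]; first by rewrite map_poly0 !horner0.
have -> : map_poly h (p * 'X + c%:P) = map_poly h p * 'X + (h c)%:P.
  apply/polyP => i; rewrite coefD coefMX coefC coef_map_id0//.
  rewrite coefD coefMX coefC; case: i => [|i] /=; first by rewrite !add0r.
  by rewrite coef_map_id0// [RHS]addr0 addr0.
by rewrite !hornerMXaddC -IH hl.
Qed.

Lemma Re_horner (p : {poly R[i]}) (t : R) :
  complex.Re p.[(t%:C)%C] = (map_poly (@complex.Re R) p).[t].
Proof.
by apply: additive_horner => // -[a b] [c d] /=; rewrite mulr0 subr0.
Qed.

Lemma Im_horner (p : {poly R[i]}) (t : R) :
  complex.Im p.[(t%:C)%C] = (map_poly (@complex.Im R) p).[t].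
Proof.
by apply: additive_horner => // -[a b] [c d] /=; rewrite mulr0 add0r.
Qed.

Lemma real_complex_horner p (t : R) :
  (map_poly (real_complex R) p).[(t%:C)%C] = (p.[t]%:C)%C.
Proof. exact: horner_map. Qed.

Lemma intble_sqmod nu f : in_cL2 nu f ->
  L2 nu (fun t => complex.Re (f t)) /\ L2 nu (fun t => complex.Im (f t)).
Proof.
move=> [mr mi /cL2norm_lty fin].
have ms : measurable_fun setT (fun t => sqmod (f t)).
  by apply: measurable_funD; exact: measurable_funX.
have Is : intble nu (fun t => sqmod (f t)).
  apply/integrableP; split; first exact/measurable_EFinP.
  by under eq_integral do rewrite /= ger0_norm ?sqmod_ge0//.
split; (split=> //; apply: le_integrable Is => //).
- by apply/measurable_EFinP; exact: measurable_funX.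
- move=> t _ /=; rewrite lee_fin !ger0_norm ?sqmod_ge0 ?sqr_ge0//.
  by rewrite /sqmod lerDl sqr_ge0.
- by apply/measurable_EFinP; exact: measurable_funX.
- move=> t _ /=; rewrite lee_fin !ger0_norm ?sqmod_ge0 ?sqr_ge0//.
  by rewrite /sqmod lerDr sqr_ge0.
Qed.

Lemma cpoly_denseP nu : finite_moments nu -> cpoly_dense nu <-> poly_dense nu.
Proof.
move=> fm; split=> [cd f Lf|d f f2 e e0].
- split=> // e e0; have [mf If] := Lf.
  pose s := Num.sqrt e; have s0 : 0 < s by rewrite sqrtr_gt0.
  have [|p Hp] := cd (fun t => (f t)%:C%C) _ s s0.
    split=> //=.
    apply/cL2norm_lty; rewrite /sqmod /=.
    under eq_integral do rewrite expr0n/= addr0.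
    exact: integrable_lty If.
  exists (map_poly (@complex.Re R) p).
  move/(cL2norm_lt _ _ s0) : Hp; rewrite sqr_sqrtr ?(ltW e0)// => Hp.
  rewrite -lte_fin; apply: le_lt_trans Hp.
  have Lg : L2 nu (fun t => f t - (map_poly (@complex.Re R) p).[t]).
    by apply: L2B => //; exact: L2_poly.
  rewrite /sqnorm -intE; last by case: Lg.
  apply: ge0_le_integral => //.
  + by move=> t _; rewrite lee_fin sqr_ge0.
  + by apply/measurable_EFinP; apply: measurable_funX; case: Lg.
  + apply/measurable_EFinP; apply: measurable_funD; apply: measurable_funX.
      rewrite (_ : (fun t => _) = fun t => f t - (map_poly (@complex.Re R) p).[t]); first by case: Lg.
      by apply/funext => t; rewrite -Re_horner raddfB.
    rewrite (_ : (fun t => _) = fun t => - (map_poly (@complex.Im R) p).[t]).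
      apply: measurableT_comp => //; exact: measurable_horner.
    by apply/funext => t; rewrite -Im_horner raddfB /= sub0r.
  + move=> t _; rewrite lee_fin /sqmod raddfB /= -Re_horner lerDl sqr_ge0//.
- have [Lr Li] := intble_sqmod f2.
  have e2 : 0 < e ^+ 2 / 2 by rewrite divr_gt0// exprn_gt0.
  have [_ /(_ _ e2) [p Hp]] := d _ Lr; have [_ /(_ _ e2) [q Hq]] := d _ Li.
  exists (map_poly (real_complex R) p + 'i%C%:P * map_poly (real_complex R) q).
  apply/(cL2norm_lt _ _ e0).
  have E t : sqmod (f t - (map_poly (real_complex R) p + 'i%C%:P * map_poly (real_complex R) q).[(t%:C)%C]) =
     (complex.Re (f t) - p.[t]) ^+ 2 + (complex.Im (f t) - q.[t]) ^+ 2.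
    rewrite hornerD hornerM hornerC !real_complex_horner; case: (f t) => a b.
    rewrite /sqmod /=; ring.
  under eq_integral do rewrite E.
  have Lp := L2B Lr (L2_poly p fm); have Lq := L2B Li (L2_poly q fm).
  have Ipq : intble nu (fun t => (complex.Re (f t) - p.[t]) ^+ 2 + (complex.Im (f t) - q.[t]) ^+ 2).
    by apply: intbleD; [case: Lp|case: Lq].
  rewrite (intE Ipq) lte_fin intD; [|by case: Lp|by case: Lq].
  by move: Hp Hq; rewrite /sqnorm; lra.
Qed.
End complex_density.

(** * Supports *)
Section supports.
Context {R : realType}.
Implicit Types (nu : {measure set R -> \bar R}) (x t : R).

(** Outside the support, null intervals with rational endpoints form a countable
    cover. *)
Lemma supp_null nu (U : set R) : open U -> (forall t, U t -> ~ supp nu t) ->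
  nu U = 0%E.
Proof.
move=> oU ns.
pose I (ab : rat * rat) : set R := `]ratr ab.1, ratr ab.2[%classic.
pose A n : set R := if unpickle n is Some ab then
  (if `[< nu (I ab) = 0%E >] then I ab else set0) else set0.
have mA n : measurable (A n).
  rewrite /A; case: unpickle => // ab; case: ifP => // _; exact: measurable_itv.
have A0 n : nu (A n) = 0%E.
  by rewrite /A; case: unpickle => [ab|]; rewrite ?measure0//; case: asboolP; rewrite ?measure0.
have cover : U `<=` \bigcup_n A n.
  move=> t Ut.
  have [V [oV [Vt V0]]] : exists V, open V /\ V t /\ nu V = 0%E.
    apply: contrapT => nV; apply: (ns _ Ut) => V oV Vt.
    rewrite lt0e measure_ge0 andbT; apply/eqP => V0; apply: nV; by exists V.
  have := open_nbhs_nbhs (conj oV Vt) => /nbhs_ballP[d /= d0 dV].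
  have [a /andP[a1 a2]] : exists a : rat, t - d < ratr a < t.
    by have [q] := @rat_in_itvoo R (t - d) t (ltac:(lra)); rewrite in_itv/=; exists q.
  have [b /andP[b1 b2]] : exists b : rat, t < ratr b < t + d.
    by have [q] := @rat_in_itvoo R t (t + d) (ltac:(lra)); rewrite in_itv/=; exists q.
  have [n nE] : exists n, unpickle n = Some (a, b) by exists (pickle (a, b)); exact: pickleK.
  exists n; first exact: Logic.I.
  rewrite /A nE.
  have I0 : nu (I (a, b)) = 0%E.
    apply/eqP; rewrite -measure_le0 -V0; apply: le_measure; rewrite ?inE.
    - exact: measurable_itv.
    - exact: open_measurable.
    - move=> s; rewrite /I/= in_itv/= => /andP[s1 s2]; apply: dV.
      by rewrite /ball/= ltr_norml; apply/andP; lra.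
  by rewrite asboolT// /I/= in_itv/= a2 b1.
apply/eqP; rewrite -measure_le0.
have -> : 0%E = nu (\bigcup_n A n).
  apply/esym/negligibleP; first exact: bigcupT_measurable.
  apply: negligible_bigcup => n; apply/negligibleP; first exact: mA.
  exact: A0.
apply: le_measure; rewrite ?inE//; [exact: open_measurable|exact: bigcupT_measurable].
Qed.

Lemma carried_supp nu x : carried nu x <-> supp nu `<=` [set t | x <= t].
Proof.
have ol : open [set t : R | t < x].
  exact: open_lt.
split=> [c t st|s].
  rewrite /= leNgt; apply/negP => tx.
  by have := st _ ol tx; rewrite c ltxx.
by apply: supp_null => // t /= tx /s /=; rewrite leNgt tx.
Qed.

Lemma carried_le nu x y : carried nu x -> y <= x -> carried nu y.
Proof.
move=> /carried_supp c yx; apply/carried_supp => t /c /=; exact: le_trans.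
Qed.

Lemma supp_point nu x : (0 < nu [set x])%E -> supp nu x.
Proof.
move=> n0 U oU Ux; apply: lt_le_trans n0 _.
apply: le_measure; rewrite ?inE; [exact: measurable_set1|exact: open_measurable|].
by move=> _ ->.
Qed.

Lemma supp_eq nu rho : measure_eq nu rho -> supp nu = supp rho.
Proof.
by move=> e; apply/seteqP; split=> t st U oU Ut; have := st _ oU Ut;
  rewrite (e U)//; exact: open_measurable.
Qed.

(** The support is closed, hence contains its infimum. *)
Lemma inf_suppP nu x : supp nu !=set0 -> carried nu x ->
  let b := inf (supp nu) in [/\ supp nu b, carried nu b & x <= b].
Proof.
move=> s0 cx b.
have hb : has_inf (supp nu) by split=> //; exists x; apply/carried_supp.
have ble t : supp nu t -> b <= t by move=> st; apply: ge_inf => //; case: hb.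
split.
- move=> U oU Ub; have := open_nbhs_nbhs (conj oU Ub) => /nbhs_ballP[d /= d0 dU].
  have [t st tb] := inf_adherent d0 hb.
  have bt := ble t st.
  apply: st => //; apply: dU; rewrite /ball/= ltr_norml.
  by apply/andP; split; lra.
- by apply/carried_supp => t; exact: ble.
- by apply: lb_le_inf => //; apply/carried_supp.
Qed.

Lemma inf_supp_eq nu x : supp nu x -> carried nu x -> inf (supp nu) = x.
Proof.
move=> sx cx; have [] := inf_suppP (ex_intro _ x sx) cx => _ _ xb.
apply: le_anti; rewrite xb andbT; apply: ge_inf => //.
by exists x; apply/carried_supp.
Qed.

Lemma measure_eq_sym nu rho : measure_eq nu rho -> measure_eq rho nu.
Proof. by move=> e A mA; rewrite e. Qed.

Lemma measure_eq_trans nu rho kap : measure_eq nu rho -> measure_eq rho kap ->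
  measure_eq nu kap.
Proof. by move=> e e' A mA; rewrite e// e'. Qed.

End supports.

(** * Representing measures and their extremal masses *)
Section moments.
Context {R : realType}.
Implicit Types (mu nu rho : {measure set R -> \bar R}) (x : R) (p q : {poly R})
  (gamma : nat -> R).

Lemma H_representingP gamma nu : H_representing gamma nu <->
  finite_moments nu /\ forall n, \int[nu]_t t ^+ n = gamma n.
Proof.
split=> -[fm h]; split=> // n.
- by have := h n; rewrite (intE (intble_pow n fm)) => -[].
- by rewrite (intE (intble_pow n fm)) h.
Qed.

Lemma int_sum_moments gamma nu n (c : nat -> R) : H_representing gamma nu ->
  intble nu (fun t => \sum_(i < n) c i * t ^+ i) /\
  \int[nu]_t (\sum_(i < n) c i * t ^+ i) = \sum_(i < n) c i * gamma i.
Proof.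
move=> /H_representingP[fm h]; elim: n => [|n [IH1 IH2]].
  rewrite big_ord0; under [X in Rintegral _ _ X]eq_fun do rewrite big_ord0.
  split; last by rewrite int_cst// mul0r.
  by apply: (eq_intble _ (intble_cst 0 fm)) => t; rewrite big_ord0.
have In : intble nu (fun t => c n * t ^+ n) by apply: intbleZ; exact: intble_pow.
split; first by apply: (eq_intble _ (intbleD IH1 In)) => t; rewrite big_ord_recr.
under [X in Rintegral _ _ X]eq_fun do rewrite big_ord_recr.
by rewrite big_ord_recr /= intD// IH2 intZ ?h//; exact: intble_pow.
Qed.

Lemma int_moments gamma nu p : H_representing gamma nu ->
  \int[nu]_t p.[t] = \sum_(i < size p) p`_i * gamma i.
Proof.
move=> /(int_sum_moments (size p) (fun i => p`_i))[_ <-].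
by congr Rintegral; apply/funext => t; rewrite horner_coef.
Qed.

Lemma H_representing_same gamma nu rho :
  H_representing gamma nu -> H_representing gamma rho -> same_moments nu rho.
Proof. by move=> hn hr p; rewrite (int_moments p hn) (int_moments p hr). Qed.

Lemma same_H_representing gamma nu rho : H_representing gamma nu ->
  finite_moments rho -> same_moments nu rho -> H_representing gamma rho.
Proof.
move=> /H_representingP[fn hn] fr mm; apply/H_representingP; split=> // n.
rewrite -hn; have := mm 'X^n => h.
transitivity (\int[nu]_t ('X^n).[t]); [rewrite h|];
  by congr Rintegral; apply/funext => t; rewrite hornerXn.
Qed.

Lemma locally_bounded_same nu rho : same_moments nu rho -> locally_bounded nu ->
  locally_bounded rho.
Proof.
move=> mm lb M; have [C C0 HC] := lb M; exists C => // p t.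
by rewrite -(same_moments_psqnorm p mm); exact: HC.
Qed.

Lemma locally_bounded_two nu rho x :
  finite_moments nu -> finite_moments rho -> carried nu x -> carried rho x ->
  same_moments nu rho -> ~ measure_eq nu rho -> locally_bounded nu.
Proof.
move=> fn fr cn cr mm ne; have [C _ HC] := eval_bounded_left fn fr cn cr mm ne.
exact: (locally_bounded_of_eval fn cn HC).
Qed.

(** A measure with empty support is zero, and zero is determined by its total
    mass. *)
Lemma H_indet_supp gamma nu : H_indeterminate gamma -> H_representing gamma nu ->
  supp nu !=set0.
Proof.
move=> [_ nd] hn; apply/set0P/eqP => s0; apply: nd; exists nu; split=> // mu hm A mA.
have fin rho : H_representing gamma rho -> rho setT = (gamma 0%N)%:E.
  move=> [_ /(_ 0%N)] <-; under eq_integral do rewrite expr0.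
  by rewrite integral_cst// mul1e.
have n0 : nu setT = 0%E.
  by apply: supp_null => [|t _]; [exact: openT|rewrite s0].
have z rho : rho setT = 0%E -> rho A = 0%E.
  move=> r0; apply/eqP; rewrite -measure_le0 -r0.
  by apply: le_measure; rewrite ?inE.
by rewrite !z// (fin _ hm) -(fin _ hn).
Qed.

Lemma H_indet_two gamma nu rho : H_representing gamma nu -> H_representing gamma rho ->
  ~ measure_eq nu rho -> H_indeterminate gamma.
Proof.
move=> hn hr ne; split; first by exists nu.
move=> [mu [_ all]]; apply: ne; apply: measure_eq_trans (all _ hn) _.
exact: measure_eq_sym (all _ hr).
Qed.

Section point_mass.
Variables (m : {nonneg R}) (x : R).
Let P : {measure set R -> \bar R} := mscale m \d_x.

Lemma int_point_ge0 (f : R -> \bar R) : measurable_fun setT f ->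
  (forall t, (0 <= f t)%E) -> (\int[P]_t f t = m%:num%:E * f x)%E.
Proof.
move=> mf f0; rewrite ge0_integral_mscale// integral_dirac//.
by rewrite diracE in_setT mul1e.
Qed.

Lemma finite_moments_point : finite_moments P.
Proof.
move=> n; rewrite int_point_ge0; first by rewrite -EFinM ltry.
  by apply/measurable_EFinP; apply: measurable_funX; exact: normr_measurable.
by move=> t; rewrite lee_fin exprn_ge0.
Qed.

Lemma int_point p : \int[P]_t p.[t] = m%:num * p.[x].
Proof.
have I2 := L2_poly (p + 1%:P) finite_moments_point.
have I1 := L2_poly p finite_moments_point.
have h q : \int[P]_t q.[t] ^+ 2 = m%:num * q.[x] ^+ 2.
  rewrite /Rintegral int_point_ge0//.
    by apply/measurable_EFinP; apply: measurable_funX; exact: measurable_horner.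
  by move=> t; rewrite lee_fin sqr_ge0.
have Ip := intble_poly p finite_moments_point.
have I0 := intble_cst 1 finite_moments_point.
have := h (p + 1%:P); have := h p; have := h 1%:P.
rewrite !hornerD !hornerC expr1n mulr1.
rewrite (_ : \int[P]_t (p + 1%:P).[t] ^+ 2 = \int[P]_t (p.[t] ^+ 2 + (2 * p.[t] + 1))).
  rewrite intD; [|by case: I1|by apply: intbleD => //; exact: intbleZ].
  rewrite intD//; [|exact: intbleZ]; rewrite intZ//.
  rewrite (_ : \int[P]_t (1%:P : {poly R}).[t] ^+ 2 = \int[P]_t cst 1 t).
    by move=> -> -> h3; lra.
  by congr Rintegral; apply/funext => t; rewrite hornerC expr1n.
by congr Rintegral; apply/funext => t; rewrite hornerD hornerC; ring.
Qed.

Lemma carried_point : carried P x.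
Proof.
rewrite /carried (_ : P _ = (m%:num%:E * \d_x [set t : R | (t < x)%R])%E)//.
by rewrite diracE memNset ?mule0//= ltxx.
Qed.

Lemma mass_point : mass P [set x] = m%:num.
Proof. by rewrite /mass /P /mscale/= /dirac indicE mem_set//= mulr1. Qed.

End point_mass.

(** With m = inf { int p^2 : p(x) = 1 }, positive by local boundedness, the
    functional int p - m p(x) is nonnegative on squares by the definition of m, and
    on (t - x) q^2 since the point mass does not see these. *)
Lemma exists_extremal nu x : finite_moments nu -> locally_bounded nu ->
  (forall q, 0 <= \int[nu]_t (('X - x%:P) * q ^+ 2).[t]) ->
  exists rho : {measure set R -> \bar R}, [/\ finite_moments rho,
    carried rho x, same_moments nu rho, extremal_mass rho x & 0 < mass rho [set x]].
Proof.
move=> fm lb form.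
pose S := [set psqnorm nu p | p in [set p | p.[x] = 1]].
have [C C0 HC] := lb `|x|.
have Slb p : p.[x] = 1 -> C^-1 <= psqnorm nu p.
  move=> px; have [] := HC p x (lexx _); rewrite px expr1n => h _.
  by rewrite -div1r ler_pdivrMr// mulrC.
have hS : has_inf S.
  by split; [exists (psqnorm nu 1), 1 => //=; rewrite hornerC|exists C^-1 => _ [p px <-]; exact: Slb].
pose m := inf S.
have m0 : 0 < m.
  apply: (@lt_le_trans _ _ C^-1); first by rewrite invr_gt0.
  by apply: lb_le_inf; [case: hS|move=> _ [p px <-]; exact: Slb].
have mS p : p.[x] = 1 -> m <= psqnorm nu p.
  by move=> px; apply: ge_inf; [case: hS|exists p].
pose L p := \int[nu]_t p.[t] - m * p.[x].
have IP p := intble_poly p fm.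
have LD p q : L (p + q) = L p + L q.
  rewrite /L hornerD (_ : (fun t => (p + q).[t]) = fun t => p.[t] + q.[t]).
    by rewrite intD//; ring.
  by apply/funext => t; rewrite hornerD.
have LZ c p : L (c *: p) = c * L p.
  rewrite /L hornerZ (_ : (fun t => (c *: p).[t]) = fun t => c * p.[t]).
    by rewrite intZ//; ring.
  by apply/funext => t; rewrite hornerZ.
have L1 q : 0 <= L (q ^+ 2).
  have -> : L (q ^+ 2) = psqnorm nu q - m * q.[x] ^+ 2.
    rewrite /L horner_exp; congr (_ - _).
    by congr Rintegral; apply/funext => t; rewrite horner_exp.
  have [qx|qx] := eqVneq q.[x] 0; first by rewrite qx expr0n mulr0 subr0 psqnorm_ge0.
  have := mS (q.[x]^-1 *: q); rewrite hornerZ mulVf// => /(_ erefl).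
  by rewrite psqnormZ// exprVn mulrC ler_pdivlMr ?exprn_even_gt0// subr_ge0.
have L2 q : 0 <= L (('X - x%:P) * q ^+ 2).
  by rewrite /L hornerM hornerXsubC subrr mul0r mulr0 subr0.
have [mu [fmu cmu mumom]] := moment_representation LD LZ L1 L2.
pose P : {measure set R -> \bar R} := mscale (NngNum (ltW m0)) \d_x.
pose rho : {measure set R -> \bar R} := measure_add mu P.
have fP : finite_moments P by exact: finite_moments_point.
have frho : finite_moments rho by exact: finite_moments_add.
have same : same_moments nu rho.
  move=> p; rewrite (int_add (intble_poly p fmu) (intble_poly p fP)).2 mumom int_point /L /=.
  ring.
have mx : measurable [set x] by exact: measurable_set1.
have massx : m <= mass rho [set x].
  by rewrite mass_add// mass_point lerDr mass_ge0.
exists rho; split=> //.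
- by apply: carried_add => //; exact: carried_point.
- move=> k k0; have [_ [p px <-] pm] := inf_adherent k0 hS.
  exists p => //; rewrite -(same_moments_psqnorm p same).
  by apply: le_trans (ltW pm) _; rewrite lerD2r.
- exact: lt_le_trans massx.
Qed.

Lemma form_ge0 nu x q : finite_moments nu -> carried nu x ->
  0 <= \int[nu]_t (('X - x%:P) * q ^+ 2).[t].
Proof.
move=> fm cx; have <- : \int[nu]_t (0 : R) = 0 by rewrite int_cst// mul0r.
apply: (le_int cx); [exact: (intble_cst 0)|exact: intble_poly|].
by move=> t xt; rewrite hornerM hornerXsubC horner_exp mulr_ge0 ?sqr_ge0// subr_ge0.
Qed.

(** The hypothesis on the forms bears on moments only, so it holds for nu + rho,
    which thus has extremal mass at b. *)
Lemma unique_of_small_form nu rho b :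
  finite_moments nu -> finite_moments rho -> carried nu b -> carried rho b ->
  same_moments nu rho -> locally_bounded nu ->
  (forall e, 0 < e -> exists q, \int[nu]_t (('X - (b + e)%:P) * q ^+ 2).[t] < 0) ->
  measure_eq nu rho.
Proof.
move=> fn fr cn cr mm lb small.
apply: (measure_eq_of_extremal_mass fn fr cn cr mm lb).
apply: extremal_mass_of_small_form.
- exact: finite_moments_add.
- exact: carried_add.
- exact: locally_bounded_add.
- move=> e e0; have [q Hq] := small _ e0; exists q.
  rewrite (int_add (intble_poly _ fn) (intble_poly _ fr)).2 -(mm (('X - _) * _)).
  lra.
Qed.

Lemma unique_of_support_point nu rho x :
  finite_moments nu -> finite_moments rho -> carried nu x -> carried rho x ->
  same_moments nu rho -> locally_bounded nu ->
  extremal_mass nu x -> extremal_mass rho x -> measure_eq nu rho.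
Proof.
move=> fn fr cn cr mm lb en er.
apply: (measure_eq_of_extremal_mass fn fr cn cr mm lb).
exact: extremal_mass_add.
Qed.

End moments.

(** * Images of measures under affine maps *)
Section push.
Context {R : realType}.
Implicit Types (mu nu rho : {measure set R -> \bar R}) (x t theta a : R) (p q : {poly R})
  (gamma : nat -> R).

Definition affine theta a : {poly R} := theta *: ('X + a%:P).

Lemma horner_affine theta a t : (affine theta a).[t] = psi theta a t.
Proof. by rewrite hornerZ hornerD hornerX hornerC. Qed.

Lemma psiK theta a : theta != 0 ->
  cancel (psi theta a) (psi theta^-1 (- (theta * a))).
Proof. by move=> t0 t; rewrite /psi -mulrBr addrK mulKf. Qed.

Lemma psiVK theta a : theta != 0 ->
  cancel (psi theta^-1 (- (theta * a))) (psi theta a).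
Proof. by move=> t0 t; rewrite /psi mulrBr mulKf// subrK mulVKf. Qed.

Lemma preimage_psi_measurable theta a (A : set R) : measurable A ->
  measurable (psi theta a @^-1` A).
Proof. by move=> mA; rewrite -[X in measurable X]setTI; exact: measurable_psi. Qed.

Lemma preimage_psi_open theta a (A : set R) : open A ->
  open (psi theta a @^-1` A).
Proof.
move=> oA; apply: open_comp => // t _.
have -> : psi theta a = horner (affine theta a) by apply/funext => s; rewrite horner_affine.
exact: continuous_horner.
Qed.

Lemma int_push theta a nu (f : R -> R) : measurable_fun setT f ->
  intble nu (f \o psi theta a) ->
  \int[push_psi theta a nu]_s f s = \int[nu]_t f (psi theta a t).
Proof.
move=> mf If; rewrite /Rintegral integral_pushforward//.
- exact: measurable_psi.
- exact/measurable_EFinP.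
Qed.

Lemma finite_moments_push theta a nu : finite_moments nu ->
  finite_moments (push_psi theta a nu).
Proof.
move=> fm n; rewrite ge0_integral_pushforward//.
- have /integrableP[_] : intble nu (fun t => (affine theta a ^+ n).[t]) by exact: intble_poly.
  congr (_ < _)%E; apply: eq_integral => t _.
  by rewrite /= horner_exp horner_affine normrX.
- exact: measurable_psi.
- by apply/measurable_EFinP; apply: measurable_funX; exact: normr_measurable.
Qed.

Lemma int_poly_push theta a nu p : finite_moments nu ->
  \int[push_psi theta a nu]_s p.[s] = \int[nu]_t (p \Po affine theta a).[t].
Proof.
move=> fm; rewrite int_push; first last.
- apply: eq_intble (intble_poly (p \Po affine theta a) fm) => t.
  by rewrite horner_comp horner_affine.
- exact: measurable_horner.
by congr Rintegral; apply/funext => t; rewrite horner_comp horner_affine.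
Qed.

Lemma comp_affine theta a p : theta != 0 ->
  (p \Po affine theta^-1 (- (theta * a))) \Po affine theta a = p.
Proof.
move=> t0; rewrite -comp_polyA /affine comp_polyZ comp_polyD comp_polyX comp_polyC.
rewrite (_ : theta^-1 *: _ = 'X) ?comp_polyXr//.
by rewrite polyCN polyCM -[theta *: _]mul_polyC mulrDr addrK -mul_polyC mulrA -polyCM mulVf// mul1r.
Qed.

Lemma H_representing_push theta a gamma nu : H_representing gamma nu ->
  H_representing (transform theta a gamma) (push_psi theta a nu).
Proof.
move=> hn; have [fm _] := hn; apply/H_representingP; split.
  exact: finite_moments_push.
move=> n; have -> : \int[push_psi theta a nu]_t t ^+ n =
    \int[push_psi theta a nu]_t ('X^n).[t].
  by congr Rintegral; apply/funext => t; rewrite hornerXn.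
rewrite int_poly_push//.
have [_ h] := int_sum_moments n.+1
  (fun j => 'C(n, j)%:R * a ^+ (n - j) * theta ^+ n) hn.
rewrite /transform -h; congr Rintegral; apply/funext => t.
rewrite horner_comp hornerXn horner_affine /psi exprMn addrC exprDn mulr_sumr.
by apply: eq_bigr => i _; rewrite -mulr_natl; ring.
Qed.

(** Image under the inverse of psi theta a, again of the form psi. *)
Definition pull theta a nu : {measure set R -> \bar R} :=
  push_psi theta^-1 (- (theta * a)) nu.

Lemma push_pull theta a nu : theta != 0 ->
  measure_eq (push_psi theta a (pull theta a nu)) nu.
Proof.
move=> t0 A mA; rewrite /pull /push_psi /pushforward /=; congr (nu _).
by apply/seteqP; split=> t /=; rewrite psiVK.
Qed.

Lemma H_representing_pull theta a gamma nu rho : theta != 0 ->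
  H_representing gamma nu -> H_representing (transform theta a gamma) rho ->
  H_representing gamma (pull theta a rho).
Proof.
move=> t0 hn hr; have [fn _] := hn; have [fr _] := hr.
apply: (same_H_representing hn); first exact: finite_moments_push.
move=> p; rewrite /pull int_poly_push//.
rewrite -(H_representing_same (H_representing_push theta a hn) hr).
by rewrite int_poly_push// comp_affine.
Qed.

Lemma carried_push theta a nu x : 0 < theta -> carried nu x ->
  carried (push_psi theta a nu) (psi theta a x).
Proof.
move=> t0; rewrite /carried => <-; rewrite /push_psi /pushforward; congr (nu _).
by apply/seteqP; split=> t /=; rewrite /psi ltr_pM2l// ltrD2r.
Qed.

Lemma carried_pull theta a nu x : 0 < theta -> carried nu (psi theta a x) ->
  carried (pull theta a nu) x.
Proof.
move=> t0 c; rewrite -(psiK a (lt0r_neq0 t0) x).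
by apply: carried_push => //; rewrite invr_gt0.
Qed.

Lemma supp_push theta a nu x : supp nu x ->
  supp (push_psi theta a nu) (psi theta a x).
Proof. by move=> sx U oU Ux; apply: sx => //; exact: preimage_psi_open. Qed.

(** Composition with an affine map preserves polynomials in both directions. *)
Lemma poly_dense_push theta a nu : theta != 0 -> finite_moments nu -> poly_dense nu ->
  poly_dense (push_psi theta a nu).
Proof.
move=> t0 fm d f Lf; split=> // e e0; have [mf If] := Lf.
have mp : measurable_fun setT (psi theta a) := measurable_psi theta a.
have ge (f' : R -> R) : measurable_fun setT f' -> (\int[push_psi theta a nu]_s (f' s ^+ 2)%:E =
    \int[nu]_t (f' (psi theta a t) ^+ 2)%:E)%E.
  move=> mf'; rewrite ge0_integral_pushforward//.
    by apply/measurable_EFinP; exact: measurable_funX.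
  by move=> t _; rewrite lee_fin sqr_ge0.
have Lg : L2 nu (f \o psi theta a).
  have mg : measurable_fun setT (f \o psi theta a) by exact: measurableT_comp.
  split=> //; apply/integrableP; split.
    by apply/measurable_EFinP; exact: measurable_funX.
  have /integrableP[_] := If.
  under eq_integral do rewrite /= ger0_norm ?sqr_ge0//.
  rewrite ge//; under [in X in _ -> X]eq_integral do rewrite /= ger0_norm ?sqr_ge0//.
  by [].
have [_ /(_ _ e0)[p Hp]] := d _ Lg.
exists (p \Po affine theta^-1 (- (theta * a))); apply: le_lt_trans Hp.
rewrite le_eqVlt; apply/orP; left; apply/eqP; rewrite /sqnorm /Rintegral ge.
  congr fine; apply: eq_integral => t _ /=.
  by rewrite horner_comp horner_affine psiK.
by apply: measurable_funB => //; exact: measurable_horner.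
Qed.

End push.

(** * Half-lines carrying representing measures *)
Section N_extremal_measures.
Context {R : realType}.
Implicit Types (mu nu rho kappa : {measure set R -> \bar R}) (x t theta a : R)
  (p q : {poly R}) (gamma : nat -> R).

Lemma N_extremal_plusP gamma nu : N_extremal_plus gamma nu <->
  [/\ H_indeterminate gamma, H_representing gamma nu, poly_dense nu & carried nu 0].
Proof.
split=> [[[hi hr /cpoly_denseP d] /carried_supp c]|[hi hr d /carried_supp c]].
  by split=> //; apply: d; case: hr.
by split=> //; split=> //; apply/cpoly_denseP => //; case: hr.
Qed.

Lemma S_representingP gamma nu : S_representing gamma nu <->
  H_representing gamma nu /\ carried nu 0.
Proof. by split=> -[h /carried_supp c]. Qed.

Lemma N_extremal_plus_push theta a gamma nu :
  theta != 0 -> H_indeterminate (transform theta a gamma) ->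
  H_representing gamma nu -> poly_dense nu -> carried (push_psi theta a nu) 0 ->
  N_extremal_plus (transform theta a gamma) (push_psi theta a nu).
Proof.
move=> t0 hi hr d c; apply/N_extremal_plusP; split=> //.
  exact: H_representing_push.
by apply: poly_dense_push => //; case: hr.
Qed.

Lemma measure_eq_push theta a nu rho : measure_eq nu rho ->
  measure_eq (push_psi theta a nu) (push_psi theta a rho).
Proof. by move=> e A mA; apply: e; exact: preimage_psi_measurable. Qed.

Lemma push_eq_pull theta a nu rho : theta != 0 -> measure_eq (pull theta a rho) nu ->
  measure_eq rho (push_psi theta a nu).
Proof.
move=> t0 e; apply: measure_eq_trans (measure_eq_push theta a e).
exact/measure_eq_sym/push_pull.
Qed.

Lemma pull_push theta a nu : theta != 0 ->
  measure_eq (pull theta a (push_psi theta a nu)) nu.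
Proof.
move=> t0 A mA; rewrite /pull /push_psi /pushforward /=; congr (nu _).
by apply/seteqP; split=> t /=; rewrite psiK.
Qed.

Lemma push_inj theta a nu rho : theta != 0 ->
  measure_eq (push_psi theta a nu) (push_psi theta a rho) -> measure_eq nu rho.
Proof.
move=> t0 e; apply: measure_eq_trans (measure_eq_sym (pull_push a nu t0)) _.
by apply: measure_eq_trans (pull_push a rho t0); exact: measure_eq_push.
Qed.

Lemma inf_supp_push theta a nu x : 0 < theta -> supp nu x -> carried nu x ->
  inf (supp (push_psi theta a nu)) = psi theta a x.
Proof.
by move=> t0 s c; apply: inf_supp_eq; [exact: supp_push|exact: carried_push].
Qed.

Lemma extremal_of_dense nu x : finite_moments nu -> poly_dense nu ->
  locally_bounded nu -> supp nu x -> extremal_mass nu x.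
Proof.
move=> fm d lb s; apply: extremal_mass_dense => // A mA; apply: d.
exact: L2_indic.
Qed.

Lemma dense_of_extremal nu x : finite_moments nu -> carried nu x ->
  locally_bounded nu -> extremal_mass nu x -> poly_dense nu.
Proof.
by move=> fm c lb em f Lf; apply: (papprox_all fm c) => //; exact: extremal_mass_recip.
Qed.

Section Krein_Friedrichs.
Variables (gamma : nat -> R) (alpha beta : {measure set R -> \bar R}).
Hypothesis KF : Krein_Friedrichs_pair gamma alpha beta.
Let b := inf (supp beta).

Lemma pair_basic : [/\ H_indeterminate gamma, H_representing gamma alpha,
  H_representing gamma beta, ~ measure_eq alpha beta &
  [/\ poly_dense alpha, poly_dense beta, carried alpha 0 & carried beta 0]].
Proof. by have [_ /N_extremal_plusP[? ? ? ?] /N_extremal_plusP[? ? ? ?] ? _] := KF. Qed.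

(** The Krein measure serves as the second representing measure on [0, +oo[. *)
Lemma Friedrichs_locally_bounded : locally_bounded beta.
Proof.
have [_ ha hb ne [_ _ ca cb]] := pair_basic.
apply: (locally_bounded_two hb.1 ha.1 cb ca); first exact: H_representing_same hb ha.
by move=> /measure_eq_sym.
Qed.

Lemma Friedrichs_inf : [/\ supp beta b, carried beta b & 0 <= b].
Proof.
have [hi _ hb _ [_ _ _ cb]] := pair_basic.
exact: inf_suppP (H_indet_supp hi hb) cb.
Qed.

(** Otherwise [exists_extremal] yields an N-extremal measure on [y, +oo[, whose
    support begins beyond both alpha and beta. *)
Lemma Friedrichs_inf_maximal y : b < y ->
  exists q, \int[beta]_t (('X - y%:P) * q ^+ 2).[t] < 0.
Proof.
move=> by_; apply: contrapT => nq.
have form q : 0 <= \int[beta]_t (('X - y%:P) * q ^+ 2).[t].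
  by rewrite leNgt; apply/negP => h; apply: nq; exists q.
have [hi ha hb ne [da db ca cb]] := pair_basic.
have lb := Friedrichs_locally_bounded.
have [sb cbb b0] := Friedrichs_inf.
have [rho [fr cr mm em m0]] := exists_extremal hb.1 lb form.
have hr := same_H_representing hb fr mm.
have lr := locally_bounded_same mm lb.
have cr0 : carried rho 0 by apply: carried_le cr _; lra.
have dr := dense_of_extremal fr cr lr em.
have nr : N_extremal_plus gamma rho by apply/N_extremal_plusP.
have [_ _ yr] := inf_suppP (H_indet_supp hi hr) cr.
have [_ _ _ _ [a0 max]] := KF.
have nra : ~ measure_eq rho alpha.
  by move=> /supp_eq e; move: yr; rewrite e -a0; lra.
have nrb : ~ measure_eq rho beta.
  by move=> /supp_eq e; move: yr; rewrite e -/b; lra.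
have /andP[_] := max _ nr nra nrb; rewrite -/b; lra.
Qed.

(** The forms int (t - x) q^2 depend on gamma only. *)
Lemma carried_le_Friedrichs_inf nu x : H_representing gamma nu -> carried nu x ->
  x <= b.
Proof.
move=> hn cx; rewrite leNgt; apply/negP => /Friedrichs_inf_maximal[q].
have [_ _ hb _ _] := pair_basic.
by rewrite (H_representing_same hb hn) ltNge form_ge0//; case: hn.
Qed.

Lemma Friedrichs_unique nu : H_representing gamma nu -> carried nu b ->
  measure_eq nu beta.
Proof.
move=> hn cn; apply: measure_eq_sym.
have [_ _ hb _ _] := pair_basic.
have [_ cbb _] := Friedrichs_inf; have lb := Friedrichs_locally_bounded.
apply: (unique_of_small_form hb.1 hn.1 cbb cn (H_representing_same hb hn) lb) => e e0.
by apply: Friedrichs_inf_maximal; rewrite ltrDl.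
Qed.

Lemma exists_extremal_below x : x < b -> exists kappa, [/\ H_representing gamma kappa,
  poly_dense kappa, carried kappa x & supp kappa x].
Proof.
move=> xb; have [_ _ hb _ _] := pair_basic.
have [_ cbb _] := Friedrichs_inf; have lb := Friedrichs_locally_bounded.
have [kappa [fk ck mm em m0]] : exists rho : {measure set R -> \bar R},
    [/\ finite_moments rho, carried rho x, same_moments beta rho,
        extremal_mass rho x & 0 < mass rho [set x]].
  apply: exists_extremal => //; first by case: hb.
  by move=> q; apply: form_ge0; [case: hb|apply: carried_le cbb _; exact: ltW].
exists kappa; split=> //.
- exact: same_H_representing mm.
- exact: dense_of_extremal ck (locally_bounded_same mm lb) em.
- by apply: supp_point; rewrite lt0e measure_ge0 andbT; apply/eqP => k0;
    move: m0; rewrite /mass k0 ltxx.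
Qed.

(** By density both measures have extremal mass at x, the common beginning of
    their supports. *)
Lemma dense_unique nu rho x : H_representing gamma nu -> H_representing gamma rho ->
  poly_dense nu -> poly_dense rho -> carried nu x -> carried rho x ->
  supp nu x -> supp rho x -> measure_eq nu rho.
Proof.
move=> hn hr dn dr cn cr sn sr.
have [_ _ hb _ _] := pair_basic.
have lb := Friedrichs_locally_bounded.
have ln : locally_bounded nu by apply: locally_bounded_same lb; exact: H_representing_same hb hn.
have lr : locally_bounded rho by apply: locally_bounded_same lb; exact: H_representing_same hb hr.
apply: (unique_of_support_point hn.1 hr.1 cn cr (H_representing_same hn hr) ln).
  exact: extremal_of_dense hn.1 dn ln sn.
exact: extremal_of_dense hr.1 dr lr sr.
Qed.

(** The support cannot begin after b, and begins at b for beta only. *)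
Lemma inf_supp_lt nu : H_representing gamma nu ->
  ~ measure_eq nu beta -> supp nu !=set0 -> has_lbound (supp nu) ->
  inf (supp nu) < b.
Proof.
move=> hn ne s0 [x lx].
have cx : carried nu x by apply/carried_supp.
have [_ ci _] := inf_suppP s0 cx.
rewrite lt_neqAle (carried_le_Friedrichs_inf hn ci) andbT.
by apply/eqP => e; apply: ne; apply: Friedrichs_unique hn _; rewrite -e.
Qed.

End Krein_Friedrichs.

End N_extremal_measures.

Theorem theorem2p2p3 (R : realType) (theta a : R) (theta_gt0 : 0 < theta)
    (gamma : nat -> R) (gammaS : S_indeterminate gamma)
    (beta : {measure set R -> \bar R})
    (betaF : Friedrichs_measure gamma beta) :
  let c := psi theta a (inf (supp beta)) in
  [/\ H_indeterminate (transform theta a gamma),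
      0 < c ->
        S_indeterminate (transform theta a gamma) /\
        Friedrichs_measure (transform theta a gamma) (push_psi theta a beta),
      c = 0 -> S_determinate (transform theta a gamma) &
      c < 0 -> ~ Stieltjes (transform theta a gamma)].
Proof.
rewrite /=; set b := inf (supp beta); set c := psi theta a b.
have [alpha KF] := betaF.
have [hi ha hb ne [da db ca cb]] := pair_basic KF.
have [sbb cbb b0] : [/\ supp beta b, carried beta b & 0 <= b] := Friedrichs_inf KF.
have t0 : theta != 0 by rewrite gt_eqF.
have hi' : H_indeterminate (transform theta a gamma).
  apply: (H_indet_two (H_representing_push theta a ha) (H_representing_push theta a hb)).
  by move=> e; apply: ne; exact: push_inj e.
have hb' := H_representing_push theta a hb.
have psi0 : psi theta a (- a) = 0 by rewrite /psi addNr mulr0.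
have pull0 rho : carried rho 0 -> carried (pull theta a rho) (- a).
  by move=> cr; apply: carried_pull; rewrite ?psi0.
have cE : c = theta * (b + a) by [].
have cb' : carried (push_psi theta a beta) c by exact: carried_push.
split=> // [c0|c0|c0].
- have ab : - a < b by move: c0; rewrite cE pmulr_rgt0//; lra.
  (* The image of kappa is the Krein measure: psi maps - a to 0. *)
  have [kappa [hk dk ck sk]] := exists_extremal_below KF ab.
  have ck' : carried (push_psi theta a kappa) 0 by rewrite -psi0; exact: carried_push.
  have infk : inf (supp (push_psi theta a kappa)) = 0.
    by rewrite -psi0; exact: inf_supp_push.
  have infb : inf (supp (push_psi theta a beta)) = c by exact: inf_supp_push.
  have cb0 := carried_le cb' (ltW c0).
  have hk' := H_representing_push theta a hk.
  have nkb : ~ measure_eq (push_psi theta a kappa) (push_psi theta a beta).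
    by move=> /supp_eq e; move: c0; rewrite -infb -e infk ltxx.
  have Si : S_indeterminate (transform theta a gamma).
    split; first by exists (push_psi theta a beta); apply/S_representingP.
    move=> [mu [_ all]]; apply: nkb.
    apply: measure_eq_trans (all _ _) (measure_eq_sym (all _ _));
      exact/S_representingP.
  split=> //; exists (push_psi theta a kappa); split=> //.
  + exact: N_extremal_plus_push.
  + exact: N_extremal_plus_push.
  + split=> // rho /N_extremal_plusP[_ hr dr cr] nk nb.
    have hp := H_representing_pull t0 hb hr.
    have cp := pull0 _ cr.
    have dp : poly_dense (pull theta a rho).
      by apply: poly_dense_push => //; [rewrite invr_eq0|case: hr].
    have [sy cy xy] := inf_suppP (H_indet_supp hi hp) cp.
    set y := inf _ in sy cy xy.
    have sy' : supp rho (psi theta a y).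
      rewrite -(supp_eq (push_pull a rho t0)); exact: supp_push.
    have cy' : carried rho (psi theta a y).
      have := carried_push a theta_gt0 cy; rewrite /carried => <-.
      by apply/esym/push_pull => //; exact: measurable_lt.
    rewrite infk infb (inf_supp_eq sy' cy') -psi0 /c /psi !ltr_pM2l// !ltrD2r.
    rewrite lt_neqAle xy andbT; apply/andP; split.
      apply/eqP => e; apply: nk; apply: push_eq_pull => //.
      move: sk ck; rewrite e => sk ck.
      exact: (dense_unique KF hp hk dp dk cy ck sy sk).
    apply: (inf_supp_lt KF) => //.
    * by move=> e; apply: nb; exact: push_eq_pull.
    * by exists y.
    * by exists (- a); apply/carried_supp.
- have bE : b = - a.
    by move/eqP: c0; rewrite cE mulf_eq0 (negbTE t0)/= addr_eq0 => /eqP.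
  exists (push_psi theta a beta); split.
    by apply/S_representingP; split=> //; rewrite -c0.
  move=> mu /S_representingP[hm cm]; apply: push_eq_pull => //.
  apply: (Friedrichs_unique KF); first exact: (H_representing_pull t0 hb hm).
  by rewrite -/b bE; exact: pull0.
- move=> [rho /S_representingP[hr cr]].
  have := carried_le_Friedrichs_inf KF (H_representing_pull t0 hb hr) (pull0 _ cr).
  by move: c0; rewrite cE pmulr_rlt0// -/b; lra.
Qed.
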